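(* Let $u$ be a weight on $\mathbb R$ and $w$ a weight on $(0,\infty)$. If $H:\Lambda^p_u(w)\to\Lambda^{p,\infty}_u(w)$ is bounded for some $0<p<\infty$, then for every $r>p$, $$H:\Lambda^r_u(w)\to\Lambda^r_u(w)$$ is bounded.
   Context: A weight $u$ on $\mathbb R$ is locally integrable with $u>0$ a.e.; $u(E)=\int_Eu$. A weight $w$ on $(0,\infty)$ is nonnegative locally integrable, $W(t)=\int_0^tw$. $f^*_u(t)=\inf\{y>0:u(\{|f|>y\})\le t\}$; $\|f\|_{\Lambda^p_u(w)}=\left(\int_0^\infty(f^*_u)^pw\right)^{1/p}$, $\|f\|_{\Lambda^{p,\infty}_u(w)}=\sup_{t>0}f^*_u(t)W(t)^{1/p}$, and the spaces consist of the measurable $f$ with finite quasi-norm. $Hf(x)=\frac1\pi\lim_{\varepsilon\to0^+}\int_{|x-y|>\varepsilon}\frac{f(y)}{x-y}dy$; ''$H:X\to Y$ is bounded'' means $Hf$ is defined a.e. for every $f\in X$ and $\|Hf\|_Y\le C\|f\|_X$. *)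

(* Defs.v *)
From HB Require Import structures.
From mathcomp Require Import all_boot all_order all_algebra.
From mathcomp Require Import all_classical all_reals all_analysis.
Import Order.TTheory GRing.Theory Num.Theory.
Import numFieldNormedType.Exports.
Local Open Scope classical_set_scope.
Local Open Scope ring_scope.

Section LorentzHilbert.
Context {R : realType}.
Local Notation mu := (@lebesgue_measure R).

Definition weight_R (u : R -> R) : Prop :=
  [/\ measurable_fun setT u,
      (forall K : set R, compact K -> mu.-integrable K (EFin \o u))
    & {ae mu, forall x, 0 < u x}].

(* A weight w on (0,oo): nonnegative, locally integrable on (0,oo)
   (integrable on every compact subset of (0,oo)).  Values of w outside
   (0,oo) are irrelevant. *)
Definition weight_pos (w : R -> R) : Prop :=
  [/\ measurable_fun (`]0%R, +oo[ : set R) w,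
      (forall t, 0 < t -> 0 <= w t)
    & (forall K : set R, compact K -> K `<=` (`]0%R, +oo[ : set R) ->
         mu.-integrable K (EFin \o w))].

Definition umeas (u : R -> R) (E : set R) : \bar R :=
  (\int[mu]_(x in E) (u x)%:E)%E.

Definition Wfun (w : R -> R) (t : R) : \bar R :=
  (\int[mu]_(s in (`]0%R, t] : set R)) (w s)%:E)%E.

(* f^*_u(t) = inf { y > 0 : u({|f| > y}) <= t }  (inf of the empty set = +oo) *)
Definition rearr (u f : R -> R) (t : R) : \bar R :=
  ereal_inf (EFin @` [set y : R | 0 < y /\
                        (umeas u [set x | (y < `|f x|)%R] <= t%:E)%E]).

Definition lorentz_norm (u w : R -> R) (p : R) (f : R -> R) : \bar R :=
  poweR (\int[mu]_(t in (`]0%R, +oo[ : set R)) (poweR (rearr u f t) p * (w t)%:E))%E p^-1.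

Definition weak_lorentz_norm (u w : R -> R) (p : R) (f : R -> R) : \bar R :=
  ereal_sup ((fun t => (rearr u f t * poweR (Wfun w t) p^-1)%E) @` (`]0%R, +oo[ : set R)).

Definition hilbert_pv (f : R -> R) (x l : R) : Prop :=
  (\forall eps \near 0^'+,
     mu.-integrable [set y | eps < `|x - y|] (fun y => (f y / (x - y))%:E)) /\
  (pi^-1 * Rintegral mu [set y | eps < `|x - y|] (fun y => f y / (x - y)))
    @[eps --> 0^'+] --> l.

(* H : X -> Y bounded, X and Y given by their quasi-norms (the spaces
   consist of the measurable functions with finite quasi-norm):
   for every f in X, Hf is defined a.e., is (a.e. equal to) a measurable
   function, and ||Hf||_Y <= C ||f||_X. *)
Definition hilbert_bounded (NX NY : (R -> R) -> \bar R) : Prop :=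
  exists C : R, forall f : R -> R,
    measurable_fun setT f -> (NX f < +oo)%E ->
    exists Hf : R -> R,
      [/\ measurable_fun setT Hf,
          {ae mu, forall x, hilbert_pv f x (Hf x)}
        & (NY Hf <= C%:E * NX f)%E].

End LorentzHilbert.

(* Main.v *)
Require Import Defs.
From HB Require Import structures.
From mathcomp Require Import all_boot all_order all_algebra.
From mathcomp Require Import all_classical all_reals all_analysis measurable_realfun.
From mathcomp Require Import ring lra.
Set Implicit Arguments.
Unset Strict Implicit.
Unset Printing Implicit Defensive.
Import Order.TTheory GRing.Theory Num.Theory.
Import numFieldNormedType.Exports.
Local Open Scope classical_set_scope.
Local Open Scope ring_scope.

(** Write [Phi E = W (u E)].  The [r]-th power of the quasi-norm of [f] in
    [Lambda^r_u(w)] is comparable with the dyadic sum of [e^(r k) Phi {|f| > e^k}]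
    over the integers [k], so that the hypothesis is a weak type [(p, p)] estimate
    for the set function [Phi].  Tested on the indicator of the longest of three
    consecutive intervals of equal [u]-measure, it shows that [W] is doubling,
    hence that [Phi] is quasi-subadditive.

    Let [q = 3 p / 2].  For the boundary values [g], [h] of the real and
    imaginary parts of a polynomial in [i / (x + i)], Cotlar's identity turns the
    weak estimate into [e^(2 p t) Phi {|h| > e^t} <= C D_q g] when [g] is bounded,
    where [D_q] is the dyadic sum with exponent [q].  By a Bernstein approximation
    such [g] are dense, so that every [g] with [|g| <= 1] and bounded support
    satisfies [Phi {|H g| > e^2} <= C D_q g].  Truncating [f] at height [e^k] and
    summing over [k], with exponent [q] below and [p] above the height, yields the
    strong estimate for [p < r < q]; iteration reaches all [r > p].  A function
    of unbounded support is handled through its truncations to [-N, N], because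
    the weak estimate on [-1/2, 1/2] for [sgn(y) |f(y)|] bounds the integral of
    [|f(y) / y|] over [|y| > 1].  If [W] is infinite then the Lorentz spaces are
    trivial. *)

(** * Sums over the integers *)

(** Interpolation needs an estimate on each side of [r], while the hypothesis offers only the
    exponent [p]. The second estimate comes from the algebra of analytic boundary values: [g h] is
    half the imaginary part of [(g + i h)^2], so a weak bound with exponent [p] for the transform of
    [g h] controls [h^2], that is, [h] with exponent [2 p]. Splitting the level [e^(3 m)] of [g h]
    into the levels [e^(2 m - n)] of [g] and [e^(m + n)] of [h] puts the weight
    [e^(3 p m) = e^(q (2 m))] on [g]; this is the origin of [q = 3 p / 2]. The shift [n] makes the
    returning part of [h] small enough to be absorbed. Absorption requires a finite bound
    beforehand, hence an explicit class of bounded functions. Since [Phi] is only quasi-subadditive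
    and [p] may be less than 1, neither a norm nor duality is available; sets are joined two at a
    time. It is not even clear at first that a function decaying like [1 / x^2] lies in the space:
    the weak estimate itself shows it, tested on the indicator of [[-1, 1]]. *)

Section zsum.
Context {R : realType}.
Implicit Types (a b : int -> \bar R) (m : int).

Definition zsum a : \bar R := (\esum_(k in [set: int]) a k)%E.

Lemma zsum_ge0 a : (forall k, 0 <= a k)%E -> (0 <= zsum a)%E.
Proof. by move=> a0; apply: esum_ge0. Qed.

Lemma le_zsum a b : (forall k, a k <= b k)%E -> (zsum a <= zsum b)%E.
Proof. by move=> ab; apply: le_esum => k _. Qed.

Lemma zsumD a b : (forall k, 0 <= a k)%E -> (forall k, 0 <= b k)%E ->
  zsum (fun k => a k + b k)%E = (zsum a + zsum b)%E.
Proof. by move=> a0 b0; apply: esumD. Qed.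

Lemma zsumZ (c : R) a : 0 <= c -> (forall k, 0 <= a k)%E ->
  zsum (fun k => c%:E * a k)%E = (c%:E * zsum a)%E.
Proof.
move=> c0 a0; rewrite /zsum /esum -ereal_supZl//; last first.
  by apply/set0P; exists (\sum_(k \in set0) a k)%E; exists set0 => //; exact: fsets_set0.
congr ereal_sup; apply/seteqP; split => [x [F FS <-]|x [_ [F FS <-] <-]].
  by exists (\sum_(k \in F) a k)%E; [exists F | rewrite ge0_mule_fsumr].
by exists F => //; rewrite ge0_mule_fsumr.
Qed.

Lemma zsum_term a k : (forall k, 0 <= a k)%E -> (a k <= zsum a)%E.
Proof.
move=> a0; apply: esum_ge; exists [set k]; first by split => //; exact: finite_set1.
by rewrite fsbig_set1.
Qed.

Lemma zsum_exchange (a : int -> int -> \bar R) : (forall i j, 0 <= a i j)%E ->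
  zsum (fun i => zsum (a i)) = zsum (fun j => zsum (fun i => a i j)).
Proof.
move=> a0; rewrite /zsum !esum_esum//.
rewrite (@reindex_esum R _ _ [set: int * int] _ (fun x => (x.2, x.1)))//.
  by rewrite (_ : [set: int * int] = setT `*`` (fun=> setT))//; apply/seteqP.
split => //.
  by move=> [x1 x2] [y1 y2] _ _ [-> ->].
by move=> [x y] _; exists (y, x).
Qed.

Lemma zsum_inj (e : int -> int) a : injective e -> (forall k, 0 <= a k)%E ->
  (zsum (a \o e) <= zsum a)%E.
Proof.
move=> ie a0; rewrite /zsum -(@esum_image _ _ _ setT e a); last by move=> x y _ _ /ie.
rewrite [leRHS](esumID (range e))// setTI leeDl//; exact: esum_ge0.
Qed.

Lemma zsum_bij (e : int -> int) a : bijective e -> zsum (a \o e) = zsum a.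
Proof.
move=> [g eK gK]; rewrite /zsum [RHS](@reindex_esum R _ _ setT _ e)//.
split => //; first by move=> x y _ _ /(can_inj eK).
by move=> x _; exists (g x).
Qed.

Lemma zsum_shift a j : zsum (fun k => a (k + j)) = zsum a.
Proof.
apply: (@zsum_bij (fun k => k + j)).
by exists (fun k => k - j) => k; [rewrite addrK | rewrite subrK].
Qed.

(** Even numbers enumerate 0, 1, 2, ... and odd ones -1, -2, ...; a sum over the integers becomes a
    series, which gives its measurability in a parameter and its exchange with an integral in
    [dsum_integral]. *)
Definition int_of_nat (n : nat) : int := if odd n then Negz n./2 else Posz n./2.

Lemma zsum_nat a : (forall k, 0 <= a k)%E ->
  zsum a = (\sum_(n <oo) a (int_of_nat n))%E.
Proof.
move=> a0; rewrite nneseries_esumT// /zsum (@reindex_esum R _ _ setT _ int_of_nat)//.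
split => //.
  move=> n m _ _; rewrite /int_of_nat => nm; rewrite -(odd_double_half n) -(odd_double_half m).
  by move: nm; case: (odd n) (odd m) => -[]// [->].
move=> [n|n] _; first by exists n.*2 => //; rewrite /int_of_nat odd_double doubleK.
by exists n.*2.+1 => //; rewrite /int_of_nat /= odd_double /= uphalf_double.
Qed.

Lemma le_zsum_nat (e : nat -> int) a (P : pred int) :
  injective e -> (forall k, 0 <= a k)%E -> (forall k, P k <-> exists n, e n = k) ->
  zsum (fun k => if P k then a k else 0%E) = (\sum_(n <oo) a (e n))%E.
Proof.
move=> ie a0 Pe; rewrite nneseries_esumT// -(@esum_image _ _ _ setT e a); last by move=> x y _ _ /ie.
rewrite [RHS]esum_mkcond /zsum; apply: eq_esum => k _.
case: ifPn => [/Pe[n <-]|nP]; first by rewrite mem_set//; exists n.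
by rewrite memNset//; apply: contra_not (negP nP) => -[n _ en]; apply/Pe; exists n.
Qed.

Lemma geo_series_le (q : R) : 0 <= q -> q < 1 ->
  (\sum_(n <oo) (q ^+ n)%:E <= ((1 - q)^-1)%:E)%E.
Proof.
move=> q0 q1; apply: lime_le.
  by apply: is_cvg_nneseries => n _ _; rewrite lee_fin exprn_ge0.
near=> n; rewrite sumEFin lee_fin.
have q1' : 0 < 1 - q by rewrite subr_gt0.
rewrite -(ler_pM2l q1') divff ?gt_eqF//.
suff -> : (1 - q) * (\sum_(0 <= i < n) q ^+ i) = 1 - q ^+ n by rewrite gerBl exprn_ge0.
elim: {+}n => [|k IH]; first by rewrite big_nil mulr0 expr0 subrr.
by rewrite big_nat_recr//= mulrDr IH exprS; ring.
Unshelve. all: by end_near. Qed.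

Definition geo (c : R) : R := (1 - expR (- c))^-1.

Lemma geo_gt0 (c : R) : 0 < c -> 0 < geo c.
Proof. by move=> c0; rewrite invr_gt0 subr_gt0 -expR0 ltr_expR oppr_lt0. Qed.

Lemma zsum_geo_le (c : R) m : 0 < c ->
  (zsum (fun k => if (k <= m)%R then (expR (c * k%:~R))%:E else 0%E) <=
   (geo c * expR (c * m%:~R))%:E)%E.
Proof.
move=> c0; rewrite (@le_zsum_nat (fun n => m - n%:Z)); last 3 first.
- by move=> x y /addrI /oppr_inj [].
- by move=> k; rewrite lee_fin expR_ge0.
- move=> k; split => [km|[n <-]]; last by rewrite gerBl.
  exists (absz (m - k)); rewrite gez0_abs ?subr_ge0//; ring.
under eq_eseriesr => n _.
  have -> : expR (c * (m - n%:Z)%:~R) = expR (c * m%:~R) * expR (- c) ^+ n.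
    rewrite -expRM_natl -expRD; congr (expR _).
    by rewrite intrD mulrDr mulrNz -pmulrn; congr (_ + _); rewrite mulrN mulrN mulrC.
  rewrite EFinM; over.
rewrite nneseriesZl//.
rewrite [geo c * _]mulrC EFinM; apply: lee_wpmul2l; first by rewrite lee_fin expR_ge0.
by apply: geo_series_le; rewrite ?expR_ge0// -[ltRHS]expR0 ltr_expR oppr_lt0.
Qed.

Lemma zsum_geo_ge (c : R) m : 0 < c ->
  (zsum (fun k => if (m <= k)%R then (expR (- c * k%:~R))%:E else 0%E) <=
   (geo c * expR (- c * m%:~R))%:E)%E.
Proof.
move=> c0; have := @zsum_geo_le c (- m) c0.
rewrite -(@zsum_bij -%R); last by exists -%R => k; rewrite opprK.
rewrite mulrNz mulrN -mulNr; apply: le_trans; apply: le_zsum => k /=.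
by rewrite lerN2 mulrNz mulrN mulNr.
Qed.

Lemma zsum_single a j : (forall k, 0 <= a k)%E ->
  zsum (fun k => if k == j then a k else 0%E) = a j.
Proof.
move=> a0; rewrite /zsum (esumID [set j])//; last by move=> k _; case: ifP.
rewrite !setTI esum_set1 ?eqxx// esum1 ?adde0// => k /= /eqP/negPf kj.
by rewrite kj.
Qed.

(** Compares levels at all integers with levels at multiples of 3. As only an inequality is wanted,
    it suffices that every [k] is incident to some block [m]; the sum over incident pairs is then
    exchanged. *)
Lemma zsum_mod3 a : (forall k, 0 <= a k)%E ->
  (zsum a <= zsum (fun m => a (3 * m)%R + a (3 * m + 1)%R + a (3 * m + 2)%R))%E.
Proof.
move=> a0; pose P (k m : int) := [|| k == 3 * m, k == 3 * m + 1 | k == 3 * m + 2].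
apply: (@le_trans _ _ (zsum (fun k => zsum (fun m => if P k m then a k else 0%E)))).
  apply: le_zsum => k; pose m := (k %/ 3)%Z.
  have Pk : P k m.
    have [r rE r3] : exists2 r : nat, (k %% 3)%Z = r%:Z & (r < 3)%N.
      exists (absz (k %% 3)%Z); first by rewrite gez0_abs// modz_ge0.
      by rewrite -ltz_nat gez0_abs ?modz_ge0// ltz_mod.
    rewrite /P (divz_eq k 3) -/m mulrC rE; case: r r3 {rE} => [|[|[|r]]]//= _.
    - by rewrite addr0 eqxx.
    - by rewrite eqxx orbT.
    - by rewrite eqxx !orbT.
  rewrite [X in (X <= _)%E](_ : _ = if P k m then a k else 0%E); last by rewrite Pk.
  by apply: zsum_term => j; case: ifP.
rewrite zsum_exchange; last by move=> i j; case: ifP.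
have ge0 j k : (0 <= if k == j then a k else 0%E)%E by case: ifP.
apply: le_zsum => m; apply: (@le_trans _ _ (zsum (fun k =>
    (if k == (3 * m)%R then a k else 0) + (if k == (3 * m + 1)%R then a k else 0) +
    (if k == (3 * m + 2)%R then a k else 0)))%E).
  apply: le_zsum => k; rewrite /P; case: ifP => [|_]; last by rewrite !adde_ge0 ?ge0.
  case/or3P => ->; first by rewrite -addeA leeDl// ?adde_ge0 ?ge0.
    by rewrite [X in (X + _)%E]addeC -addeA leeDl// ?adde_ge0 ?ge0.
  by rewrite addeC leeDl// ?adde_ge0 ?ge0.
rewrite zsumD; [|by move=> k; rewrite adde_ge0 ?ge0|exact: ge0].
rewrite zsumD; [|exact: ge0|exact: ge0].
by rewrite !zsum_single.
Qed.

End zsum.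

(** * Principal values *)

Section line_integrals.
Context {R : realType}.
Local Notation mu := (@lebesgue_measure R).
Local Notation mset := (set (measurableTypeR R)).
Implicit Types (f F : R -> R) (x : R).

Lemma Rintegral_lim (D : nat -> mset) (E : mset) f :
  (forall n, measurable (D n)) -> measurable E -> mu.-integrable E (EFin \o f) ->
  (forall n, D n `<=` E) -> (forall x, E x -> \forall n \near \oo, D n x) ->
  Rintegral mu (D n) f @[n --> \oo] --> Rintegral mu E f.
Proof.
move=> mD mE intf DE Dlim.
have mf := measurable_int mu intf.
pose fn (n : nat) := (EFin \o f) \_ (D n).
have [|||||_ _ H] := @dominated_convergence _ _ _ mu E mE fn (EFin \o f) (fun y => `|(EFin \o f) y|%E).
- move=> n; apply/(measurable_restrict _ (mD n) mE).
  by apply: measurable_funS mf => //; exact: subIsetr.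
- by [].
- apply/aeW => y Ey; apply: cvg_near_cst.
  have := Dlim y Ey; apply: filterS => n Dy.
  by rewrite /fn patchE mem_set.
- exact: integrable_abse.
- apply/aeW => y n Ey; rewrite /fn patchE; case: ifPn => // _.
  by rewrite abse0.
have fin : (\int[mu]_(x in E) (EFin \o f) x)%E \is a fin_num by exact: integrable_fin_num.
rewrite /Rintegral; apply: fine_cvg; rewrite fineK//; apply: cvg_trans H.
rewrite (_ : (fun n => (\int[mu]_(x in D n) (f x)%:E)%E) =
  (fun n => \int[mu]_(x in E) fn n x)%E)//.
by apply/funext => n; rewrite /fn -[in LHS](setIidr (DE n)) integral_mkcondr.
Qed.

Lemma FTC_seg f F (a b : R) : a <= b ->
  (forall x, a <= x <= b -> is_derive x 1 F (f x)) ->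
  (forall x, a <= x <= b -> {for x, continuous f}) ->
  Rintegral mu `[a, b] f = F b - F a.
Proof.
rewrite le_eqVlt => /orP[/eqP-> _ _|ab dF cf].
  by rewrite set_itv1 Rintegral_set1 subrr.
have cF x : a <= x <= b -> {for x, continuous F}.
  by move=> /dF dFx; apply/differentiable_continuous/derivable1_diffP; exact: ex_derive.
rewrite /Rintegral (@continuous_FTC2 _ f F)//.
- apply: continuous_in_subspaceT => x; rewrite inE/= in_itv/= => xab; exact: cf.
- split.
  + move=> x; rewrite in_itv/= => /andP[ax xb].
    by have := dF x; rewrite !ltW// => /(_ isT) ?; exact: ex_derive.
  + by apply: cvg_at_right_filter; apply: cF; rewrite lexx ltW.
  + by apply: cvg_at_left_filter; apply: cF; rewrite lexx ltW.
- move=> x; rewrite in_itv/= => /andP[ax xb].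
  have := dF x; rewrite !ltW// => /(_ isT) ?.
  by rewrite derive1E derive_val.
Qed.

Lemma FTC_right f F (a l : R) :
  (forall x, a <= x -> is_derive x 1 F (f x)) ->
  (forall x, a <= x -> {for x, continuous f}) ->
  mu.-integrable `]a, +oo[ (EFin \o f) -> F x @[x --> +oo] --> l ->
  Rintegral mu `]a, +oo[ f = l - F a.
Proof.
move=> dF cf intf Fl.
have H1 : Rintegral mu `]a, a + n%:R] f @[n --> \oo] --> Rintegral mu `]a, +oo[ f.
  apply: Rintegral_lim => //.
    by move=> n x /=; rewrite !in_itv/= andbT => /andP[].
  move=> x /=; rewrite in_itv/= andbT => ax; near=> n; rewrite in_itv/= ax/= -lerBlDl.
  by near: n; exact: nbhs_infty_ger.
have H2 : Rintegral mu `]a, a + n%:R] f @[n --> \oo] --> l - F a.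
  rewrite (_ : (fun n : nat => _) = fun n => F (a + n%:R) - F a); last first.
    apply/funext => n.
    have <- : Rintegral mu `[a, a + n%:R] f = F (a + n%:R) - F a.
      apply: FTC_seg; first by rewrite lerDl.
        by move=> x /andP[ax _]; exact: dF.
      by move=> x /andP[ax _]; exact: cf.
    rewrite Rintegral_itv_obnd_cbnd//.
    apply: integrableS intf => //.
    by move=> x /=; rewrite !in_itv/= andbT => /andP[].
  apply: cvgB; last exact: cvg_cst.
  apply: (cvg_comp _ _ _ Fl); apply/cvgryPge => A; near=> n; rewrite -lerBlDl.
  by near: n; exact: nbhs_infty_ger.
exact: (cvg_unique (@Rhausdorff R) H1 H2).
Unshelve. all: by end_near. Qed.

Lemma FTC_left f F (a l : R) :
  (forall x, x <= a -> is_derive x 1 F (f x)) ->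
  (forall x, x <= a -> {for x, continuous f}) ->
  mu.-integrable `]-oo, a[ (EFin \o f) -> F x @[x --> -oo] --> l ->
  Rintegral mu `]-oo, a[ f = F a - l.
Proof.
move=> dF cf intf Fl.
have H1 : Rintegral mu `[a - n%:R, a[ f @[n --> \oo] --> Rintegral mu `]-oo, a[ f.
  apply: Rintegral_lim => //.
    by move=> n x /=; rewrite !in_itv/= => /andP[].
  move=> x /=; rewrite in_itv/= => ax; near=> n; rewrite in_itv/= ax andbT lerBlDl -lerBlDr.
  by near: n; exact: nbhs_infty_ger.
have H2 : Rintegral mu `[a - n%:R, a[ f @[n --> \oo] --> F a - l.
  rewrite (_ : (fun n : nat => _) = fun n => F a - F (a - n%:R)); last first.
    apply/funext => n.
    have <- : Rintegral mu `[a - n%:R, a] f = F a - F (a - n%:R).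
      apply: FTC_seg; first by rewrite gerBl.
        by move=> x /andP[_ ax]; exact: dF.
      by move=> x /andP[_ ax]; exact: cf.
    rewrite Rintegral_itv_bndo_bndc//.
    apply: integrableS intf => //.
    by move=> x /=; rewrite !in_itv/= => /andP[].
  apply: cvgB; first exact: cvg_cst.
  apply: (cvg_comp _ _ _ Fl); apply/cvgrNyPle => A; near=> n; rewrite lerBlDl -lerBlDr.
  by near: n; exact: nbhs_infty_ger.
exact: (cvg_unique (@Rhausdorff R) H1 H2).
Unshelve. all: by end_near. Qed.

Lemma measurable_gt (h : R -> R) c : measurable_fun setT h -> measurable ([set x | c < h x] : mset).
Proof.
move=> mh; rewrite (_ : [set x | _] = setT `&` h @^-1` `]c, +oo[); first exact: mh.
by apply/seteqP; split => y /=; rewrite in_itv/= andbT; [|case].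
Qed.

Lemma measurable_gt_norm f c : measurable_fun setT f -> measurable ([set x | c < `|f x|] : mset).
Proof. by move=> mf; apply: measurable_gt; exact: measurableT_comp. Qed.

Definition far x (e : R) : mset := [set y | e < `|x - y|].

Lemma measurable_far x (e : R) : measurable (far x e).
Proof. by apply: measurable_gt_norm; apply: measurable_funB. Qed.

Lemma farE x (e : R) : 0 <= e -> far x e = `]-oo, x - e[ `|` `]x + e, +oo[.
Proof.
move=> e0; apply/seteqP; split => y /=; rewrite /far/= !in_itv/= ?andbT lter_normr.
  by case/orP => ?; [left|right]; lra.
by case=> ?; apply/orP; [left|right]; lra.
Qed.

Lemma Rintegral_far0 x f : mu.-integrable setT (EFin \o f) ->
  Rintegral mu (far x 0) f = Rintegral mu setT f.
Proof.
move=> intf; rewrite /Rintegral; congr fine.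
rewrite [RHS](@negligible_integral _ _ _ mu _ [set x])//; last exact: lebesgue_measure_set1.
congr integral; apply/seteqP; split => y; rewrite /far/= normr_gt0 subr_eq0.
  by move=> /eqP xy; split => // yx; exact: xy.
by move=> [_ yx]; apply/eqP => xy; exact: yx.
Qed.

Lemma cvg_Rintegral_far x f : mu.-integrable setT (EFin \o f) ->
  Rintegral mu (far x e) f @[e --> 0^'+] --> Rintegral mu setT f.
Proof.
move=> intf; rewrite -(Rintegral_far0 x)//; apply/cvg_at_rightP => u [u0 ul].
apply: Rintegral_lim => //.
- by move=> n; exact: measurable_far.
- exact: measurable_far.
- by apply: integrableS intf => //; exact: measurable_far.
- by move=> n y; rewrite /far/=; apply: lt_trans.
move=> y; rewrite /far/= => xy.
by move/cvgrPdist_lt: ul => /(_ _ xy); apply: filterS => n; rewrite sub0r normrN gtr0_norm.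
Qed.

Lemma Rintegral_far_split x e f : 0 <= e -> mu.-integrable (far x e) (EFin \o f) ->
  Rintegral mu (far x e) f = Rintegral mu `]-oo, x - e[ f + Rintegral mu `]x + e, +oo[ f.
Proof.
move=> e0; rewrite farE// => intf; apply: Rintegral_setU => //.
apply/disj_setPS => y /=; rewrite !in_itv/= andbT; lra.
Qed.

(* Without the factor [pi^-1] of [hilbert_pv]. *)
Definition pvint f x (l : R) : Prop :=
  (\forall e \near (0 : R)^'+, mu.-integrable (far x e) (fun y => (f y / (x - y))%:E)) /\
  Rintegral mu (far x e) (fun y => f y / (x - y)) @[e --> (0 : R)^'+] --> l.

Lemma hilbert_pvE f x l : hilbert_pv f x l <-> pvint f x (pi * l).
Proof.
have pi0 : (pi : R) != 0 by rewrite gt_eqF// pi_gt0.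
split=> -[H1 H2]; split => //.
  rewrite (_ : (fun e => _) = fun e => pi * (pi^-1 * Rintegral mu (far x e) (fun y => f y / (x - y)))).
    exact: cvgMl_tmp H2.
  by apply/funext => e; rewrite mulrA divff// mul1r.
rewrite -[l](mulKf pi0); exact: cvgMl_tmp H2.
Qed.

Lemma pvint_unique f x l l' : pvint f x l -> pvint f x l' -> l = l'.
Proof. by move=> [_ H] [_ H']; exact: (cvg_unique (@Rhausdorff R) H H'). Qed.

Lemma pvintD f g x a b : pvint f x a -> pvint g x b -> pvint (fun y => f y + g y) x (a + b).
Proof.
move=> [F1 F2] [G1 G2]; split.
  near=> e; under eq_fun do rewrite mulrDl EFinD.
  by apply: integrableD; [exact: measurable_far|near: e|near: e].
apply: cvg_trans (cvgD F2 G2); apply: near_eq_cvg; near=> e.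
rewrite [LHS](_ : _ = Rintegral mu (far x e) (fun y => f y / (x - y)) +
  Rintegral mu (far x e) (fun y => g y / (x - y)))// -RintegralD//; last 3 first.
  exact: measurable_far.
  by near: e.
  by near: e.
by apply: eq_Rintegral => y _; rewrite mulrDl.
Unshelve. all: by end_near. Qed.

Lemma pvintZ f x a (c : R) : pvint f x a -> pvint (fun y => c * f y) x (c * a).
Proof.
move=> [F1 F2]; split.
  near=> e; under eq_fun do rewrite -mulrA EFinM.
  by apply: integrableZl; [exact: measurable_far|near: e].
have H : c * Rintegral mu (far x e) (fun y => f y / (x - y)) @[e --> (0 : R)^'+] --> c * a.
  exact: cvgMl_tmp F2.
apply: cvg_trans H; apply: near_eq_cvg; near=> e.
rewrite -RintegralZl//; last 2 first.
  exact: measurable_far.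
  by near: e.
by apply: eq_Rintegral => y _; rewrite mulrA.
Unshelve. all: by end_near. Qed.

Lemma pvint_integrable f x : mu.-integrable setT (fun y => (f y / (x - y))%:E) ->
  pvint f x (Rintegral mu setT (fun y => f y / (x - y))).
Proof.
move=> intf; split; last exact: cvg_Rintegral_far.
by near=> e; apply: integrableS intf => //; exact: measurable_far.
Unshelve. all: by end_near. Qed.

End line_integrals.

(** * Boundary values of polynomials in i / (x + i) *)

Section bell.
Context {R : realType}.
Local Notation mu := (@lebesgue_measure R).
Local Notation mset := (set (measurableTypeR R)).
Implicit Types (x y : R).

(** [bt] and [bs] are the real and imaginary parts of [z = i / (x + i)] on the line: pi times the
    Poisson kernel and its conjugate at height 1. *)
Definition bt x : R := (1 + x ^+ 2)^-1.
Definition bs x : R := x * bt x.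

Lemma oneDsq_gt0 x : 0 < 1 + x ^+ 2.
Proof. by rewrite ltr_pwDl// sqr_ge0. Qed.

Lemma bt_gt0 x : 0 < bt x.
Proof. by rewrite invr_gt0 oneDsq_gt0. Qed.

Lemma bt_le1 x : bt x <= 1.
Proof. by rewrite invf_le1 ?oneDsq_gt0// lerDl sqr_ge0. Qed.

Lemma btE x : (1 + x ^+ 2) * bt x = 1.
Proof. by rewrite divff// gt_eqF// oneDsq_gt0. Qed.

Lemma bs_bt x : x * bs x = 1 - bt x.
Proof. by rewrite -(btE x) /bs; ring. Qed.

(** The identity [|z|^2 = Re z]: the line is mapped into the circle with diameter [[0, 1]]. *)
Lemma bs2_bt2 x : bs x ^+ 2 + bt x ^+ 2 = bt x.
Proof. by rewrite -[RHS]mulr1 -(btE x) /bs; ring. Qed.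

Lemma continuous_bt : continuous bt.
Proof.
move=> x; apply: cvgV; first by rewrite gt_eqF// oneDsq_gt0.
by apply: cvgD; [exact: cvg_cst|apply: exprn_continuous].
Qed.

Lemma continuous_bs : continuous bs.
Proof. by move=> x; apply: cvgM; [exact: cvg_id|exact: continuous_bt]. Qed.

Lemma is_derive_bt x : is_derive x 1 bt (- 2 * bs x * bt x).
Proof.
have h : is_derive x 1 (fun y : R => 1 + y ^+ 2) (2 * x).
  by apply: is_derive_eq; rewrite !(scaler0, add0r, addr0, scalerDr, mulrDl)/= /GRing.scale/=; ring.
apply: is_derive_eq; first by apply: is_deriveV h; rewrite gt_eqF// oneDsq_gt0.
by rewrite /bs /bt /GRing.scale/= -exprVn; ring.
Qed.

Lemma is_derive_bs x : is_derive x 1 bs (bt x ^+ 2 - bs x ^+ 2).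
Proof.
have h := is_derive_bt x.
have : is_derive x 1 (fun y : R => y * bt y) (bt x ^+ 2 - bs x ^+ 2).
  apply: is_derive_eq; rewrite /GRing.scale/= -{2}(bs2_bt2 x).
  rewrite (_ : x * (_ * _ * _) = - 2 * (bs x * (x * bt x))); last by ring.
  by rewrite -/(bs x); ring.
by [].
Qed.

Fixpoint zpow n x : R * R := if n is m.+1
  then (bt x * (zpow m x).1 - bs x * (zpow m x).2, bs x * (zpow m x).1 + bt x * (zpow m x).2)
  else (1, 0).

(* [zre n] and [zim n] are the boundary values on the line of the real and
   imaginary parts of [z ^ n], [z = i / (x + i)]. *)
Definition zre n x := (zpow n x).1.
Definition zim n x := (zpow n x).2.

Lemma zreS n x : zre n.+1 x = bt x * zre n x - bs x * zim n x. Proof. by []. Qed.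
Lemma zimS n x : zim n.+1 x = bs x * zre n x + bt x * zim n x. Proof. by []. Qed.
Lemma zre1 x : zre 1 x = bt x. Proof. by rewrite zreS /zre /zim/=; ring. Qed.
Lemma zim1 x : zim 1 x = bs x. Proof. by rewrite zimS /zre /zim/=; ring. Qed.

Lemma zpowD m n x : zre (m + n) x = zre m x * zre n x - zim m x * zim n x /\
  zim (m + n) x = zim m x * zre n x + zre m x * zim n x.
Proof.
elim: m => [|m [IH1 IH2]].
  by rewrite add0n /zre /zim/=; split; ring.
by rewrite addSn !zreS !zimS IH1 IH2; split; ring.
Qed.

Lemma zpow_norm n x : zre n x ^+ 2 + zim n x ^+ 2 = bt x ^+ n.
Proof.
elim: n => [|n IH]; first by rewrite /zre /zim/=; ring.
by rewrite zreS zimS [RHS]exprS -IH -[X in _ = X * _](bs2_bt2 x); ring.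
Qed.

Lemma continuous_zpow n : continuous (zre n) /\ continuous (zim n).
Proof.
elim: n => [|n [c1 c2]]; first by split=> x; exact: cvg_cst.
have [ct cs] := (continuous_bt, continuous_bs).
by split=> x; [apply: cvgB|apply: cvgD]; apply: cvgM; solve [exact: ct|exact: cs|exact: c1|exact: c2].
Qed.

(** From [z' = i z^2] follows [(z^n)' = i n z^(n + 1)], which provides primitives for the powers
    from 2 on. *)
Lemma is_derive_zpow n x : is_derive x 1 (zre n) (- n%:R * zim n.+1 x) /\
  is_derive x 1 (zim n) (n%:R * zre n.+1 x).
Proof.
elim: n => [|n [d1 d2]].
  by rewrite oppr0 !mul0r; split; exact: is_derive_cst.
have [dt ds] := (is_derive_bt x, is_derive_bs x).
split.
  have : is_derive x 1 (fun y => bt y * zre n y - bs y * zim n y) (- n.+1%:R * zim n.+2 x).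
    apply: is_derive_eq; rewrite /GRing.scale/= !zreS !zimS ?zreS -(@natr1 R n); ring.
  by [].
have : is_derive x 1 (fun y => bs y * zre n y + bt y * zim n y) (n.+1%:R * zre n.+2 x).
  apply: is_derive_eq; rewrite /GRing.scale/= !zreS !zimS ?zreS -(@natr1 R n); ring.
by [].
Qed.

Lemma integral_bt : Rintegral mu setT bt = pi /\ mu.-integrable setT (EFin \o bt).
Proof.
have E : (\int[mu]_x (bt x)%:E = pi%:E)%E.
  rewrite ge0_symfun_integralT.
  - rewrite -set_itvcy.
    have := @integral0y_oneDsqr R; rewrite /oneDsqr => ->.
    by rewrite -EFinM mulrCA divff ?mulr1.
  - by move=> x; rewrite ltW// bt_gt0.
  - exact: continuous_bt.
  - by move=> x; rewrite /bt/= sqrrN.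
split; first by rewrite /Rintegral E.
apply/integrableP; split; first by apply/measurable_EFinP; exact: continuous_measurable_fun continuous_bt.
under eq_integral => x _ do rewrite gee0_abs ?lee_fin ?ltW ?bt_gt0//.
by rewrite E ltry.
Qed.

Lemma cvgy_inv (x : R) : (y - x)^-1 @[y --> +oo] --> (0 : R).
Proof.
apply/cvgrPdist_lt => e e0; near=> y.
have h : x + e^-1 < y by near: y; apply: nbhs_pinfty_gt; rewrite num_real.
have yx : e^-1 < y - x by rewrite ltrBrDl.
have yx0 : 0 < y - x by apply: lt_trans yx; rewrite invr_gt0.
by rewrite sub0r normrN gtr0_norm ?invr_gt0// -[ltRHS]invrK ltf_pV2// posrE invr_gt0.
Unshelve. all: by end_near. Qed.

Lemma cvgNy_inv (x : R) : (y - x)^-1 @[y --> -oo] --> (0 : R).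
Proof.
have H : - (y - (- x))^-1 @[y --> +oo] --> - (0 : R) by apply: cvgN; exact: cvgy_inv.
rewrite oppr0 in H; apply/cvgNy_compNP; apply: cvg_trans H.
rewrite (_ : _ \o _ = fun y => - (y - (- x))^-1)//.
by apply/funext => y /=; rewrite -invrN; congr (_^-1); ring.
Qed.

Lemma cvgNy_atan : (@atan R) y @[y --> -oo] --> - (pi / 2).
Proof.
have H : - (@atan R) y @[y --> +oo] --> - (pi / 2 : R) by apply: cvgN; exact: cvgy_atan.
apply/cvgNy_compNP; apply: cvg_trans H.
rewrite (_ : _ \o _ = fun y => - atan y)//.
by apply/funext => y /=; rewrite atanN.
Qed.

Lemma measurable_inv : measurable_fun setT (@GRing.inv R).
Proof.
rewrite (_ : GRing.inv = fun x : R => x * (x ^+ 2) `^ (-1)).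
  apply: measurable_funM => //.
  by apply: (@measurableT_comp _ _ _ _ _ _ (fun y : R => y `^ (-1))); [exact: measurable_powR|exact: exprn_measurable].
apply/funext => x; rewrite powR_inv1 ?sqr_ge0//.
by have [->|x0] := eqVneq x 0; [rewrite invr0 mul0r|rewrite expr2 invfM mulrA divff ?mul1r].
Qed.

Lemma le_integrable_far x (e : R) (f g : R -> R) : 0 < e -> measurable_fun setT f ->
  mu.-integrable setT (EFin \o g) -> (forall y, `|f y| <= g y) ->
  mu.-integrable (far x e) (fun y => (f y / (x - y))%:E).
Proof.
move=> e0 mf intg fg.
apply: (@le_integrable _ _ _ mu _ _ _ (fun y => (e^-1 * g y)%:E)).
- exact: measurable_far.
- apply: (@measurable_funS _ _ _ _ setT) => //.
  apply/measurable_EFinP; apply: measurable_funM => //.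
  by apply: (measurableT_comp measurable_inv); exact: measurable_funB.
- move=> y; rewrite /far/= => xy; rewrite lee_fin normrM normfV mulrC [leRHS]ger0_norm; last first.
    by rewrite mulr_ge0 ?invr_ge0 ?(le_trans _ (fg y))// ltW.
  have xy0 : 0 < `|x - y| by exact: lt_trans xy.
  by apply: ler_pM => //; rewrite lef_pV2 ?posrE// ltW.
have : mu.-integrable setT (fun y => (e^-1)%:E * (EFin \o g) y)%E by exact: integrableZl.
by apply: integrableS => //; exact: measurable_far.
Qed.

Lemma le_bt_integrable (f : R -> R) : continuous f -> (forall y, `|f y| <= bt y) ->
  mu.-integrable setT (EFin \o f).
Proof.
move=> cf fb; apply: (le_integrable _ _ _ (proj2 integral_bt)) => //.
  by apply/measurable_EFinP; exact: continuous_measurable_fun.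
by move=> y _; rewrite lee_fin (le_trans (fb y))// ler_norm.
Qed.

(** The factor [x - y] cancels the kernel, so the principal value is an ordinary integral. In the
    induction on powers of [z] this turns the error term into an integral over the line. *)
Lemma pvint_mulx (k : R -> R) x : mu.-integrable setT (EFin \o k) ->
  pvint (fun y => (x - y) * k y) x (Rintegral mu setT k).
Proof.
move=> intk.
have E e y : 0 < e -> y \in far x e -> (x - y) * k y / (x - y) = k y.
  move=> e0; rewrite inE/= /far/= => xy; rewrite mulrAC divff ?mul1r//.
  by rewrite -normr_gt0 (lt_trans e0).
split.
  near=> e; have e0 : 0 < e by [].
  apply: (@eq_integrable _ _ _ _ _ (measurable_far x e) (EFin \o k)).
    by move=> y yfar; rewrite /= (E e).
  by apply: integrableS intk => //; exact: measurable_far.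
apply: cvg_trans (cvg_Rintegral_far x intk); apply: near_eq_cvg; near=> e.
by apply: eq_Rintegral => y yfar; rewrite (E e).
Unshelve. all: by end_near. Qed.

(** Real part of the resolvent identity [z(y) = z(x) - i (x - y) z(x) z(y)]; [bs_translate] is the
    imaginary part. *)
Lemma bt_translate x y : bt y = bt x + (x - y) * (bs x * bt y + bt x * bs y).
Proof.
have := lt0r_neq0 (oneDsq_gt0 x); have := lt0r_neq0 (oneDsq_gt0 y).
by rewrite /bs /bt => ? ?; field; apply/andP.
Qed.

Lemma bs_translate x y : bs y = bs x + (x - y) * (bs x * bs y - bt x * bt y).
Proof.
have := lt0r_neq0 (oneDsq_gt0 x); have := lt0r_neq0 (oneDsq_gt0 y).
by rewrite /bs /bt => ? ?; field; apply/andP.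
Qed.

(** By partial fractions, [bt y / (x - y)] is [bt x] times the sum of [(x + y) bt y] and
    [1 / (x - y)]. [K] is a primitive of the first summand and [G] of the whole. The logarithm is
    taken of [(x - y)^2] so that one formula serves on both sides of [x]. *)
Let K x y : R := 2^-1 * ln (1 + y ^+ 2) + x * atan y.
Let G x y : R := bt x * (K x y - 2^-1 * ln ((x - y) ^+ 2)).

Let is_derive_K x y : is_derive y 1 (K x) (bt y * (x + y)).
Proof.
have h : is_derive y 1 (fun y : R => 1 + y ^+ 2) (2 * y).
  by apply: is_derive_eq; rewrite /GRing.scale/=; ring.
have hl : is_derive y 1 ((@ln R) \o (fun y : R => 1 + y ^+ 2)) ((1 + y ^+ 2)^-1 * (2 * y)).
  by apply: is_derive1_comp; apply: is_derive1_ln; exact: oneDsq_gt0.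
have : is_derive y 1 (fun y => 2^-1 * ((@ln R) \o (fun y : R => 1 + y ^+ 2)) y + x * atan y)
   (bt y * (x + y)).
  apply: is_derive_eq; rewrite /GRing.scale/= -/(bt y).
  by field.
by [].
Qed.

Let is_derive_G x y : y != x -> is_derive y 1 (G x) (bt y / (x - y)).
Proof.
move=> yx; have xy : x - y != 0 by rewrite subr_eq0 eq_sym.
have h : is_derive y 1 (fun y : R => (x - y) ^+ 2) (- 2 * (x - y)).
  by apply: is_derive_eq; rewrite /GRing.scale/=; ring.
have hl : is_derive y 1 ((@ln R) \o (fun y : R => (x - y) ^+ 2)) (((x - y) ^+ 2)^-1 * (- 2 * (x - y))).
  by apply: is_derive1_comp; apply: is_derive1_ln; rewrite exprn_even_gt0.
have hK := is_derive_K x y.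
have : is_derive y 1 (fun y => bt x * (K x y - 2^-1 * ((@ln R) \o (fun y : R => (x - y) ^+ 2)) y))
   (bt y / (x - y)).
  apply: is_derive_eq; rewrite /GRing.scale/= /bt.
  have := lt0r_neq0 (oneDsq_gt0 x); have := lt0r_neq0 (oneDsq_gt0 y) => ? ?.
  by field; apply/and3P.
by [].
Qed.

(** The quotient [(1 + y^2) / (x - y)^2] in terms of [v = 1 / (y - x)], so that both limits at
    infinity become [v -> 0]. *)
Let P x (v : R) : R := 1 + 2 * x * v + (1 + x ^+ 2) * v ^+ 2.

Let cvg_lnP (F : set_system R) x : ProperFilter F -> (\forall y \near F, y != x) ->
  (y - x)^-1 @[y --> F] --> (0 : R) ->
  2^-1 * ln (1 + y ^+ 2) - 2^-1 * ln ((x - y) ^+ 2) @[y --> F] --> (0 : R).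
Proof.
move=> FF Fx Fv.
have H : 2^-1 * ln (P x ((y - x)^-1)) @[y --> F] --> 2^-1 * ln (P x 0).
  apply: cvgMl_tmp; apply: (@cvg_comp _ _ _ (fun y => (y - x)^-1) (fun v => ln (P x v)) _ _ _ Fv).
  apply: (@continuous_comp _ _ _ (P x) (@ln R)); last first.
    by apply: continuous_ln; rewrite /P expr0n/= !mulr0 !addr0.
  apply: cvgD; [apply: cvgD; [exact: cvg_cst|apply: cvgMl_tmp; exact: cvg_id]|].
  by apply: cvgMl_tmp; apply: exprn_continuous.
rewrite (_ : 2^-1 * ln (P x 0) = 0) in H; last first.
  by rewrite /P expr0n/= !mulr0 !addr0 ln1 mulr0.
apply: cvg_trans H; apply: near_eq_cvg; near=> y.
have yx : y != x by near: y.
have yx0 : y - x != 0 by rewrite subr_eq0.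
have y2 : 0 < (x - y) ^+ 2 by rewrite exprn_even_gt0//= subr_eq0 eq_sym.
rewrite -mulrBr -ln_div ?posrE ?oneDsq_gt0//; congr (_ * ln _).
have xy0 : x - y != 0 by rewrite subr_eq0 eq_sym.
rewrite /P; field.
by rewrite yx0 xy0.
Unshelve. all: by end_near. Qed.

Let cvg_G (F : set_system R) x l : ProperFilter F -> (\forall y \near F, y != x) ->
  (y - x)^-1 @[y --> F] --> (0 : R) -> (@atan R) y @[y --> F] --> l ->
  G x y @[y --> F] --> bt x * (x * l).
Proof.
move=> FF Fx Fv Fa; apply: cvgMl_tmp.
rewrite (_ : (fun y => _) = fun y => (2^-1 * ln (1 + y ^+ 2) - 2^-1 * ln ((x - y) ^+ 2)) + x * atan y).
  by rewrite -[x * l]add0r; apply: cvgD; [exact: cvg_lnP|exact: cvgMl_tmp].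
by apply/funext => y; rewrite /K; ring.
Qed.

Lemma pvint_bt x : pvint bt x (pi * bs x).
Proof.
have intf e : 0 < e -> mu.-integrable (far x e) (fun y => (bt y / (x - y))%:E).
  move=> e0; apply: (@le_integrable_far _ _ _ bt) => //.
  - by apply: continuous_measurable_fun; exact: continuous_bt.
  - exact: proj2 integral_bt.
  - by move=> y; rewrite ger0_norm// ltW// bt_gt0.
split; first by near=> e; apply: intf.
have cf y : y != x -> {for y, continuous (fun y => bt y / (x - y))}.
  move=> yx; apply: cvgM; first exact: continuous_bt.
  by apply: cvgV; [rewrite subr_eq0 eq_sym|apply: cvgB; [exact: cvg_cst|exact: cvg_id]].
have E e : 0 < e -> Rintegral mu (far x e) (fun y => bt y / (x - y)) =
    pi * bs x + bt x * (K x (x - e) - K x (x + e)).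
  move=> e0; rewrite Rintegral_far_split ?(ltW e0)//; last exact: intf.
  have intfe := intf e e0; rewrite farE ?(ltW e0)// in intfe.
  have -> : Rintegral mu `]-oo, x - e[ (fun y => bt y / (x - y)) =
      G x (x - e) - bt x * (x * - (pi / 2)).
    apply: FTC_left.
    - by move=> y ye; apply: is_derive_G; rewrite lt_eqF//; lra.
    - by move=> y ye; apply: cf; rewrite lt_eqF//; lra.
    - by apply: integrableS intfe => //; exact: measurableU.
    - apply: cvg_G; [|exact: cvgNy_inv|exact: cvgNy_atan].
      by near=> y; rewrite lt_eqF//; near: y; apply: nbhs_ninfty_lt; rewrite num_real.
  have -> : Rintegral mu `]x + e, +oo[ (fun y => bt y / (x - y)) =
      bt x * (x * (pi / 2)) - G x (x + e).
    apply: FTC_right.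
    - by move=> y ye; apply: is_derive_G; rewrite gt_eqF//; lra.
    - by move=> y ye; apply: cf; rewrite gt_eqF//; lra.
    - by apply: integrableS intfe => //; exact: measurableU.
    - apply: cvg_G; [|exact: cvgy_inv|exact: cvgy_atan].
      by near=> y; rewrite gt_eqF//; near: y; apply: nbhs_pinfty_gt; rewrite num_real.
  (* The truncation is symmetric: the logarithms at [x - e] and [x + e] cancel exactly, and only the
     smooth [K] is left when [e] tends to 0. *)
  rewrite /G /bs (_ : (x - (x + e)) ^+ 2 = (x - (x - e)) ^+ 2); last by ring.
  by move: pi => q; field.
have H : pi * bs x + bt x * (K x (x - e) - K x (x + e)) @[e --> (0 : R)^'+] -->
    pi * bs x + bt x * (K x (x - 0) - K x (x + 0)).
  apply: cvg_at_right_filter.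
  have cK y : {for y, continuous (K x)}.
    by apply/differentiable_continuous/derivable1_diffP; apply: ex_derive; exact: is_derive_K.
  apply: cvgD; first exact: cvg_cst.
  apply: cvgMl_tmp; apply: cvgB.
    apply: (@continuous_comp _ _ _ (fun e => x - e) (K x)); last exact: cK.
    by apply: cvgB; [exact: cvg_cst|exact: cvg_id].
  apply: (@continuous_comp _ _ _ (fun e => x + e) (K x)); last exact: cK.
  by apply: cvgD; [exact: cvg_cst|exact: cvg_id].
rewrite subr0 addr0 subrr mulr0 addr0 in H.
apply: cvg_trans H; apply: near_eq_cvg; near=> e.
by rewrite E.
Unshelve. all: by end_near. Qed.

(** Since [|z| <= 1] and [|z|^2 = bt], the powers from 2 on are integrable; [z] itself is not, as
    [bs] decays only like [1 / x]. *)
Lemma zpow_le_bt n x : `|zre n.+2 x| <= bt x /\ `|zim n.+2 x| <= bt x.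
Proof.
have b0 := bt_gt0 x; have b1 := bt_le1 x.
have h : bt x ^+ n.+2 <= bt x ^+ 2.
  by rewrite -addn2 exprD ler_piMl ?exprn_ge0 ?exprn_ile1// ltW.
have := zpow_norm n.+2 x; have := sqr_ge0 (zre n.+2 x); have := sqr_ge0 (zim n.+2 x) => h1 h2 h3.
have b0' := ltW b0.
by split; rewrite -(@ler_pXn2r _ 2) ?nnegrE// real_normK ?num_real//; lra.
Qed.

Lemma integrable_zpow n : mu.-integrable setT (EFin \o zre n.+2) /\
  mu.-integrable setT (EFin \o zim n.+2).
Proof.
have [c1 c2] := continuous_zpow n.+2.
by split; apply: le_bt_integrable => // y; have [] := zpow_le_bt n y.
Qed.

Lemma zpow_decay n : [/\ zre n.+1 x @[x --> +oo] --> (0 : R), zre n.+1 x @[x --> -oo] --> (0 : R),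
  zim n.+1 x @[x --> +oo] --> (0 : R) & zim n.+1 x @[x --> -oo] --> (0 : R)].
Proof.
have h (f : R -> R) (F : set_system R) : ProperFilter F -> (\forall y \near F, y != 0) ->
    (y - 0)^-1 @[y --> F] --> (0 : R) -> (forall y, f y ^+ 2 <= bt y) -> f y @[y --> F] --> (0 : R).
  move=> FF F0 Fv fb; apply/cvgrPdist_lt => e e0.
  move/cvgrPdist_lt : Fv => /(_ _ e0); apply: filterS2 F0 => y y0.
  rewrite !sub0r !normrN subr0; apply: le_lt_trans.
  have y2 : 0 < y ^+ 2 by rewrite exprn_even_gt0.
  rewrite -(@ler_pXn2r _ 2) ?nnegrE// !real_normK ?num_real// (le_trans (fb y))//.
  by rewrite exprVn /bt lef_pV2 ?posrE ?oneDsq_gt0// lerDr.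
have zb x : zre n.+1 x ^+ 2 <= bt x /\ zim n.+1 x ^+ 2 <= bt x.
  have b0 := bt_gt0 x; have b1 := bt_le1 x.
  have hb : bt x ^+ n.+1 <= bt x by rewrite exprS ler_piMr ?exprn_ile1// ltW.
  have := zpow_norm n.+1 x; have := sqr_ge0 (zre n.+1 x); have := sqr_ge0 (zim n.+1 x) => h1 h2 h3.
  by split; lra.
have Fy : \forall y \near +oo, y != 0 :> R.
  by near=> y; rewrite gt_eqF//; near: y; apply: nbhs_pinfty_gt; rewrite num_real.
have FNy : \forall y \near -oo, y != 0 :> R.
  by near=> y; rewrite lt_eqF//; near: y; apply: nbhs_ninfty_lt; rewrite num_real.
split; (apply: h => //; [solve [exact: cvgy_inv|exact: cvgNy_inv]|by move=> y; have [] := zb y]).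
Unshelve. all: by end_near. Qed.

Lemma Rintegral_line0 (f F : R -> R) : continuous f -> mu.-integrable setT (EFin \o f) ->
  (forall x, is_derive x 1 F (f x)) -> F x @[x --> +oo] --> (0 : R) ->
  F x @[x --> -oo] --> (0 : R) -> Rintegral mu setT f = 0.
Proof.
move=> cf intf dF Fy FNy; rewrite -(Rintegral_far0 0)//.
rewrite Rintegral_far_split//; last by apply: integrableS intf => //; exact: measurable_far.
have -> : Rintegral mu `]-oo, 0 - 0[ f = F (0 - 0) - 0.
  by apply: FTC_left => // [x _|]; [exact: cf|exact: integrableS intf].
have -> : Rintegral mu `]0 + 0, +oo[ f = 0 - F (0 + 0).
  by apply: FTC_right => // [x _|]; [exact: cf|exact: integrableS intf].
by rewrite !subr0 !addr0 sub0r subrr.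
Qed.

Lemma Rintegral_zpow n : Rintegral mu setT (zre n.+2) = 0 /\ Rintegral mu setT (zim n.+2) = 0.
Proof.
have [i1 i2] := integrable_zpow n; have [c1 c2] := continuous_zpow n.+2.
have [d1 d2 d3 d4] := zpow_decay n.
split.
  apply: (@Rintegral_line0 (zre n.+2) (fun x => n.+1%:R^-1 * zim n.+1 x) c1 i1).
  - move=> x; have [_ ?] := is_derive_zpow n.+1 x.
    by apply: is_derive_eq; rewrite /GRing.scale/= mulrA mulVf ?mul1r.
  - by rewrite -[X in _ --> X](mulr0 n.+1%:R^-1); exact: cvgMl_tmp.
  - by rewrite -[X in _ --> X](mulr0 n.+1%:R^-1); exact: cvgMl_tmp.
apply: (@Rintegral_line0 (zim n.+2) (fun x => - n.+1%:R^-1 * zre n.+1 x) c2 i2).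
- move=> x; have [? _] := is_derive_zpow n.+1 x.
  by apply: is_derive_eq; rewrite /GRing.scale/= mulrA mulrNN mulVf ?mul1r.
- by rewrite -[X in _ --> X](mulr0 (- n.+1%:R^-1)); exact: cvgMl_tmp.
- by rewrite -[X in _ --> X](mulr0 (- n.+1%:R^-1)); exact: cvgMl_tmp.
Qed.

(** In complex form, the transform of [z^(n + 1)] is [- i pi z^(n + 1)]. Multiply the resolvent
    identity by [z(y)^(n + 1)]: the first term is [z(x)] times the induction hypothesis; in the
    second the kernel cancels and the integral of [z^(n + 2)] vanishes. At [n = 0] the imaginary
    part comes from [bs y = x bt y - (x - y) bt y] and the integral pi of [bt]. *)
Lemma pvint_zpow n x : pvint (zre n.+1) x (pi * zim n.+1 x) /\
  pvint (zim n.+1) x (- (pi * zre n.+1 x)).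
Proof.
elim: n => [|n [IH1 IH2]].
  have -> : zre 1 = bt by apply/funext => y; rewrite zre1.
  have -> : zim 1 = bs by apply/funext => y; rewrite zim1.
  split; first exact: pvint_bt.
  have [pE intb] := integral_bt.
  have := pvintD (pvintZ x (pvint_bt x)) (pvintZ (- 1) (pvint_mulx x intb)).
  rewrite pE mulrCA bs_bt.
  rewrite (_ : (fun y => _) = bs); last by apply/funext => y; rewrite /bs; ring.
  by rewrite (_ : _ + _ = - (pi * bt x))//; move: pi => q; ring.
have [i1 i2] := integrable_zpow n; have [z1 z2] := Rintegral_zpow n.
have ik (a b : R) : mu.-integrable setT (EFin \o (fun y => a * zre n.+2 y + b * zim n.+2 y)).
  rewrite (_ : _ \o _ = (fun y => a%:E * (EFin \o zre n.+2) y)%E \+ (fun y => b%:E * (EFin \o zim n.+2) y)%E)//.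
  by apply: integrableD => //; exact: integrableZl.
have zk (a b : R) : Rintegral mu setT (fun y => a * zre n.+2 y + b * zim n.+2 y) = 0.
  rewrite RintegralD ?RintegralZl ?z1 ?z2 ?mulr0 ?addr0//.
    by apply: (@integrableZl _ _ _ mu _ _ a (EFin \o zre n.+2)).
  by apply: (@integrableZl _ _ _ mu _ _ b (EFin \o zim n.+2)).
split.
  have := pvintD (pvintD (pvintZ (bt x) IH1) (pvintZ (- bs x) IH2))
    (pvint_mulx x (ik (bs x) (bt x))).
  rewrite zk addr0 [X in pvint X](_ : _ = zre n.+2); last first.
    apply/funext => y.
    rewrite [RHS](_ : _ = (bt x + (x - y) * (bs x * bt y + bt x * bs y)) * zre n.+1 y
      - (bs x + (x - y) * (bs x * bs y - bt x * bt y)) * zim n.+1 y).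
      by rewrite (zreS n.+1 y) (zimS n.+1 y); ring.
    by rewrite -bt_translate -bs_translate.
  by rewrite (_ : _ + _ = pi * zim n.+2 x)// (zimS n.+1); move: pi => q; ring.
have := pvintD (pvintD (pvintZ (bs x) IH1) (pvintZ (bt x) IH2))
    (pvint_mulx x (ik (- bt x) (bs x))).
rewrite zk addr0 [X in pvint X](_ : _ = zim n.+2); last first.
  apply/funext => y.
  rewrite [RHS](_ : _ = (bs x + (x - y) * (bs x * bs y - bt x * bt y)) * zre n.+1 y
    + (bt x + (x - y) * (bs x * bt y + bt x * bs y)) * zim n.+1 y).
    by rewrite (zreS n.+1 y) (zimS n.+1 y); ring.
  by rewrite -bt_translate -bs_translate.
by rewrite (_ : _ + _ = - (pi * zre n.+2 x))// (zreS n.+1); move: pi => q; ring.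
Qed.

End bell.

(** * Algebra of analytic boundary values and Cotlar's identity *)

Section hardy.
Context {R : realType}.
Local Notation mu := (@lebesgue_measure R).
Implicit Types (g h : R -> R).

(* Boundary values on the line of the real and imaginary parts of the complex
   polynomials without constant term in [z = i / (x + i)]. *)
Inductive hardy : (R -> R) -> (R -> R) -> Prop :=
| hardy_zpow n (a b : R) : hardy (fun x => a * zre n.+1 x - b * zim n.+1 x)
    (fun x => b * zre n.+1 x + a * zim n.+1 x)
| hardyD g h g' h' : hardy g h -> hardy g' h' ->
    hardy (fun x => g x + g' x) (fun x => h x + h' x).

Lemma hardy_continuous g h : hardy g h -> continuous g /\ continuous h.
Proof.
elim=> [n a b|g1 h1 g2 h2 _ [c1 c2] _ [c3 c4]].
  have [c1 c2] := @continuous_zpow R n.+1.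
  split=> x.
    by apply: cvgB; apply: cvgMl_tmp; [exact: c1|exact: c2].
  by apply: cvgD; apply: cvgMl_tmp; [exact: c1|exact: c2].
by split=> x; apply: cvgD; [exact: c1|exact: c3|exact: c2|exact: c4].
Qed.

Lemma hardy_measurable g h : hardy g h -> measurable_fun setT g /\ measurable_fun setT h.
Proof.
by move=> /hardy_continuous[c1 c2]; split; exact: continuous_measurable_fun.
Qed.

Lemma hardy_pvint g h x : hardy g h -> pvint g x (pi * h x) /\ pvint h x (- (pi * g x)).
Proof.
elim=> [n a b|g1 h1 g2 h2 _ [c1 c2] _ [c3 c4]].
  have [p1 p2] := @pvint_zpow R n x; split.
    have := pvintD (pvintZ a p1) (pvintZ (- b) p2).
    rewrite (_ : (fun y => _) = (fun y => a * zre n.+1 y - b * zim n.+1 y)); last first.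
      by apply/funext => y; ring.
    congr pvint; move: pi => q; ring.
  have := pvintD (pvintZ b p1) (pvintZ a p2).
  congr pvint; move: pi => q; ring.
by split; [rewrite mulrDr|rewrite mulrDr opprD]; exact: pvintD.
Qed.

Lemma hardy_bound g h : hardy g h -> exists2 C, 0 < C & forall x, g x ^+ 2 + h x ^+ 2 <= C * bt x.
Proof.
elim=> [n a b|g1 h1 g2 h2 _ [C C0 HC] _ [D D0 HD]].
  exists (a ^+ 2 + b ^+ 2 + 1) => [|x]; first by rewrite ltr_wpDl// addr_ge0// sqr_ge0.
  rewrite (_ : _ + _ = (a ^+ 2 + b ^+ 2) * (zre n.+1 x ^+ 2 + zim n.+1 x ^+ 2)); last by ring.
  rewrite zpow_norm; have b0 := bt_gt0 x; have b1 := bt_le1 x.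
  apply: ler_pM; rewrite ?addr_ge0 ?sqr_ge0 ?mulr_ge0 ?exprn_ge0// ?(ltW b0)//; first by rewrite lerDl.
  by rewrite exprS ler_piMr ?exprn_ile1// ltW.
exists (2 * (C + D)) => [|x]; first by rewrite mulr_gt0// addr_gt0.
have := HC x; have := HD x; have := sqr_ge0 (g1 x - g2 x); have := sqr_ge0 (h1 x - h2 x).
by rewrite !sqrrB !sqrrD; lra.
Qed.

Let zeroR := (fun _ : R => 0 : R).

Lemma hardyM g h g' h' : hardy g h -> hardy g' h' ->
  hardy (fun x => g x * g' x - h x * h' x) (fun x => h x * g' x + g x * h' x).
Proof.
move=> H H'; elim: H => [n a b|g1 h1 g2 h2 _ IH1 _ IH2].
  elim: H' => [m c d|g1 h1 g2 h2 _ IH1 _ IH2].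
    have := hardy_zpow (n + m.+1) (a * c - b * d) (a * d + b * c).
    congr hardy; apply/funext => x; rewrite -addSn; have [-> ->] := zpowD n.+1 m.+1 x; ring.
  by have := hardyD IH1 IH2; congr hardy; apply/funext => x; ring.
by have := hardyD IH1 IH2; congr hardy; apply/funext => x; ring.
Qed.

(** The square [(g + i h)^2] belongs to the class again and has imaginary part [2 g h]; imaginary
    parts are mapped to [- pi] times the real part, here [g^2 - h^2]. *)
Lemma hardy_cotlar g h x : hardy g h ->
  pvint (fun y => g y * h y) x (- (pi * ((g x ^+ 2 - h x ^+ 2) / 2))).
Proof.
move=> H; have [_ /(pvintZ 2^-1)] := hardy_pvint x (hardyM H H).
rewrite [X in pvint X](_ : _ = fun y => g y * h y); last by apply/funext => y; field.
rewrite [X in pvint _ _ X](_ : _ = - (pi * ((g x ^+ 2 - h x ^+ 2) / 2)))//.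
by move: pi => q; field.
Qed.

Definition hardy_re g : Prop := exists h, hardy g h.

Lemma hardy_reD g g' : hardy_re g -> hardy_re g' -> hardy_re (fun x => g x + g' x).
Proof. by move=> [h H] [h' H']; eexists; exact: hardyD H H'. Qed.

Lemma hardy_reZ c g : hardy_re g -> hardy_re (fun x => c * g x).
Proof.
move=> [h]; elim=> [n a b|g1 h1 g2 h2 _ IH1 _ IH2].
  exists (fun x => (c * b) * zre n.+1 x + (c * a) * zim n.+1 x).
  have := hardy_zpow n (c * a) (c * b); congr hardy; apply/funext => x; ring.
by have := hardy_reD IH1 IH2; congr hardy_re; apply/funext => x; ring.
Qed.

Lemma hardy_re_bt : hardy_re bt.
Proof.
exists (fun x => 0 * zre 1 x + 1 * zim 1 x); have := hardy_zpow 0 1 0; congr hardy.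
by apply/funext => x; rewrite zre1 zim1; ring.
Qed.

Lemma hardy_re_bs : hardy_re bs.
Proof.
exists (fun x => -1 * zre 1 x + 0 * zim 1 x); have := hardy_zpow 0 0 (-1); congr hardy.
by apply/funext => x; rewrite zre1 zim1; ring.
Qed.

(* [2 t z = z ^ 2 + t] with [t = bt], hence the recursion [t z ^ n.+1 =
   (z ^ n.+2 + t z ^ n) / 2]. *)
Lemma hardy_re_btM g : hardy_re g -> hardy_re (fun x => bt x * g x).
Proof.
have zh n a b : hardy_re (fun x => bt x * (a * zre n x - b * zim n x)).
  elim: n => [|n IH].
    have := hardy_reZ a hardy_re_bt; congr hardy_re; apply/funext => x.
    by rewrite /zre /zim/=; ring.
  have Z : hardy_re (fun x => a * zre n.+2 x - b * zim n.+2 x) by eexists; exact: hardy_zpow.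
  have := hardy_reZ 2^-1 (hardy_reD Z IH); congr hardy_re; apply/funext => x.
  rewrite !zreS !zimS !zreS.
  rewrite (_ : bt x * (a * zre n x - b * zim n x) =
    (bs x ^+ 2 + bt x ^+ 2) * (a * zre n x - b * zim n x)); last by rewrite bs2_bt2.
  by field.
move=> [h]; elim=> [n a b|g1 h1 g2 h2 _ IH1 _ IH2]; first exact: zh.
by have := hardy_reD IH1 IH2; congr hardy_re; apply/funext => x; ring.
Qed.

End hardy.

(** * Density *)

Section bernstein.
Context {R : realType}.
Implicit Types (psi chi : nat -> R) (t : R).

(** The expectation of [psi] at the number of successes in [n] trials of probability [t],
    conditioned on one trial. This form of the Bernstein polynomial avoids binomial coefficients and
    multiplies only by [t] and [1 - t], which is what [hardy_re_btM] can follow. *)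
Fixpoint bern n psi t : R := if n is m.+1
  then t * bern m (fun k => psi k.+1) t + (1 - t) * bern m psi t else psi 0.

Lemma bern_le n psi chi t : 0 <= t <= 1 -> (forall k, (k <= n)%N -> psi k <= chi k) ->
  bern n psi t <= bern n chi t.
Proof.
move=> /andP[t0 t1]; elim: n psi chi => [|n IH] psi chi pc /=; first exact: pc.
apply: lerD; apply: ler_wpM2l => //; rewrite ?subr_ge0//; apply: IH => k kn; apply: pc => //.
exact: leqW.
Qed.

Lemma bernD n psi chi t : bern n (fun k => psi k + chi k) t = bern n psi t + bern n chi t.
Proof. by elim: n psi chi => [//|n IH] psi chi /=; rewrite !IH; ring. Qed.

Lemma bernZ n c psi t : bern n (fun k => c * psi k) t = c * bern n psi t.
Proof. by elim: n psi => [//|n IH] psi /=; rewrite !IH; ring. Qed.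

Lemma bern_cst n c t : bern n (fun=> c) t = c.
Proof. by elim: n => [//|n IH] /=; rewrite !IH; ring. Qed.

(** The shift [a] is free because conditioning on a success replaces it by [a + 1]. Taking
    [a = - n t] leaves the variance. *)
Lemma bern_sq n a t : bern n (fun k => (k%:R + a) ^+ 2) t = (n%:R * t + a) ^+ 2 + n%:R * t * (1 - t).
Proof.
elim: n a => [|n IH] a; first by rewrite /=; ring.
rewrite /= IH (_ : (fun k : nat => _) = fun k => (k%:R + (a + 1)) ^+ 2); last first.
  by apply/funext => k; rewrite -(@natr1 R k); ring.
by rewrite IH -(@natr1 R n); ring.
Qed.

Lemma bern_norm_le n psi chi t : 0 <= t <= 1 -> (forall k, (k <= n)%N -> `|psi k| <= chi k) ->
  `|bern n psi t| <= bern n chi t.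
Proof.
move=> t01 pc; rewrite ler_norml -mulN1r -bernZ.
by apply/andP; split; apply: bern_le => // k /pc; rewrite ler_norml ?mulN1r => /andP[].
Qed.

Lemma unif_cont01 (f : R -> R) : (forall x, 0 <= x <= 1 -> {for x, continuous f}) ->
  forall eta, 0 < eta -> exists2 d, 0 < d & forall x y, 0 <= x <= 1 -> 0 <= y <= 1 ->
    `|x - y| < d -> `|f x - f y| < eta.
Proof.
move=> cf eta eta0; apply: contrapT => H.
have H1 n : exists z : R * R, [/\ 0 <= z.1 <= 1, 0 <= z.2 <= 1, `|z.1 - z.2| < n.+1%:R^-1 &
    eta <= `|f z.1 - f z.2|].
  apply: contrapT => H2; apply: H; exists n.+1%:R^-1; first by rewrite invr_gt0.
  move=> x y x01 y01 xy; rewrite ltNge; apply/negP => fxy; apply: H2.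
  by exists (x, y).
have {H1}[z zP] := choice H1.
have bz : bounded_fun (fun n => (z n).1).
  exists 1; split; first exact: num_real.
  move=> M M1 n _ /=; have [/andP[a b] _ _ _] := zP n.
  by rewrite ger0_norm// (le_trans b)// ltW.
have [k kinc /cvg_ex[/= l kl]] := bolzano_weierstrass bz.
have l01 : 0 <= l <= 1.
  by apply/andP; split; [apply: (cvgr_to_ge kl)|apply: (cvgr_to_le kl)]; apply: nearW => n /=;
    have [/andP[]] := zP (k n).
have kn n : (n <= k n)%N.
  elim: n => // n IH; apply: leq_ltn_trans IH _.
  by have := leW_mono kinc n n.+1; rewrite !ltEnat/= => ->.
have := cf l l01; move=> /cvgrPdist_lt/(_ (eta / 2)); rewrite divr_gt0// => /(_ isT).
move=> /nbhs_ballP[d /= d0 dP].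
have [n [nd nl]] : exists n, n.+1%:R^-1 < d / 2 /\ `|(z (k n)).1 - l| < d / 2.
  have d2 : 0 < d / 2 by rewrite divr_gt0.
  near \oo => n; exists n; split.
    rewrite -[ltRHS]invrK ltf_pV2 ?posrE ?invr_gt0//.
    by apply: (@lt_le_trans _ _ n%:R); [near: n; exact: nbhs_infty_gtr|rewrite ler_nat].
  rewrite distrC; near: n; move/cvgrPdist_lt: kl; exact.
have [_ _ h1 h2] := zP (k n).
have h3 : `|(z (k n)).1 - (z (k n)).2| < d / 2.
  by apply: lt_trans h1 _; apply: le_lt_trans nd; rewrite lef_pV2 ?posrE// ler_nat ltnS.
have e1 := dP (z (k n)).1; have e2 := dP (z (k n)).2; move: e1 e2.
rewrite /ball/= => e1 e2.
have {}e1 : `|f l - f (z (k n)).1| < eta / 2 by apply: e1; rewrite distrC; lra.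
have {}e2 : `|f l - f (z (k n)).2| < eta / 2.
  apply: e2; have := ler_distD (z (k n)).1 l (z (k n)).2.
  by rewrite (distrC l (z (k n)).1); lra.
have := ler_distD (f l) (f (z (k n)).1) (f (z (k n)).2).
rewrite (distrC (f (z (k n)).1) (f l)); lra.
Unshelve. all: by end_near. Qed.

Lemma bounded01 (f : R -> R) : (forall x, 0 <= x <= 1 -> {for x, continuous f}) ->
  exists2 M, 0 < M & forall x, 0 <= x <= 1 -> `|f x| <= M.
Proof.
move=> cf; have [||c _ H] := @EVT_max R (fun x => `|f x|) 0 1 => //.
  apply: continuous_in_subspaceT => x; rewrite inE/= in_itv/= => x01.
  by apply: cvg_norm; exact: cf.
exists (`|f c| + 1); first by rewrite ltr_wpDl.
by move=> x x01; rewrite (le_trans (H x _)) ?in_itv//= lerDl.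
Qed.

(* Chebyshev's inequality for the binomial law, whose variance is
   [n t (1 - t)]. *)
Lemma bern_approx (f : R -> R) : (forall x, 0 <= x <= 1 -> {for x, continuous f}) ->
  forall eta, 0 < eta -> exists n, forall t, 0 <= t <= 1 ->
    `|bern n.+1 (fun k => f (k%:R / n.+1%:R)) t - f t| <= eta.
Proof.
move=> cf eta eta0; have [M M0 fM] := bounded01 cf.
have eta2 : 0 < eta / 2 by rewrite divr_gt0.
have [d d0 fd] := unif_cont01 cf eta2.
have [n nP] : exists n, 2 * M / d ^+ 2 / n.+1%:R <= eta / 2.
  near \oo => n; exists n; rewrite ler_pdivrMr// -ler_pdivrMl//.
  by apply: (@le_trans _ _ n%:R); [near: n; exact: nbhs_infty_ger|rewrite ler_nat].
exists n => t t01; set N := n.+1%:R in nP *.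
rewrite -(bern_cst n.+1 (f t) t) -[X in _ + X]mulN1r -bernZ -bernD.
have bnd k : (k <= n.+1)%N -> `|f (k%:R / N) + -1 * f t| <=
    eta / 2 + 2 * M / d ^+ 2 / N ^+ 2 * (k%:R + - (N * t)) ^+ 2.
  move=> kn; rewrite mulN1r.
  have kN : 0 <= k%:R / N <= 1 by rewrite divr_ge0//= ler_pdivrMr// mul1r ler_nat.
  have d20 : 0 < d ^+ 2 by rewrite exprn_gt0.
  have -> : 2 * M / d ^+ 2 / N ^+ 2 * (k%:R + - (N * t)) ^+ 2 =
      2 * M * ((k%:R / N - t) ^+ 2 / d ^+ 2).
    by field; rewrite !gt_eqF.
  have q0 : 0 <= (k%:R / N - t) ^+ 2 / d ^+ 2 by rewrite divr_ge0 ?sqr_ge0// ltW.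
  have [lt|ge] := ltP `|k%:R / N - t| d.
    have h1 := fd _ _ kN t01 lt; rewrite ltW// (lt_le_trans h1)// lerDl mulr_ge0// mulr_ge0//.
    exact: ltW.
  have q1 : 1 <= (k%:R / N - t) ^+ 2 / d ^+ 2.
    by rewrite ler_pdivlMr// mul1r -(real_normK (num_real (k%:R / N - t))) ler_pXn2r ?nnegrE// ltW.
  have := ler_normB (f (k%:R / N)) (f t); have := fM _ kN; have := fM _ t01 => h1 h2 h3.
  have : 2 * M * 1 <= 2 * M * ((k%:R / N - t) ^+ 2 / d ^+ 2) by apply: ler_wpM2l => //; lra.
  by move: ((k%:R / N - t) ^+ 2 / d ^+ 2) => q h4; lra.
apply: (le_trans (bern_norm_le t01 bnd)); rewrite bernD bern_cst bernZ bern_sq -/N subrr expr0n/= add0r.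
rewrite [leRHS]splitr lerD2l.
apply: le_trans nP.
have -> : 2 * M / d ^+ 2 / N ^+ 2 * (N * t * (1 - t)) = (2 * M / d ^+ 2 / N) * (t * (1 - t)).
  by field; rewrite !gt_eqF.
have tt : t * (1 - t) <= 1 by move/andP: t01 => [t0 t1]; nra.
rewrite -[leRHS]mulr1; apply: ler_wpM2l => //.
by rewrite divr_ge0 ?divr_ge0 ?mulr_ge0 ?exprn_ge0 ?ltW.
Unshelve. all: by end_near. Qed.

End bernstein.

Lemma hardy_re_bern (R : realType) n (psi : nat -> R) (g : R -> R) : hardy_re g ->
  hardy_re (fun x => bern n psi (bt x) * g x).
Proof.
move=> hg; elim: n psi => [|n IH] psi /=; first exact: hardy_reZ.
have H1 := hardy_re_btM (IH (fun k => psi k.+1)); have H2 := IH psi.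
have := hardy_reD H1 (hardy_reD H2 (hardy_reZ (-1) (hardy_re_btM H2))).
by congr hardy_re; apply/funext => x; ring.
Qed.

(** With [t = bt x], the even part of [g] is a function of [t] and the odd part is [x] times such a
    function. Written as [al t * t] and [be t * (t * bs x)], they are approximated by replacing [al]
    and [be] with Bernstein polynomials in [t], which keeps the products in the class. Vanishing
    near 0 makes [be] continuous at [t = 1] in spite of the division by [|x|]; vanishing at infinity
    takes care of the division by powers of [t] at [t = 0]. The factors kept outside make the error
    proportional to [bt]. *)
Lemma hardy_approx (R : realType) (g : R -> R) (d L : R) : continuous g -> 0 < d -> 0 < L ->
  (forall x, `|x| <= d -> g x = 0) -> (forall x, L <= `|x| -> g x = 0) ->
  forall eta : R, 0 < eta -> exists G h, hardy G h /\ forall x, `|G x - g x| <= eta * bt x.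
Proof.
move=> cg d0 L0 gd gL eta eta0.
pose r (s : R) : R := Num.sqrt (s^-1 - 1).
have rbt x : r (bt x) = `|x| by rewrite /r /bt invrK addrAC subrr add0r sqrtr_sqr.
have cr (s : R) : 0 < s -> {for s, continuous r}.
  move=> s0; apply: (@continuous_comp _ _ _ (fun s : R => s^-1 - 1) (@Num.sqrt R)).
    by apply: cvgB; [apply: cvgV; [exact: lt0r_neq0|exact: cvg_id]|exact: cvg_cst].
  exact: sqrt_continuous.
have cz (F : R -> R) (s : R) : (\forall s' \near s, F s' = 0) -> {for s, continuous F}.
  by move=> H; rewrite /prop_for /continuous_at (nbhs_singleton H); exact: cvg_near_cst.
have cont (k : R -> R) i j : continuous k -> (forall x, `|x| <= d -> k x = 0) ->
    (forall x, L <= `|x| -> k x = 0) ->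
    forall s : R, 0 <= s <= 1 -> {for s, continuous (fun s => k (r s) / (2 * r s ^+ i * s ^+ j.+1))}.
  move=> ck kd kL s /andP[s0 s1].
  have [->|sn0] := eqVneq s 0.
    have z s' : s' < (1 + L ^+ 2)^-1 -> k (r s') / (2 * r s' ^+ i * s' ^+ j.+1) = 0.
      move=> sL; have [s'0|s'0] := ltP 0 s'.
        rewrite kL ?mul0r// /r ger0_norm ?sqrtr_ge0//.
        rewrite -[leLHS]ger0_norm ?(ltW L0)// -sqrtr_sqr ler_sqrt; last first.
          rewrite subr_ge0 invf_ge1// ltW// (lt_le_trans sL)// invf_le1 ?ltr_pwDl ?sqr_ge0//.
          by rewrite lerDl sqr_ge0.
        rewrite lerBrDl -[leLHS]invrK lef_pV2 ?posrE ?invr_gt0 ?ltr_pwDl ?sqr_ge0//.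
        exact: ltW.
      (* For [s' <= 0], with [0^-1 = 0], the radicand is negative; the root is then 0 by convention,
         and [k] vanishes there. *)
      rewrite kd ?mul0r// /r ler0_sqrtr ?normr0 ?(ltW d0)//.
      by rewrite subr_le0 (@le_trans _ _ 0)// invr_le0.
    apply: cz; apply/nbhs_ballP; exists ((1 + L ^+ 2)^-1) => [|s'] /=.
      by rewrite invr_gt0 ltr_pwDl ?sqr_ge0.
    by rewrite /ball/= sub0r normrN => h; apply: z; exact: le_lt_trans (ler_norm _) h.
  have {}s0 : 0 < s by rewrite lt_neqAle eq_sym sn0.
  have [rs|rs] := ltP (r s) d.
    apply: cz; have := cr s s0 => /(@cvgr_lt _ _ _ _ r (r s)) /(_ d rs).
    apply: filterS => s' rs'; rewrite kd ?mul0r//.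
    by rewrite ger0_norm ?sqrtr_ge0// ltW.
  have rs0 : r s != 0 by rewrite gt_eqF// (lt_le_trans d0).
  have crs := cr s s0.
  apply: cvgM; first by apply: (@continuous_comp _ _ _ r k) => //; exact: ck.
  apply: cvgV; first by rewrite !mulf_neq0 ?expf_neq0.
  apply: cvgM; last by apply: exprn_continuous.
  apply: cvgM; first exact: cvg_cst.
  by apply: (@continuous_comp _ _ _ r (fun y => y ^+ i)) => //; exact: exprn_continuous.
have cN : continuous (fun y => g (- y)).
  by move=> y; apply: (@continuous_comp _ _ _ -%R g); [exact: opp_continuous|exact: cg].
have c1 : continuous (fun y => g y + g (- y)) by move=> y; apply: cvgD; [exact: cg|exact: cN].
have c2 : continuous (fun y => g y - g (- y)) by move=> y; apply: cvgB; [exact: cg|exact: cN].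
have eta2 : 0 < eta / 2 by rewrite divr_gt0.
pose al s := (fun y => g y + g (- y)) (r s) / (2 * r s ^+ 0 * s ^+ 1).
pose be s := (fun y => g y - g (- y)) (r s) / (2 * r s ^+ 1 * s ^+ 2).
have [|n1 H1] := @bern_approx R al _ _ eta2.
  apply: cont => // x hx; first by rewrite !gd ?addr0 ?normrN.
  by rewrite !gL ?addr0 ?normrN.
have [|n2 H2] := @bern_approx R be _ _ eta2.
  apply: cont => // x hx; first by rewrite !gd ?subr0 ?normrN.
  by rewrite !gL ?subr0 ?normrN.
have [h hG] := hardy_reD
  (hardy_re_bern n1.+1 (fun k => al (k%:R / n1.+1%:R)) (@hardy_re_bt R))
  (hardy_re_bern n2.+1 (fun k => be (k%:R / n2.+1%:R)) (hardy_re_btM (@hardy_re_bs R))).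
eexists; exists h; split; first exact: hG.
move=> x; cbv beta; have b0 := bt_gt0 x; have b01 : 0 <= bt x <= 1 by rewrite ltW//= bt_le1.
have gE : g x = al (bt x) * bt x + be (bt x) * (bt x * bs x).
  rewrite /al /be /= rbt /bs.
  have [->|x0] := eqVneq x 0; first by rewrite normr0 oppr0 gd ?normr0 ?(ltW d0)//; ring.
  have bn0 : bt x != 0 by exact: lt0r_neq0.
  by have [x1|x1] := ger0P x; rewrite ?opprK; field; rewrite ?bn0 ?x0.
have {}H1 := H1 _ b01; have {}H2 := H2 _ b01.
rewrite {1}gE; move: H1 H2; set A := bern _ _ _; set B := bern _ _ _ => H1 H2.
rewrite (_ : _ - _ = (A - al (bt x)) * bt x + (B - be (bt x)) * (bt x * bs x)); last by ring.
apply: (le_trans (ler_normD _ _)); rewrite !normrM (gtr0_norm b0).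
rewrite (_ : `|x| * bt x = `|bs x|); last by rewrite /bs normrM (gtr0_norm b0).
have s1 : `|bs x| <= 1.
  by rewrite -(@ler_pXn2r _ 2) ?nnegrE// expr1n real_normK ?num_real//; have := bs2_bt2 x;
    have := bt_le1 x; have := sqr_ge0 (bt x); lra.
have h1 : `|A - al (bt x)| * bt x <= eta / 2 * bt x by rewrite ler_pM2r.
have h2 : `|B - be (bt x)| * (bt x * `|bs x|) <= eta / 2 * (bt x * 1).
  by apply: ler_pM => //; [rewrite mulr_ge0// ltW|rewrite ler_pM2l].
lra.
Unshelve. all: by end_near. Qed.

(** * Segments and exceptional sets *)

Section segments.
Context {R : realType}.
Local Notation mu := (@lebesgue_measure R).
Local Notation mset := (set (measurableTypeR R)).
Implicit Types (f g : R -> R).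

Definition seg (L : R) : mset := [set x : R | (`|x| <= L)%R].

Lemma measurable_seg L : measurable (seg L).
Proof.
rewrite (_ : seg L = `[(- L)%R, L]%classic)//.
by apply/seteqP; split => x /=; rewrite /seg/= in_itv/= ler_norml.
Qed.

Lemma ae_imp (P Q : R -> Prop) : (forall x, P x -> Q x) -> {ae mu, forall x, P x} -> {ae mu, forall x, Q x}.
Proof. by move=> PQ; exact: (@filterS _ _ (ae_filter_ringOfSetsType mu) P Q). Qed.

Lemma ae_imp2 (P Q S : R -> Prop) : (forall x, P x -> Q x -> S x) ->
  {ae mu, forall x, P x} -> {ae mu, forall x, Q x} -> {ae mu, forall x, S x}.
Proof. by move=> PQ; exact: (@filterS2 _ _ (ae_filter_ringOfSetsType mu) P Q S). Qed.

Lemma measure_seg (l : R) : 0 < l -> mu (seg l) = (2 * l)%:E.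
Proof.
move=> l0; rewrite (_ : seg l = `[(- l), l]%classic); last first.
  by apply/seteqP; split => x /=; rewrite /seg/= in_itv/= ler_norml.
rewrite lebesgue_measure_itv/= lte_fin ifT; last by lra.
by rewrite -EFinD; congr _%:E; lra.
Qed.

End segments.

(** * Principal values off the support *)

Section lower_bounds.
Context {R : realType}.
Local Notation mu := (@lebesgue_measure R).
Local Notation mset := (set (measurableTypeR R)).
Implicit Types (f g : R -> R).

Lemma integrable_bounded_support f (L M : R) : measurable_fun setT f -> (forall x, `|f x| <= M) ->
  (forall x, L < `|x| -> f x = 0) -> mu.-integrable setT (EFin \o f).
Proof.
move=> mf fM fL.
have intb : mu.-integrable setT (fun x => (M * (1 + L ^+ 2))%:E * (EFin \o bt) x)%E.
  by apply: integrableZl => //; exact: (proj2 (@integral_bt R)).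
apply: (le_integrable _ _ _ intb) => //; first exact/measurable_EFinP.
move=> x _; rewrite lee_fin [leRHS]ger0_norm; last first.
  by rewrite !mulr_ge0 ?addr_ge0 ?sqr_ge0 ?(le_trans _ (fM x)) ?(ltW (bt_gt0 x)).
have [xL|Lx] := leP `|x| L; last first.
  by rewrite fL// normr0 !mulr_ge0 ?addr_ge0 ?sqr_ge0 ?(le_trans _ (fM x)) ?(ltW (bt_gt0 x)).
apply: (le_trans (fM x)); rewrite -mulrA -[leLHS]mulr1 ler_wpM2l ?(le_trans _ (fM x))//.
rewrite -[leLHS](btE x) ler_wpM2r ?(ltW (bt_gt0 x))// lerD2l -(real_normK (num_real x)).
by rewrite ler_pXn2r ?nnegrE// (le_trans _ xL).
Qed.

Lemma measurable_div_sub f x : measurable_fun setT f -> measurable_fun setT (fun y => f y / (x - y)).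
Proof.
move=> mf; apply: measurable_funM => //.
by apply: (measurableT_comp measurable_inv); exact: measurable_funB.
Qed.

Lemma integrable_away f x (d : R) : 0 < d -> mu.-integrable setT (EFin \o f) ->
  (forall y, `|x - y| < d -> f y = 0) -> mu.-integrable setT (fun y => (f y / (x - y))%:E).
Proof.
move=> d0 intf fd; have mf : measurable_fun setT f by apply/measurable_EFinP; exact: (measurable_int mu intf).
have intb : mu.-integrable setT (fun x => (d^-1)%:E * (EFin \o f) x)%E by exact: integrableZl.
apply: (le_integrable _ _ _ intb) => //; first by apply/measurable_EFinP; exact: measurable_div_sub.
move=> y _; rewrite lee_fin !normrM normfV [leRHS]mulrC.
have [xd|dx] := ltP `|x - y| d; first by rewrite fd// normr0 !mul0r.
rewrite ler_wpM2l// [leRHS]ger0_norm ?invr_ge0 ?(ltW d0)// lef_pV2 ?posrE//.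
exact: lt_le_trans dx.
Qed.

Lemma pvint_lower f g x l (s : R) : pvint f x l ->
  mu.-integrable setT (fun y => (f y / (x - y))%:E) -> mu.-integrable setT (EFin \o g) ->
  (forall y, g y <= s * (f y / (x - y))) -> Rintegral mu setT g <= s * l.
Proof.
move=> pl intf intg gf; rewrite (pvint_unique pl (pvint_integrable intf)).
rewrite -RintegralZl//; apply: le_Rintegral => //.
have := @integrableZl _ _ _ mu _ measurableT s _ intf.
by apply: eq_integrable.
Qed.

(** Off the interval the kernel has constant sign and modulus at least [1 / T] on it, so nothing
    cancels. Both tests of the weak estimate on indicators of intervals rest on this bound. *)
Lemma pvint_indic_lower (b c T x l : R) : b < c -> pvint \1_(`[b, c]) x l -> ~ (b <= x <= c) ->
  0 < T -> `|x - b| <= T -> `|x - c| <= T -> (c - b) / T <= `|l|.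
Proof.
set J : set R := `[b, c]%classic => bc px nx T0.
rewrite !ler_norml => /andP[xb1 xb2] /andP[xc1 xc2].
have JE y : J y = (b <= y <= c) :> Prop by rewrite /J/= in_itv.
have mJ : measurable (J : mset) by exact: measurable_itv.
have intJ : mu.-integrable setT (EFin \o (\1_J : R -> R)).
  apply: (integrable_bounded_support (L := `|b| + `|c|) (M := 1)) => //.
  - by move=> y; rewrite indicE; case: (y \in J); rewrite ?normr1 ?normr0.
  move=> y hy; rewrite indicE memNset// JE => /andP[h1 h2].
  move: hy; rewrite ltNge => /negP; apply; rewrite ler_norml; have := ler_norm b; have := ler_norm c.
  by have := ler_norm (- b); have := ler_norm (- c); rewrite !normrN; lra.
have RJ : Rintegral mu setT (\1_J : R -> R) = c - b.
  have mJc : mu J = (c - b)%:E by rewrite /J lebesgue_measure_itv/= lte_fin bc.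
  by rewrite /Rintegral integral_indic// setIT; set m := (X in fine X); have -> : m = _ := mJc.
pose g y : R := T^-1 * \1_J y.
have ig : mu.-integrable setT (EFin \o g) by have := integrableZl measurableT T^-1 intJ; apply: eq_integrable.
have Ig : Rintegral mu setT g = (c - b) / T by rewrite /g RintegralZl// RJ mulrC.
have [xb|xb] := ltP x b.
  have iJ : mu.-integrable setT (fun y => (\1_J y / (x - y))%:E).
    apply: (integrable_away (d := b - x)) => //; first by rewrite subr_gt0.
    move=> y hy; rewrite indicE memNset// JE => /andP[h1 h2].
    by move: hy; rewrite distrC ger0_norm; lra.
  have := pvint_lower px iJ ig (s := -1); rewrite Ig => H.
  rewrite (le_trans (H _))//; last by rewrite mulN1r -normrN ler_norm.
  move=> y; rewrite /g indicE; case: (boolP (y \in J)); last by rewrite mulr0 mul0r mulr0.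
  rewrite inE JE => /andP[h1 h2]; rewrite mulr1 mulN1r -mulrN -invrN opprB mul1r.
  by rewrite lef_pV2 ?posrE; lra.
have cx : c < x by rewrite ltNge; apply/negP => xc; apply: nx; rewrite xb.
have iJ : mu.-integrable setT (fun y => (\1_J y / (x - y))%:E).
  apply: (integrable_away (d := x - c)) => //; first by rewrite subr_gt0.
  move=> y hy; rewrite indicE memNset// JE => /andP[h1 h2].
  by move: hy; rewrite ger0_norm; lra.
have := pvint_lower px iJ ig (s := 1); rewrite Ig => H.
rewrite (le_trans (H _))//; last by rewrite mul1r ler_norm.
move=> y; rewrite /g indicE; case: (boolP (y \in J)); last by rewrite mulr0 mul0r mulr0.
rewrite inE JE => /andP[h1 h2]; rewrite mulr1 !mul1r.
by rewrite lef_pV2 ?posrE; lra.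
Qed.

End lower_bounds.

(** * Continuous functions close in measure *)

Section continuous_approximation.
Context {R : realType}.
Local Notation mu := (@lebesgue_measure R).
Local Notation mset := (set (measurableTypeR R)).
Local Open Scope ereal_scope.

(** Closeness is asked only in measure, the notion to which [gauge_small] responds. Vanishing near 0
    and outside a bounded set is what [hardy_approx] requires of [g2]. *)
Lemma cont_approx (g : R -> R) (L eta d : R) : measurable_fun setT g -> (forall x, `|g x| <= 1)%R -> (0 < L)%R ->
  (forall x, (L < `|x|)%R -> g x = 0%R) -> (0 < eta)%R -> (0 < d)%R ->
  exists (g2 : R -> R) (r : R), [/\ continuous g2, (0 < r)%R, (forall x : R, `|g2 x| <= 1)%R,
    (forall x : R, (`|x| <= r)%R -> g2 x = 0%R) /\ (forall x : R, (L + 1 <= `|x|)%R -> g2 x = 0%R) &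
    mu [set x | (eta < `|g2 x - g x|)%R] < d%:E].
Proof.
move=> mg g1 L0 gL eta0 d0.
pose E := seg (L + 1).
have mE : measurable E by exact: measurable_seg.
have segE := measure_seg.
have intg : mu.-integrable E (EFin \o g).
  apply: (@integrableS _ _ _ _ setT) => //.
  exact: (@integrable_bounded_support _ g L 1).
have muE : mu E < +oo by rewrite /E segE ?ltry//; lra.
have [gn [cgn ign gng]] := approximation_continuous_integrable mE muE intg.
have [n nP] : exists n, \int[mu]_(z in E) `|(g z - gn n z)%:E| < (eta * (d / 2))%:E.
  have h : (0 < eta * (d / 2))%R by rewrite mulr_gt0 ?divr_gt0.
  have gng' : (\int[mu]_(z in E) `|(g z - gn n z)%:E|) @[n --> \oo] --> (0%R : R)%:E := gng.
  have /fine_cvgP[gf gc] := gng'; near \oo => n; exists n.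
  have nf : (\int[mu]_(z in E) `|(g z - gn n z)%:E|) \is a fin_num by near: n.
  by rewrite -(fineK nf) lte_fin; near: n; exact: (cvgr_lt _ gc).
(* On [|x| <= 2 r], of measure [4 r = d / 4], the cutoff may spoil the approximation; Chebyshev's
   inequality bounds the remaining bad set by [d / 2]. *)
pose r := (d / 16)%R; have r0 : (0 < r)%R by rewrite divr_gt0.
pose c (x : R) : R := Num.max (-1)%R (Num.min 1%R (gn n x)).
pose chi (x : R) : R := (Num.min 1 (Num.max 0 ((`|x| - r) / r)) * Num.min 1 (Num.max 0 (L + 1 - `|x|)))%R.
have mm0 (y : R) : (y <= 0)%R -> Num.min 1%R (Num.max 0%R y) = 0%R by move=> h; rewrite (max_l h) min_r.
have mm1 (y : R) : (1 <= y)%R -> Num.min 1%R (Num.max 0%R y) = 1%R.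
  by move=> h; rewrite max_r ?min_l// (le_trans _ h).
have cont_min (f1 f2 : R -> R) : continuous f1 -> continuous f2 -> continuous (fun x => Num.min (f1 x) (f2 x)).
  by move=> h1 h2 x; apply: continuous_min; [exact: h1|exact: h2].
have cont_max (f1 f2 : R -> R) : continuous f1 -> continuous f2 -> continuous (fun x => Num.max (f1 x) (f2 x)).
  by move=> h1 h2 x; apply: continuous_max; [exact: h1|exact: h2].
have ccst (a : R) : continuous (fun _ : R => a) by move=> x; exact: cvg_cst.
have cnorm : continuous (fun x : R => `|x|%R) by move=> x; exact: norm_continuous.
exists (fun x => chi x * c x)%R, r.
have chi01 x : (0 <= chi x <= 1)%R.
  have h (y : R) : (0 <= Num.min 1 (Num.max 0 y) <= 1)%R.
    by rewrite le_min ler01 le_max lexx/= ge_min lexx.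
  have /andP[a1 a2] := h ((`|x| - r) / r)%R; have /andP[b1 b2] := h (L + 1 - `|x|)%R.
  by rewrite /chi mulr_ge0//= -[leRHS]mulr1 ler_pM.
have c1 x : (`|c x| <= 1)%R by rewrite /c ler_norml le_max lexx/= ge_max ge_min lexx andbT; lra.
(* Clipping to [[-1, 1]] moves no value away from [g], which lies in that interval. *)
have cg x : (`|c x - g x| <= `|g x - gn n x|)%R.
  have := g1 x; rewrite ler_norml => /andP[g1x g2x].
  rewrite /c; have [h1|h1] := leP (gn n x) 1%R; last first.
    rewrite max_r; last by lra.
    by rewrite ger0_norm ?ler0_norm; lra.
  have [h2|h2] := leP (-1)%R (gn n x); first by rewrite distrC.
  by rewrite ler0_norm ?ger0_norm; lra.
have cprod : continuous (fun x => chi x * c x)%R.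
  have k1 : continuous (fun x : R => (`|x| - r) / r)%R.
    by move=> y; apply: cvgMr_tmp; apply: cvgB; [exact: cnorm|exact: cvg_cst].
  have k2 : continuous (fun x : R => L + 1 - `|x|)%R.
    by move=> y; apply: cvgB; [exact: cvg_cst|exact: cnorm].
  have k3 := cont_min _ _ (ccst 1%R) (cont_max _ _ (ccst 0%R) k1).
  have k4 := cont_min _ _ (ccst 1%R) (cont_max _ _ (ccst 0%R) k2).
  have k5 := cont_max _ _ (ccst (-1)%R) (cont_min _ _ (ccst 1%R) (cgn n)).
  by move=> x; exact: cvgM (cvgM (k3 x) (k4 x)) (k5 x).
split => //.
- move=> x; rewrite normrM -[leRHS]mulr1 ler_pM//.
  by have /andP[h1 h2] := chi01 x; rewrite ger0_norm.
- split=> x hx; rewrite /chi.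
    have h : ((`|x| - r) / r <= 0)%R by rewrite pmulr_lle0 ?invr_gt0//; lra.
    by rewrite (mm0 _ h) !mul0r.
  have h : (L + 1 - `|x| <= 0)%R by lra.
  by rewrite (mm0 _ h) mulr0 mul0r.
have sub : [set x | (eta < `|chi x * c x - g x|)%R] `<=` seg (2 * r) `|`
    (E `&` [set x | eta%:E <= `|(g x - gn n x)%:E|]).
  move=> x /= hx; have [x2|x2] := leP `|x|%R (2 * r)%R; first by left.
  right; have chi1 : (chi x = Num.min 1 (Num.max 0 (L + 1 - `|x|)))%R.
    have h : (1 <= (`|x| - r) / r)%R by rewrite ler_pdivlMr//; lra.
    by rewrite /chi (mm1 _ h) mul1r.
  have [xL1|xL1] := leP (L + 1)%R `|x|%R.
    exfalso; move: hx; rewrite chi1 (mm0 (L + 1 - `|x|)%R); last by lra.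
    by rewrite mul0r gL ?subrr ?normr0; lra.
  split; first by rewrite /E /seg/= ltW.
  rewrite lee_fin; apply: ltW; apply: (lt_le_trans hx).
  have [xL|xL] := leP `|x|%R L.
    have h : (1 <= L + 1 - `|x|)%R by lra.
    by rewrite chi1 (mm1 _ h) mul1r.
  have := cg x; rewrite gL// !subr0; apply: le_trans; rewrite normrM -[leRHS]mul1r ler_pM//.
  by have /andP[h1 h2] := chi01 x; rewrite ger0_norm.
have mgn : measurable_fun setT (fun x => g x - gn n x)%R.
  by apply: measurable_funB => //; exact: continuous_measurable_fun.
have mS : measurable (E `&` [set x | eta%:E <= `|(g x - gn n x)%:E|]).
  apply: measurableI => //; rewrite [X in measurable X](_ : _ = ~` [set x | (`|g x - gn n x| < eta)%R]).
    apply: measurableC; rewrite (_ : [set x | _] = [set x | (- eta < - `|g x - gn n x|)%R]).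
      by apply: measurable_gt; apply: measurable_funN; exact: measurableT_comp.
    by apply/seteqP; split => x /=; rewrite ltrN2.
  by apply/seteqP; split => x /=; rewrite lee_fin leNgt => /negP.
have m2 : measurable_fun setT (fun x => chi x * c x - g x)%R.
  apply: measurable_funB => //; exact: continuous_measurable_fun.
apply: (@le_lt_trans _ _ (mu (seg (2 * r) `|` (E `&` [set x | eta%:E <= `|(g x - gn n x)%:E|])))).
  apply: le_measure; rewrite ?inE//; first exact: measurable_gt_norm.
  by apply: measurableU => //; exact: measurable_seg.
apply: (le_lt_trans (measureU2 _ _ _)) => //; first exact: measurable_seg.
have mk : eta%:E * mu (E `&` [set x | eta%:E <= `|(g x - gn n x)%:E|]) < (eta * (d / 2))%:E.
  apply: le_lt_trans nP; apply: (@le_integral_abse _ _ _ mu E mE (fun x => (g x - gn n x)%:E)) => //.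
  by apply/measurable_EFinP; exact: measurable_funTS.
have mk2 : mu (E `&` [set x | eta%:E <= `|(g x - gn n x)%:E|]) < (d / 2)%:E.
  by move: mk; rewrite EFinM lte_pmul2l ?lte_fin.
set m1 := (X in X + _); have -> : m1 = (2 * (2 * r))%:E by apply: segE; rewrite mulr_gt0.
have -> : d%:E = (2 * (2 * r))%:E + (3 * d / 4)%:E by rewrite -EFinD; congr _%:E; rewrite /r; lra.
by rewrite lteD2lE//; apply: lt_trans mk2 _; rewrite lte_fin; lra.
Unshelve. all: by end_near. Qed.

End continuous_approximation.

(** * Weak estimates for a gauge *)

Section gauge.
Context {R : realType}.
Local Notation mu := (@lebesgue_measure R).
Local Notation mset := (set (measurableTypeR R)).
Local Open Scope ereal_scope.

(* Abstracts [Phi E = W (u E)], the only way in which the two weights enter the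
   real-variable part of the argument. *)
Record gauge (Phi : mset -> \bar R) (K : R) : Prop := Gauge {
  gauge_K : (1 <= K)%R ;
  gauge_ge0 : forall E, 0 <= Phi E ;
  gauge_le : forall E F : mset, measurable E -> measurable F ->
    {ae mu, forall x, E x -> F x} -> Phi E <= Phi F ;
  gauge_setU : forall E F : mset, measurable E -> measurable F ->
    Phi (E `|` F) <= K%:E * (Phi E + Phi F) ;
  gauge_fin : forall L : R, Phi (seg L) < +oo ;
  gauge_small : forall L e : R, (0 < e)%R -> exists2 d : R, (0 < d)%R &
    forall E : mset, measurable E -> E `<=` seg L -> mu E < d%:E -> Phi E <= e%:E ;
  gauge_lim : forall (E : mset) c, measurable E ->
    (forall n : nat, Phi (E `&` seg n%:R) <= c) -> Phi E <= c ;
  gauge_pos : 0 < Phi (seg 2^-1) }.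

Definition ex (a : R) : \bar R := (expR a)%:E.

Lemma exD a b : ex (a + b) = ex a * ex b. Proof. by rewrite /ex expRD EFinM. Qed.
Lemma ex_ge0 a : 0 <= ex a. Proof. by rewrite lee_fin expR_ge0. Qed.
Lemma ex_gt0 a : 0 < ex a. Proof. by rewrite lte_fin expR_gt0. Qed.
Lemma ex_le a b : (ex a <= ex b) = (a <= b)%R. Proof. by rewrite lee_fin ler_expR. Qed.
Lemma ex0 : ex 0 = 1. Proof. by rewrite /ex expR0. Qed.

Variables (Phi : mset -> \bar R) (K : R).
Hypothesis gP : gauge Phi K.
Implicit Types (f g h : R -> R).

Let K0 : (0 <= K)%R. Proof. by have := gauge_K gP; lra. Qed.

(** Levels on a logarithmic scale, so that dilations of [f] become translations of [t]. *)
Definition lev f (t : R) : \bar R := Phi [set x | (expR t < `|f x|)%R].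

(** The spacing [c] of the levels is 1 except for products, whose levels [e^(3 m)] split into
    integer levels of the two factors. *)
Definition dsum (c p : R) f : \bar R := zsum (fun k => ex (c * p * k%:~R) * lev f (c * k%:~R)).

Lemma lev_ge0 f t : 0 <= lev f t. Proof. exact: (gauge_ge0 gP). Qed.

Lemma exlev_ge0 f a t : 0 <= ex a * lev f t.
Proof. by rewrite mule_ge0 ?ex_ge0 ?lev_ge0. Qed.

Lemma dsum_ge0 c p f : 0 <= dsum c p f.
Proof. by apply: zsum_ge0 => k; exact: exlev_ge0. Qed.

Lemma measurable_lev f t : measurable_fun setT f ->
  measurable ([set x | (expR t < `|f x|)%R] : mset).
Proof. exact: measurable_gt_norm. Qed.

Lemma le_lev f g s t : measurable_fun setT f -> measurable_fun setT g ->
  {ae mu, forall x, expR s < `|f x| -> expR t < `|g x|}%R -> lev f s <= lev g t.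
Proof. by move=> mf mg fg; apply: (gauge_le gP) => //; exact: measurable_lev. Qed.

Lemma lev_mono f s t : measurable_fun setT f -> (t <= s)%R -> lev f s <= lev f t.
Proof.
by move=> mf ts; apply: le_lev => //; apply/aeW => x; apply: le_lt_trans; rewrite ler_expR.
Qed.

Lemma levU f g h a s t : measurable_fun setT f -> measurable_fun setT g -> measurable_fun setT h ->
  {ae mu, forall x, expR a < `|h x| -> (expR s < `|f x|) || (expR t < `|g x|)}%R ->
  lev h a <= K%:E * (lev f s + lev g t).
Proof.
move=> mf mg mh H; apply: le_trans (gauge_setU gP (measurable_lev s mf) (measurable_lev t mg)).
apply: (gauge_le gP); [exact: measurable_lev|by apply: measurableU; exact: measurable_lev|].
by apply: ae_imp H => x Hx /= /Hx/orP.
Qed.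

Lemma levD f g h t : measurable_fun setT f -> measurable_fun setT g -> measurable_fun setT h ->
  {ae mu, forall x, `|h x| <= `|f x| + `|g x|}%R -> lev h (t + 1) <= K%:E * (lev f t + lev g t).
Proof.
move=> mf mg mh H; apply: levU => //; apply: ae_imp H => x Hx hx.
rewrite -[X in X || _]negbK -[X in _ || X]negbK -negb_and -!leNgt; apply/negP => /andP[fx gx].
have e2 : (2 <= expR 1 :> R)%R by rewrite (le_trans _ (expR_ge1Dx 1)).
move: hx; rewrite expRD ltNge => /negP; apply.
apply: (le_trans Hx); apply: (@le_trans _ _ (expR t * 2)%R); first by lra.
by rewrite ler_pM2l// expR_gt0.
Qed.

Lemma lev0 f t : measurable_fun setT f -> {ae mu, forall x, `|f x| <= expR t}%R -> lev f t = 0.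
Proof.
move=> mf H; apply/eqP; rewrite eq_le lev_ge0 andbT.
have [d d0 /(_ set0)] := gauge_small gP 0 (@ltr01 R).
have P0 : Phi set0 <= 0.
  apply/lee_addgt0Pr => e e0; rewrite add0e; have [d1 d10 H1] := gauge_small gP 0 e0.
  by apply: H1; rewrite ?measure0 ?lte_fin.
move=> _; apply: le_trans P0; apply: (gauge_le gP) => //; first exact: measurable_lev.
by apply: ae_imp H => x Hx /=; rewrite ltNge Hx.
Qed.

Lemma le_dsum c p f g : measurable_fun setT f -> measurable_fun setT g ->
  {ae mu, forall x, `|f x| <= `|g x|}%R -> dsum c p f <= dsum c p g.
Proof.
move=> mf mg fg; apply: le_zsum => k; apply: lee_wpmul2l; first exact: ex_ge0.
by apply: le_lev => //; apply: ae_imp fg => x fx h; exact: lt_le_trans fx.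
Qed.

Lemma dsumD p f g h : measurable_fun setT f -> measurable_fun setT g -> measurable_fun setT h ->
  {ae mu, forall x, `|h x| <= `|f x| + `|g x|}%R ->
  dsum 1 p h <= (K * expR p)%:E * (dsum 1 p f + dsum 1 p g).
Proof.
move=> mf mg mh H; rewrite {1}/dsum -(zsum_shift _ 1).
rewrite -zsumD; try (move=> k; exact: exlev_ge0).
rewrite -zsumZ; [|by rewrite mulr_ge0|by move=> k; rewrite adde_ge0 ?exlev_ge0].
apply: le_zsum => k; rewrite !mul1r intrD mulrDr mulr1 exD [X in X * _]muleC -!muleA EFinM -!muleA.
rewrite (muleCA K%:E); apply: lee_wpmul2l; first exact: ex_ge0.
rewrite -muleDr//; last by rewrite ge0_adde_def ?inE ?lev_ge0.
rewrite (muleCA K%:E); apply: lee_wpmul2l; first exact: ex_ge0.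
exact: levD.
Qed.

Lemma lev_scale f a t : lev (fun x => expR a * f x)%R t = lev f (t - a).
Proof.
rewrite /lev; congr Phi; apply/seteqP; split => x /=; rewrite normrM (gtr0_norm (expR_gt0 _)) expRD expRN;
  by rewrite ltr_pdivrMr ?expR_gt0 ?(mulrC (expR a)).
Qed.

Lemma dsum_scale p f (n : int) : dsum 1 p (fun x => expR n%:~R * f x)%R = ex (p * n%:~R) * dsum 1 p f.
Proof.
rewrite /dsum -zsumZ ?expR_ge0//; last by move=> k; exact: exlev_ge0.
rewrite -[LHS](zsum_shift _ n); congr zsum; apply/funext => k.
by rewrite lev_scale !mul1r intrD mulrDr addrK exD [X in X * _]muleC muleA.
Qed.

(** Chebyshev's inequality for dyadic sums; rounding [t] down to an integer costs the factor
    [e^p]. *)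
Lemma lev_dsum (p : R) f (t : R) : measurable_fun setT f -> (0 <= p)%R ->
  ex (p * t) * lev f t <= ex p * dsum 1 p f.
Proof.
move=> mf p0; set k := Num.floor t.
have kt : (k%:~R <= t)%R by rewrite floor_le_tmp.
have tk : (t <= k%:~R + 1)%R by rewrite ltW// -[X in (_ + X)%R]/(1%:~R) -intrD; exact: lt_succ_floor.
apply: (@le_trans _ _ (ex p * (ex (p * k%:~R) * lev f k%:~R))).
  rewrite muleA -exD; apply: lee_pmul; rewrite ?ex_ge0 ?lev_ge0//.
    by rewrite ex_le -{2}[p]mulr1 -mulrDr ler_wpM2l// addrC.
  exact: lev_mono.
apply: lee_wpmul2l; first exact: ex_ge0.
have -> : ex (p * k%:~R) * lev f k%:~R = ex (1 * p * k%:~R) * lev f (1 * k%:~R) by rewrite !mul1r.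
by apply: (@zsum_term R (fun k => ex (1 * p * k%:~R) * lev f (1 * k%:~R))) => j; exact: exlev_ge0.
Qed.

Lemma lev_supp f (L t : R) : measurable_fun setT f -> (forall x, (L < `|x|)%R -> f x = 0%R) ->
  lev f t <= Phi (seg L).
Proof.
move=> mf fL; apply: (gauge_le gP); [exact: measurable_lev|exact: measurable_seg|].
apply/aeW => x /= fx; rewrite /seg/= leNgt; apply/negP => /fL f0.
by move: fx; rewrite f0 normr0 ltNge expR_ge0.
Qed.

Lemma dsum_bounded (c p : R) f (L : R) (a : int) : (0 < c)%R -> (0 < p)%R -> measurable_fun setT f ->
  (forall x, (L < `|x|)%R -> f x = 0%R) -> (forall x, (`|f x| <= expR (c * a%:~R))%R) ->
  dsum c p f <= (geo (c * p) * expR (c * p * a%:~R))%:E * Phi (seg L).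
Proof.
move=> c0 p0 mf fL fa; set B := Phi _.
have Bfin : B \is a fin_num by rewrite ge0_fin_numE ?(gauge_fin gP)//; exact: (gauge_ge0 gP).
have B0 : 0 <= B by exact: (gauge_ge0 gP).
have cp : (0 < c * p)%R by rewrite mulr_gt0.
apply: (@le_trans _ _ (B * zsum (fun k => if (k <= a)%R then (expR (c * p * k%:~R))%:E else 0))).
  rewrite -(fineK Bfin) -zsumZ ?fine_ge0//; last by move=> k; case: ifP => // _; rewrite lee_fin expR_ge0.
  apply: le_zsum => k; case: ifPn => [ka|].
    by rewrite muleC; apply: lee_wpmul2r; rewrite ?ex_ge0// fineK//; exact: lev_supp.
  rewrite -ltNge => ak; rewrite mule0 lev0 ?mule0//; apply/aeW => x; rewrite (le_trans (fa x))//.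
  by rewrite ler_expR ler_pM2l// ler_int ltW.
by rewrite muleC; apply: lee_wpmul2r => //; exact: zsum_geo_le.
Qed.

Lemma dsum_step3 (p : R) f : measurable_fun setT f -> (0 < p)%R ->
  dsum 1 p f <= (1 + expR p + expR (2 * p))%:E * dsum 3 p f.
Proof.
move=> mf p0; apply: (le_trans (zsum_mod3 _)); first by move=> k; exact: exlev_ge0.
rewrite -zsumZ; [|by rewrite !addr_ge0 ?expR_ge0|by move=> k; exact: exlev_ge0].
apply: le_zsum => m; set B := ex (3 * p * m%:~R) * lev f (3 * m%:~R).
have H (i : int) : (0 <= i)%R -> ex (1 * p * (3 * m + i)%:~R) * lev f (1 * (3 * m + i)%:~R) <= ex (p * i%:~R) * B.
  move=> i0; rewrite mul1r (_ : ex (p * (3 * m + i)%:~R) = ex (p * i%:~R) * ex (3 * p * m%:~R)); last first.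
    by rewrite -exD; congr ex; rewrite intrD intrM; ring.
  rewrite -muleA; do 2 (apply: lee_wpmul2l; first exact: ex_ge0).
  by apply: lev_mono => //; rewrite mul1r intrD intrM lerDl ler0z.
have H0 := H 0%R isT; have H1 := H 1%R isT; have H2 := H 2%R isT.
rewrite addr0 mulr0 ex0 mul1e in H0; rewrite mulr1 in H1; rewrite (mulrC p) in H2.
rewrite !EFinD; rewrite ge0_muleDl ?adde_ge0 ?ex_ge0// ge0_muleDl ?ex_ge0// mul1e.
by rewrite !leeD.
Qed.

(** If [|G H| > e^(3 m)], then [|G| > e^(2 m - n)] or [|H| > e^(m + n)]. For [G] the weight
    [e^(3 p m)] is [e^(q (2 m))] with [q = 3 p / 2]; against the bound [N e^(- 2 p (m + n))] for [H]
    it leaves [e^(p m)], summable over [m < n]. For [m >= n], [|G| <= e] forces [|H| > e^(3 m - 1)],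
    and the weight loses against [e^(- 6 p m)]. The free [n] makes the coefficient of [N] as small
    as desired. *)
Lemma dsum_mul (p : R) (G H : R -> R) (N : R) (n : int) : (0 < p)%R -> (0 <= N)%R ->
  measurable_fun setT G -> measurable_fun setT H -> (forall x, `|G x| <= expR 1)%R ->
  (forall t, ex (2 * p * t) * lev H t <= N%:E) ->
  dsum 3 p (fun x => G x * H x)%R <=
    (K * expR (3 / 2 * p * n%:~R))%:E * dsum 1 (3 / 2 * p) G +
    (N * (K * geo p * expR (- p * n%:~R) + expR (2 * p) * geo (3 * p) * expR (- (3 * p) * n%:~R)))%:E.
Proof.
move=> p0 N0 mG mH Ge HN.
have mGH : measurable_fun setT (fun x => G x * H x)%R by exact: measurable_funM.
have levH t : lev H t <= (N * expR (- (2 * p * t)))%:E.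
  rewrite EFinM muleC -lee_pdivrMl ?expR_gt0//.
  by rewrite expRN invrK; exact: HN.
pose A m := (K * expR (3 / 2 * p * n%:~R))%:E * (ex (1 * (3 / 2 * p) * (2 * m - n)%:~R) * lev G (1 * (2 * m - n)%:~R)).
pose B m := (K * N * expR (- (2 * p) * n%:~R))%:E * (if (m <= n)%R then (expR (p * m%:~R))%:E else 0).
pose D m := (N * expR (2 * p))%:E * (if (n <= m)%R then (expR (- (3 * p) * m%:~R))%:E else 0).
have if0 (b : bool) (x : R) : (0 <= x)%R -> 0 <= (if b then x%:E else 0) by case: b; rewrite // lee_fin.
have c1 : (0 <= K * expR (3 / 2 * p * n%:~R))%R by rewrite mulr_ge0.
have c2 : (0 <= K * N * expR (- (2 * p) * n%:~R))%R by rewrite !mulr_ge0.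
have c3 : (0 <= N * expR (2 * p))%R by rewrite mulr_ge0.
have A0 m : 0 <= A m by rewrite mule_ge0// exlev_ge0.
have B0 m : 0 <= B m by rewrite mule_ge0// if0.
have D0 m : 0 <= D m by rewrite mule_ge0// if0.
apply: (@le_trans _ _ (zsum (fun m => A m + B m + D m))).
  apply: le_zsum => m; have [mn|nm] := ltP m n.
    apply: (@le_trans _ _ (A m + B m)); last by rewrite leeDl.
    rewrite /A /B (ltW mn) !mul1r.
    have -> : (K * expR (3 / 2 * p * n%:~R))%:E * (ex (3 / 2 * p * (2 * m - n)%:~R) * lev G (2 * m - n)%:~R) =
        ex (3 * p * m%:~R) * (K%:E * lev G (2 * m - n)%:~R).
      rewrite EFinM -!muleA [in RHS]muleCA; congr (_ * _); rewrite muleA; congr (_ * _).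
      rewrite -EFinM -expRD; congr (expR _)%:E.
      by rewrite intrD intrM rmorphN/=; field.
    have -> : (K * N * expR (- (2 * p) * n%:~R))%:E * (expR (p * m%:~R))%:E =
        ex (3 * p * m%:~R) * (K%:E * (N * expR (- (2 * p * (m%:~R + n%:~R))))%:E).
      rewrite -!EFinM; congr _%:E.
      have -> : expR (- (2 * p * (m%:~R + n%:~R))) = (expR (- (2 * p) * n%:~R) * expR (- (2 * p) * m%:~R))%R.
        by rewrite -expRD; congr expR; ring.
      have -> : expR (p * m%:~R) = (expR (3 * p * m%:~R) * expR (- (2 * p) * m%:~R))%R.
        by rewrite -expRD; congr expR; ring.
      by ring.
    rewrite -ge0_muleDr ?mule_ge0 ?lev_ge0 ?lee_fin ?mulr_ge0//.
    rewrite -ge0_muleDr ?lev_ge0 ?lee_fin ?mulr_ge0//.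
    apply: lee_wpmul2l; first exact: ex_ge0.
    apply: (@le_trans _ _ (K%:E * (lev G (2 * m - n)%:~R + lev H (m%:~R + n%:~R)))).
      apply: levU => //; apply/aeW => x; rewrite normrM.
      apply: contraTT; rewrite negb_or -!leNgt => /andP[h1 h2].
      apply: le_trans (ler_pM _ _ h1 h2) _ => //.
      by rewrite -expRD ler_expR intrD intrM rmorphN/=; lra.
    by apply: lee_wpmul2l; rewrite ?lee_fin//; apply: leeD.
  apply: (@le_trans _ _ (D m)); last by rewrite leeDr// adde_ge0.
  rewrite /D nm.
  apply: (@le_trans _ _ (ex (3 * p * m%:~R) * lev H (3 * m%:~R - 1))).
    apply: lee_wpmul2l; first exact: ex_ge0.
    apply: le_lev => //; apply/aeW => x; rewrite normrM.
    apply: contraTT; rewrite -!leNgt => h1.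
    apply: le_trans (ler_pM _ _ (Ge x) h1) _ => //.
    by rewrite -expRD addrCA subrr addr0.
  apply: (@le_trans _ _ (ex (3 * p * m%:~R) * (N * expR (- (2 * p * (3 * m%:~R - 1))))%:E)).
    by apply: lee_wpmul2l; rewrite ?ex_ge0.
  rewrite -!EFinM lee_fin.
  rewrite (_ : (expR _ * _)%R = (N * (expR (3 * p * m%:~R) * expR (- (2 * p * (3 * m%:~R - 1)))))%R); last by ring.
  rewrite -(mulrA N) -!expRD ler_wpM2l// ler_expR; lra.
rewrite zsumD//; last by move=> m; rewrite adde_ge0.
rewrite zsumD// -addeA; apply: leeD.
  rewrite /A zsumZ//; last by move=> m; exact: exlev_ge0.
  apply: lee_wpmul2l => //.
  (* Only the indices [2 m - n], all of one parity, occur, so this sum is a part of the full one. *)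
  apply: (@zsum_inj _ (fun m => 2 * m - n)%R (fun k => ex (1 * (3 / 2 * p) * k%:~R) * lev G (1 * k%:~R))).
    by move=> i j /addIr /(mulfI (_ : 2 != 0 :> int)) ->.
  by move=> k; exact: exlev_ge0.
rewrite mulrDr EFinD; apply: leeD.
  rewrite /B zsumZ//; last by move=> m; exact: if0.
  apply: (@le_trans _ _ ((K * N * expR (- (2 * p) * n%:~R))%:E * (geo p * expR (p * n%:~R))%:E)).
    by apply: lee_wpmul2l => //; exact: zsum_geo_le.
  rewrite -EFinM lee_fin.
  have -> : expR (- p * n%:~R) = (expR (- (2 * p) * n%:~R) * expR (p * n%:~R))%R.
    by rewrite -expRD; congr expR; ring.
  by rewrite le_eqVlt; apply/orP; left; apply/eqP; ring.
rewrite /D zsumZ//; last by move=> m; exact: if0.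
apply: (@le_trans _ _ ((N * expR (2 * p))%:E * (geo (3 * p) * expR (- (3 * p) * n%:~R))%:E)).
  by apply: lee_wpmul2l => //; apply: zsum_geo_ge; rewrite mulr_gt0.
by rewrite -EFinM lee_fin !mulrA.
Qed.

Definition pv_ae f Hf := measurable_fun setT Hf /\ {ae mu, forall x, pvint f x (Hf x)}.

Lemma pv_ae_unique f H1 H2 : pv_ae f H1 -> pv_ae f H2 -> {ae mu, forall x, H1 x = H2 x}.
Proof. by move=> [_ h1] [_ h2]; apply: ae_imp2 h1 h2 => x; exact: pvint_unique. Qed.

Lemma pv_aeD f g Hf Hg : pv_ae f Hf -> pv_ae g Hg ->
  pv_ae (fun x => f x + g x)%R (fun x => Hf x + Hg x)%R.
Proof.
move=> [mf hf] [mg hg]; split; first exact: measurable_funD.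
by apply: ae_imp2 hf hg => x; exact: pvintD.
Qed.

Lemma pv_aeZ c f Hf : pv_ae f Hf -> pv_ae (fun x => c * f x)%R (fun x => c * Hf x)%R.
Proof.
by move=> [mf hf]; split; [exact: measurable_funM|apply: ae_imp hf => x; exact: pvintZ].
Qed.

(** Every representative of the transform is covered, so the estimate applies at once to a transform
    known explicitly, as for [hardy] pairs. *)
Definition weak_bound (p C : R) := forall f, measurable_fun setT f -> dsum 1 p f < +oo ->
  (exists Hf, pv_ae f Hf) /\
  forall Hf, pv_ae f Hf -> forall t, ex (p * t) * lev Hf t <= C%:E * dsum 1 p f.

Lemma dsum_expo (p q : R) f (a : int) : measurable_fun setT f -> (p <= q)%R ->
  (forall x, `|f x| <= expR a%:~R)%R -> dsum 1 q f <= ex ((q - p) * a%:~R) * dsum 1 p f.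
Proof.
move=> mf pq fa; rewrite /dsum -zsumZ ?expR_ge0//; last by move=> k; exact: exlev_ge0.
apply: le_zsum => k; rewrite !mul1r.
have [ka|ak] := leP k a.
  rewrite muleA -exD; apply: lee_wpmul2r; rewrite ?lev_ge0// ex_le.
  have : ((q - p) * k%:~R <= (q - p) * a%:~R)%R by rewrite ler_wpM2l ?subr_ge0// ler_int.
  by lra.
rewrite lev0 ?mule0//; apply/aeW => x; rewrite (le_trans (fa x))// ler_expR ler_int ltW//.
Qed.

Lemma dsum_supp_fin (c p : R) f (L : R) (a : int) : (0 < c)%R -> (0 < p)%R -> measurable_fun setT f ->
  (forall x, (L < `|x|)%R -> f x = 0%R) -> (forall x, (`|f x| <= expR (c * a%:~R))%R) ->
  dsum c p f < +oo.
Proof.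
move=> c0 p0 mf fL fa; apply: (le_lt_trans (dsum_bounded c0 p0 mf fL fa)).
rewrite lte_mul_pinfty ?lee_fin ?mulr_ge0 ?expR_ge0 ?(gauge_fin gP)//.
by rewrite ltW// geo_gt0// mulr_gt0.
Qed.

Section weak.
Variables (p C : R).
Hypotheses (p0 : (0 < p)%R) (C0 : (0 <= C)%R) (wb : weak_bound p C).

Let b : R -> R := \1_(`[(-1)%R, 1%R]).

Let bE x : b x = if (`|x| <= 1)%R then 1%R else 0%R.
Proof.
rewrite /b indicE; case: ifPn => h; first by rewrite mem_set//= in_itv/= -ler_norml.
by rewrite memNset//= in_itv/= -ler_norml; exact/negP.
Qed.

Let mb : measurable_fun setT b. Proof. exact: measurable_indic. Qed.

Let b_lower x l : (1 < `|x|)%R -> pvint b x l -> (2 / (`|x| + 1) <= `|l|)%R.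
Proof.
move=> x1 pl; have := @pvint_indic_lower _ (-1) 1 (`|x| + 1)%R x l _ pl.
rewrite (_ : 1 - -1 = 2)%R; last by rewrite opprK.
apply; rewrite -?ler_norml -?ltNge//.
- by lra.
- by rewrite opprK (le_trans (ler_normD _ _))// normr1.
- by rewrite (le_trans (ler_normB _ _))// normr1.
Qed.

Let mbt : measurable_fun setT (@bt R).
Proof. by apply: continuous_measurable_fun; exact: continuous_bt. Qed.

(** On [|x| > 1] the transform of the indicator of [[-1, 1]] is at least [2 / (|x| + 1)], which
    dominates the square root of [bt]. Up to a bounded set, the level [e^t] of [bt] thus lies in the
    level [e^(t / 2)] of the transform, whose gauge is [O(e^(- p t / 2))]; against [e^(p k)] half of
    the exponent is left to sum over [k <= 0]. *)
Lemma dsum_bt_fin : dsum 1 p bt < +oo.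
Proof.
have b1 x : (`|b x| <= expR (1 * 0%:~R))%R.
  by rewrite mulr0 expR0 bE; case: ifP; rewrite ?normr1 ?normr0.
have bL x : (1 < `|x|)%R -> b x = 0%R by rewrite bE ltNge => /negPf ->.
have bfin : dsum 1 p b < +oo by apply: (dsum_supp_fin _ _ _ bL b1).
have [[Hb [mHb pHb]] /(_ Hb (conj mHb pHb)) wHb] := wb mb bfin.
set M := C%:E * dsum 1 p b in wHb.
have M0 : 0 <= M by rewrite mule_ge0 ?dsum_ge0.
have Mfin : M < +oo by rewrite lte_mul_pinfty.
set A := K%:E * (Phi (seg 1) + M).
have A0 : 0 <= A by rewrite mule_ge0 ?adde_ge0//; exact: (gauge_ge0 gP).
have Afin : A \is a fin_num.
  by rewrite ge0_fin_numE// lte_mul_pinfty// lte_add_pinfty// (gauge_fin gP).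
have H (t : R) : (t <= 0)%R -> lev bt t <= ex (- (p * (t / 2))) * A.
  move=> t0; apply: (@le_trans _ _ (K%:E * (lev b (- 1) + lev Hb (t / 2)))).
    apply: levU => //; apply: ae_imp pHb => x px; rewrite gtr0_norm ?bt_gt0// => tx.
    have [x1|x1] := leP (`|x|)%R 1%R.
      by rewrite bE x1 normr1 expR_lt1 oppr_lt0 ltr01.
    apply/orP; right; apply: lt_le_trans (b_lower x1 px).
    rewrite -(@ltr_pXn2r _ 2) ?nnegrE ?expR_ge0 ?divr_ge0 ?addr_ge0//.
    rewrite -expRM_natl (_ : (2%:R * (t / 2) = t)%R); last by field.
    apply: (lt_le_trans tx); rewrite /bt expr_div_n ler_pdivlMr; last by rewrite exprn_gt0// addr_gt0//; lra.
    rewrite ler_pdivrMl ?oneDsq_gt0//.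
    rewrite -[X in (_ <= (1 + X) * _)%R](real_normK (num_real x)); nra.
  have e1 : 1 <= ex (- (p * (t / 2))).
    by rewrite -ex0 ex_le oppr_ge0 pmulr_rle0//; lra.
  rewrite muleCA; apply: lee_wpmul2l => //; rewrite ge0_muleDr ?(gauge_ge0 gP)//; apply: leeD.
    apply: (le_trans (lev_supp _ mb bL)); rewrite -[leLHS]mul1e; apply: lee_wpmul2r => //.
    exact: (gauge_ge0 gP).
  rewrite -[leLHS]mul1e -ex0 -(addNr (p * (t / 2))%R) exD -muleA.
  by apply: lee_wpmul2l; rewrite ?ex_ge0.
apply: (@le_lt_trans _ _ (zsum (fun k => A * (if (k <= 0)%R then (expR (p / 2 * k%:~R))%:E else 0)))).
  apply: le_zsum => k; rewrite !mul1r; case: ifPn => [k0|].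
    apply: (@le_trans _ _ (ex (p * k%:~R) * (ex (- (p * (k%:~R / 2))) * A))).
      by apply: lee_wpmul2l; rewrite ?ex_ge0// H// -[leRHS](_ : 0%:~R = _)// ler_int.
    by rewrite muleA -exD muleC; apply: lee_wpmul2l => //; rewrite ex_le; lra.
  rewrite -ltNge => k0; rewrite lev0 ?mule0//; apply/aeW => x; rewrite gtr0_norm ?bt_gt0//.
  by rewrite (le_trans (bt_le1 x))// -[leLHS]expR0 ler_expR ler0z ltW.
rewrite -(fineK Afin) zsumZ ?fine_ge0//; last by move=> k; case: ifP => // _; rewrite lee_fin expR_ge0.
rewrite lte_mul_pinfty ?lee_fin ?fine_ge0//; apply: le_lt_trans (@zsum_geo_le R (p / 2)%R 0%R _) _.
  by rewrite divr_gt0.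
exact: ltry.
Qed.

Lemma dsum_le_bt_fin f (D : R) : measurable_fun setT f -> (forall x, `|f x| <= D * bt x)%R ->
  dsum 1 p f < +oo.
Proof.
move=> mf fD; have [n Dn] : exists n : int, (D <= expR n%:~R)%R.
  exists (Num.floor D + 1)%R; apply: le_trans (expR_ge1Dx _).
  by rewrite (le_trans (ltW (lt_succ_floor D)))// intrD lerDr.
apply: (@le_lt_trans _ _ (dsum 1 p (fun x => expR n%:~R * bt x)%R)).
  apply: le_dsum => //; first exact: measurable_funM.
  apply/aeW => x; rewrite (le_trans (fD x))// ger0_norm ?mulr_ge0 ?(ltW (bt_gt0 x))//.
  by rewrite ler_wpM2r// ltW// bt_gt0.
by rewrite dsum_scale lte_mul_pinfty ?ex_ge0// dsum_bt_fin.
Qed.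

Let wb_bound f Hf t : measurable_fun setT f -> dsum 1 p f < +oo -> pv_ae f Hf ->
  ex (p * t) * lev Hf t <= C%:E * dsum 1 p f.
Proof. by move=> mf ffin pf; have [_] := wb mf ffin; apply. Qed.

Let expn_small (B : R) : (0 <= B)%R -> exists n : nat, (B * expR (- p * n%:R) <= 2^-1)%R.
Proof.
move=> B0; have [n hn] : exists n : nat, (2 * B <= 1 + p * n%:R)%R.
  exists (Num.truncn (2 * B / p)).+1.
  have h : (2 * B / p <= (Num.truncn (2 * B / p)).+1%:R)%R by rewrite ltW// truncnS_gt.
  by rewrite ler_pdivrMr// in h; lra.
exists n; rewrite mulNr expRN ler_pdivrMr ?expR_gt0//.
by have := expR_ge1Dx (p * n%:R)%R; lra.
Qed.

(* Cotlar's identity [H ^ 2 = pi ^ 2 g ^ 2 + 2 T (g H)], [H = T g], turns the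
   weak bound into an inequality for [N] in which [N] comes back with the
   factor [1 / 2]. *)
Lemma cotlar_step : exists2 A : R, (0 <= A)%R & forall g h, hardy g h ->
  (forall x, `|g x| <= expR 1)%R -> dsum 1 p g < +oo ->
  forall N : R, (0 <= N)%R -> (forall t, ex (2 * p * t) * lev (fun x => pi * h x)%R t <= N%:E) ->
  forall t, ex (2 * p * t) * lev (fun x => pi * h x)%R t <=
    A%:E * dsum 1 (3 / 2 * p) g + (N / 2)%:E.
Proof.
have gp : (0 <= geo p)%R by rewrite ltW// geo_gt0.
have g3p : (0 <= geo (3 * p))%R by rewrite ltW// geo_gt0// mulr_gt0.
set q := (3 / 2 * p)%R.
have q0 : (0 <= q)%R by rewrite mulr_ge0// ltW.
(* As [pi <= e^(pi - 1)], the bound [|g| <= e^(t - a)] gives [pi^2 g^2 <= e^(2 t - 4)]. Together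
   with [|T| <= e^(2 t - 4)], Cotlar's identity then yields [H^2 <= 3 e^(2 t - 4) <= e^(2 t)]. *)
pose a : R := (pi + 1)%R.
have pi0 := @pi_ge0 R.
have pie : (pi <= expR (pi - 1) :> R)%R by have := expR_ge1Dx (pi - 1 : R)%R; lra.
pose c3 := (1 + expR p + expR (2 * p))%R.
have c30 : (0 <= c3)%R by rewrite !addr_ge0.
pose S := (K * geo p + expR (2 * p) * geo (3 * p))%R.
have S0 : (0 <= S)%R by rewrite addr_ge0 ?mulr_ge0.
pose B := (K * (expR (4 * p) * (C * c3)))%R.
have B0 : (0 <= B)%R by rewrite !mulr_ge0.
(* The splitting parameter of [dsum_mul], large enough for the returning [N] to be halved after all
   constants. *)
have [n nP] := expn_small (mulr_ge0 B0 S0).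
pose E1 := expR (q * a + p / 2 * (1 + a) + q).
pose E2 := (K * expR (q * n%:R))%R.
have E10 : (0 <= E1)%R by exact: expR_ge0.
have E20 : (0 <= E2)%R by rewrite mulr_ge0.
exists (K * E1 + B * E2)%R; first by rewrite addr_ge0 ?mulr_ge0.
move=> g h gh ge gfin N N0 HN t.
have [mg mh] := hardy_measurable gh.
pose H x : R := (pi * h x)%R; rewrite -/H in HN *.
have mH : measurable_fun setT H by exact: measurable_funM.
have mgH : measurable_fun setT (fun x => g x * H x)%R by exact: measurable_funM.
set D := dsum 1 q g.
have D0 : 0 <= D by exact: dsum_ge0.
have Dfin : D < +oo.
  apply: (@le_lt_trans _ _ (ex ((q - p) * 1%:~R) * dsum 1 p g)).
    have pq : (p <= q)%R by rewrite /q; move: p0; lra.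
    have ge1 x : (`|g x| <= expR (1 : int)%:~R)%R by rewrite mulr1z.
    exact: (dsum_expo mg pq ge1).
  by rewrite lte_mul_pinfty ?ex_ge0.
have HgH : dsum 1 p (fun x => g x * H x)%R <= c3%:E * (E2%:E * D + (N * (S * expR (- p * n%:R)))%:E).
  apply: (le_trans (dsum_step3 mgH p0)); apply: lee_wpmul2l => //.
  apply: (le_trans (dsum_mul n p0 N0 mg mH ge HN)); apply: leeD; first by rewrite /E2 -pmulrn.
  rewrite lee_fin; apply: ler_wpM2l => //; rewrite /S [leRHS]mulrDl -pmulrn.
  apply: lerD => //; apply: ler_wpM2l; first by rewrite mulr_ge0.
  by rewrite ler_expR ler_wpM2r// lerN2; move: p0; lra.
have gHfin : dsum 1 p (fun x => g x * H x)%R < +oo.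
  apply: (le_lt_trans HgH); rewrite lte_mul_pinfty// lte_add_pinfty ?ltry//.
  by rewrite lte_mul_pinfty.
pose T x : R := (pi * - (pi * ((g x ^+ 2 - h x ^+ 2) / 2)))%R.
have mT : measurable_fun setT T.
  apply: measurable_funM => //; apply: measurable_funN; apply: measurable_funM => //.
  by apply: measurable_funM => //; apply: measurable_funB; exact: measurable_funX.
have pT : pv_ae (fun x => g x * H x)%R T.
  split => //; apply/aeW => x; have := pvintZ pi (hardy_cotlar x gh).
  by congr pvint; apply/funext => y; rewrite /H; ring.
apply: (@le_trans _ _ (ex (2 * p * t) * (K%:E * (lev g (t - a) + lev T (2 * t - 4))))).
  apply: lee_wpmul2l; first exact: ex_ge0.
  apply: levU => //; apply/aeW => x; apply: contraTT; rewrite negb_or -!leNgt => /andP[h1 h2].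
  rewrite -(@ler_pXn2r _ 2) ?nnegrE ?expR_ge0// real_normK ?num_real//.
  have e4 : (3 * expR (2 * t - 4) <= expR t ^+ 2)%R.
    have -> : (expR t ^+ 2 = expR 4 * expR (2 * t - 4))%R.
      by rewrite -expRM_natl -expRD; congr expR; ring.
    by rewrite ler_wpM2r ?expR_ge0//; have := expR_ge1Dx (4 : R); lra.
  have HE : (H x ^+ 2 = pi ^+ 2 * g x ^+ 2 + 2 * T x)%R.
    by rewrite /H /T; move: pi => z; field.
  have h3 : (pi ^+ 2 * g x ^+ 2 <= expR (2 * t - 4))%R.
    rewrite -exprMn -(real_normK (num_real (_ * _)%R)) normrM (ger0_norm pi0).
    have -> : expR (2 * t - 4) = ((expR (pi - 1) * expR (t - a)) ^+ 2)%R.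
      by rewrite -expRD -expRM_natl; congr expR; rewrite /a; ring.
    by rewrite ler_pXn2r ?nnegrE ?mulr_ge0 ?expR_ge0// ler_pM.
  by have := ler_norm (T x); lra.
rewrite muleCA ge0_muleDr ?lev_ge0//.
have H1 : ex (2 * p * t) * lev g (t - a) <= E1%:E * D.
  (* Since [|g| <= e], only [t < 1 + a] matters, and there the excess [p / 2] of the exponent [2 p]
     over [q] costs a bounded factor. *)
  have [ta|ta] := leP 1%R (t - a)%R.
    rewrite lev0 ?mule0 ?mule_ge0//; apply/aeW => x; rewrite (le_trans (ge x))//.
    by rewrite ler_expR.
  apply: (@le_trans _ _ (ex (q * a + p / 2 * (1 + a)) * (ex (q * (t - a)) * lev g (t - a)))).
    rewrite muleA -exD; apply: lee_wpmul2r; rewrite ?lev_ge0// ex_le.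
    have : (p / 2 * (t - a) <= p / 2 * 1)%R by rewrite ler_wpM2l ?divr_ge0 ?ltW.
    by rewrite /q; lra.
  rewrite [E1%:E]exD -muleA; apply: lee_wpmul2l; first exact: ex_ge0.
  exact: lev_dsum.
have H2 : ex (2 * p * t) * lev T (2 * t - 4) <=
    (expR (4 * p) * (C * c3))%:E * (E2%:E * D + (N * (S * expR (- p * n%:R)))%:E).
  have -> : ex (2 * p * t) = ex (4 * p) * ex (p * (2 * t - 4)) by rewrite -exD; congr ex; ring.
  rewrite 2!EFinM -!muleA; apply: lee_wpmul2l; first exact: ex_ge0.
  apply: (le_trans (wb_bound _ mgH gHfin pT)).
  by apply: lee_wpmul2l.
apply: (@le_trans _ _ (K%:E * (E1%:E * D + (expR (4 * p) * (C * c3))%:E *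
    (E2%:E * D + (N * (S * expR (- p * n%:R)))%:E)))).
  by apply: lee_wpmul2l => //; apply: leeD.
have Df : D \is a fin_num by rewrite ge0_fin_numE.
rewrite -(fineK Df) -!(EFinM,EFinD) lee_fin.
have : (N * (B * S * expR (- p * n%:R)) <= N * 2^-1)%R by rewrite ler_wpM2l.
by rewrite /B; lra.
Qed.

(** Iterates [N -> A D + N / 2] towards its fixed point [2 A D]. The start must be finite: [pi h] is
    bounded, say by [e^M], so on the levels that occur [e^(2 p t)] is at most [e^(p M) e^(p t)], and
    the weak bound for [g] itself applies. *)
Lemma hardy_weak : exists2 A : R, (0 <= A)%R & forall g h, hardy g h ->
  (forall x, `|g x| <= expR 1)%R -> dsum 1 p g < +oo ->
  forall t, ex (2 * p * t) * lev (fun x => pi * h x)%R t <= A%:E * dsum 1 (3 / 2 * p) g.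
Proof.
have [A A0 step] := cotlar_step; exists (2 * A)%R; first by rewrite mulr_ge0.
move=> g h gh ge gfin t; have [mg mh] := hardy_measurable gh.
have {}step := step g h gh ge gfin.
pose H x : R := (pi * h x)%R; rewrite -/H in step *.
have mH : measurable_fun setT H by exact: measurable_funM.
set D := dsum 1 (3 / 2 * p) g in step *.
have D0 : 0 <= D by exact: dsum_ge0.
have Df : D \is a fin_num.
  rewrite (ge0_fin_numE D0).
  apply: (@le_lt_trans _ _ (ex ((3 / 2 * p - p) * 1%:~R) * dsum 1 p g)).
    have pq : (p <= 3 / 2 * p)%R by move: p0; lra.
    have ge1 x : (`|g x| <= expR (1 : int)%:~R)%R by rewrite mulr1z.
    exact: (dsum_expo mg pq ge1).
  by rewrite lte_mul_pinfty ?ex_ge0.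
clearbody D.
have [M MH] : exists M : R, forall x, (`|H x| <= expR M)%R.
  have [E E0 HE] := hardy_bound gh; exists (pi ^+ 2 * E)%R => x.
  have b1 := bt_le1 x; have b0 := ltW (bt_gt0 x).
  have h2 : (H x ^+ 2 <= pi ^+ 2 * E)%R.
    rewrite exprMn ler_wpM2l ?sqr_ge0//; have := HE x; have := sqr_ge0 (g x).
    have : (E * bt x <= E * 1)%R by rewrite ler_wpM2l// ltW.
    by lra.
  apply: (@le_trans _ _ (1 + pi ^+ 2 * E)%R); last exact: expR_ge1Dx.
  have : (0 <= (`|H x| - 1) ^+ 2)%R by exact: sqr_ge0.
  by rewrite sqrrB1 real_normK ?num_real//; have := sqr_ge0 (H x); lra.
have pH : pv_ae g H by split => //; apply/aeW => x; have [] := hardy_pvint x gh.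
pose N0 := (expR (p * M) * (C * fine (dsum 1 p g)))%R.
have gf : dsum 1 p g \is a fin_num by rewrite (ge0_fin_numE (dsum_ge0 _ _ _)).
have g0 : (0 <= fine (dsum 1 p g))%R by exact/fine_ge0/dsum_ge0.
have N00 : (0 <= N0)%R by rewrite !mulr_ge0.
have HN0 s : ex (2 * p * s) * lev H s <= N0%:E.
  have [sM|sM] := leP M s.
    rewrite lev0 ?mule0 ?lee_fin//; apply/aeW => x; rewrite (le_trans (MH x))// ler_expR//.
  apply: (@le_trans _ _ (ex (p * M) * (ex (p * s) * lev H s))).
    rewrite muleA -exD; apply: lee_wpmul2r; rewrite ?lev_ge0// ex_le.
    have : (p * s <= p * M)%R by rewrite ler_wpM2l ?ltW.
    by lra.
  rewrite /N0 2!EFinM fineK//; apply: lee_wpmul2l; first exact: ex_ge0.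
  exact: wb_bound.
have iter (j : nat) : forall s, ex (2 * p * s) * lev H s <= (2 * A * fine D + N0 / 2 ^+ j)%:E.
  have h0 : (0 <= A * fine D)%R by rewrite mulr_ge0// fine_ge0.
  elim: j => [|j IH] s.
    by rewrite expr0 divr1; apply: (le_trans (HN0 s)); rewrite lee_fin; lra.
  have h1 : (0 <= 2 * A * fine D + N0 / 2 ^+ j)%R by rewrite addr_ge0 ?divr_ge0 ?exprn_ge0//; lra.
  apply: (le_trans (step _ h1 IH s)).
  rewrite -(fineK Df) -EFinM -EFinD lee_fin fineK// exprS invfM.
  by move: (2 ^+ j)^-1%R => z; lra.
apply/lee_addgt0Pr => e e0.
have [j jP] : exists j : nat, (N0 / 2 ^+ j <= e)%R.
  exists (Num.truncn (N0 / e)).+1; rewrite ler_pdivrMr ?exprn_gt0// mulrC -ler_pdivrMr//.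
  apply: (@le_trans _ _ (Num.truncn (N0 / e)).+1%:R); first by rewrite ltW// truncnS_gt.
  by rewrite -natrX ler_nat ltnW// ltn_expl.
apply: (le_trans (iter j t)); rewrite -(fineK Df) -EFinM -EFinD lee_fin fineK//.
by rewrite lerD2l.
Qed.

(** Levels up to [e^(- n)] contribute a geometric tail times the gauge of the whole support. The
    levels from there to [e] are contained in the one at [e^(- n)], which is small in measure and
    therefore in gauge. *)
Lemma dsum_small (L e : R) : (0 < e)%R -> exists eta d : R, [/\ (0 < eta)%R, (0 < d)%R &
  forall f, measurable_fun setT f -> (forall x, `|f x| <= expR 1)%R ->
    (forall x, (L < `|x|)%R -> f x = 0%R) ->
    mu [set x | (eta < `|f x|)%R] < d%:E -> dsum 1 p f <= e%:E].
Proof.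
move=> e0; have gp : (0 < geo p)%R by exact: geo_gt0.
have B0 : 0 <= Phi (seg L) by exact: (gauge_ge0 gP).
have Bf : Phi (seg L) \is a fin_num by rewrite ge0_fin_numE// (gauge_fin gP).
set B := fine (Phi (seg L)); have B0' : (0 <= B)%R by rewrite fine_ge0.
have [n nP] := expn_small (mulr_ge0 (divr_ge0 (ltW gp) (ltW e0)) B0').
pose k0 : int := (- n%:Z)%R.
have k0E : k0%:~R = (- n%:R)%R :> R by rewrite /k0 mulrNz -pmulrn.
pose e2 : R := (e / 2 / (geo p * expR p))%R.
have e20 : (0 < e2)%R by rewrite !divr_gt0// mulr_gt0// expR_gt0.
have [d d0 dP] := gauge_small gP L e20.
exists (expR k0%:~R), d; split; [exact: expR_gt0|exact: d0|].
move=> f mf fe fL fd.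
have lk : lev f k0%:~R <= e2%:E.
  apply: dP => //; first exact: measurable_lev.
  move=> x /= fx; rewrite /seg/= leNgt; apply/negP => /fL f0.
  by move: fx; rewrite f0 normr0 ltNge expR_ge0.
pose A k : \bar R := if (k <= k0)%R then (expR (p * k%:~R))%:E else 0.
pose D k : \bar R := if (k <= 1)%R then (expR (p * k%:~R))%:E else 0.
have A0 k : 0 <= A k by rewrite /A; case: ifP => // _; rewrite lee_fin expR_ge0.
have D0 k : 0 <= D k by rewrite /D; case: ifP => // _; rewrite lee_fin expR_ge0.
apply: (@le_trans _ _ (zsum (fun k => B%:E * A k + e2%:E * D k))).
  apply: le_zsum => k; rewrite !mul1r.
  have [kk|kk] := leP k k0.
    apply: (@le_trans _ _ (B%:E * A k)); last by rewrite leeDl// mule_ge0// lee_fin ltW.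
    rewrite /A kk muleC; apply: lee_wpmul2r; first exact: ex_ge0.
    by rewrite fineK//; exact: lev_supp.
  apply: (@le_trans _ _ (e2%:E * D k)); last by rewrite leeDr// mule_ge0.
  rewrite /D; have [k1|k1] := leP k 1%R.
    rewrite muleC; apply: lee_wpmul2r; first exact: ex_ge0.
    by apply: le_trans lk; apply: lev_mono => //; rewrite ler_int ltW.
  rewrite mule0 lev0 ?mule0//; apply/aeW => x; rewrite (le_trans (fe x))// ler_expR.
  by rewrite -(mulr1z (1 : R)) ler_int ltW.
rewrite zsumD; [|by move=> k; rewrite mule_ge0|by move=> k; rewrite mule_ge0// lee_fin ltW].
rewrite !zsumZ//; last exact: ltW.
apply: (@le_trans _ _ (B%:E * (geo p * expR (p * k0%:~R))%:E + e2%:E * (geo p * expR (p * 1%:~R))%:E)).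
  apply: leeD; apply: lee_wpmul2l => //; try exact: zsum_geo_le.
  by rewrite lee_fin ltW.
rewrite -!EFinM -EFinD lee_fin mulr1z mulr1 {1}k0E.
have -> : (e2 * (geo p * expR p) = e / 2)%R.
  by rewrite /e2 divfK// mulf_neq0// gt_eqF ?expR_gt0.
have : (e * (geo p / e * B * expR (- p * n%:R)) <= e * 2^-1)%R by rewrite ler_wpM2l// ltW.
rewrite (_ : (e * _ = B * (geo p * expR (p * - n%:R)))%R); first by lra.
by rewrite mulrN mulNr; field; rewrite gt_eqF.
Qed.

(** Two approximations in turn: by a continuous function in measure, then by the class with error
    [e^(- n) bt], which is small in [dsum] because [bt] has finite [dsum]. *)
Lemma hardy_density g (L e : R) : measurable_fun setT g -> (forall x, `|g x| <= 1)%R -> (0 < L)%R ->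
  (forall x, (L < `|x|)%R -> g x = 0%R) -> (0 < e)%R ->
  exists G h, [/\ hardy G h, (forall x, `|G x| <= expR 1)%R, dsum 1 p G < +oo &
    dsum 1 p (fun x => G x - g x)%R <= e%:E].
Proof.
move=> mg g1 L0 gL e0.
have bf : dsum 1 p bt \is a fin_num by rewrite ge0_fin_numE ?dsum_bt_fin// dsum_ge0.
set B := fine (dsum 1 p bt); have B0 : (0 <= B)%R by rewrite fine_ge0// dsum_ge0.
pose Q := (K * expR p)%R.
have Q0 : (0 < Q)%R by rewrite mulr_gt0 ?expR_gt0//; have := gauge_K gP; lra.
pose e1 := (e / 2 / Q)%R; have e10 : (0 < e1)%R by rewrite !divr_gt0.
have [eta [d [eta0 d0 small]]] := dsum_small (L + 1) e10.
have [g2 [r [cg2 r0 g21 [g2r g2L] mug]]] := cont_approx mg g1 L0 gL eta0 d0.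
have [n nP] := expn_small (divr_ge0 B0 (ltW e10)).
have [G [h [gGh Gg2]]] := hardy_approx cg2 r0 (addr_gt0 L0 ltr01) g2r g2L (expR_gt0 (- n%:R)).
have [mG mh] := hardy_measurable gGh.
have mg2 : measurable_fun setT g2 by exact: continuous_measurable_fun.
have Gg21 x : (`|G x - g2 x| <= bt x)%R.
  apply: (le_trans (Gg2 x)); rewrite -[leRHS]mul1r ler_wpM2r//.
  exact: ltW (bt_gt0 x).
exists G, h; split => //.
- move=> x; have := ler_distD (g2 x) (G x) 0%R; rewrite !subr0.
  have := Gg21 x; have := bt_le1 x; have := g21 x; have := expR_ge1Dx (1 : R).
  by lra.
- apply: (@dsum_le_bt_fin _ (1 + (1 + (L + 1) ^+ 2))%R) => // x.
  have := ler_distD (g2 x) (G x) 0%R; rewrite !subr0 => h1; apply: (le_trans h1).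
  rewrite mulrDl mul1r lerD//.
  have [xL|xL] := leP (L + 1)%R `|x|%R.
    by rewrite g2L// normr0 mulr_ge0 ?addr_ge0 ?sqr_ge0 ?(ltW (bt_gt0 x)).
  apply: (le_trans (g21 x)); rewrite -[leLHS](btE x) ler_wpM2r ?(ltW (bt_gt0 x))// lerD2l.
  by rewrite -(real_normK (num_real x)) ler_pXn2r ?nnegrE// ?ltW//; lra.
have H1 : dsum 1 p (fun x => G x - g2 x)%R <= e1%:E.
  apply: (@le_trans _ _ (dsum 1 p (fun x => expR (- n%:Z)%:~R * bt x)%R)).
    apply: le_dsum; [exact: measurable_funB|exact: measurable_funM|].
    apply/aeW => x; rewrite [leRHS]ger0_norm ?mulr_ge0 ?(ltW (bt_gt0 x)) ?expR_ge0//.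
    by rewrite mulrNz -pmulrn.
  rewrite dsum_scale -(fineK bf) -EFinM lee_fin mulrNz -pmulrn mulrC mulrN -mulNr -/B.
  have : (e1 * (B / e1 * expR (- p * n%:R)) <= e1 * 2^-1)%R by rewrite ler_wpM2l// ltW.
  rewrite (_ : e1 * _ = B * expR (- p * n%:R))%R; first by move: e10; lra.
  by field; rewrite gt_eqF.
have H2 : dsum 1 p (fun x => g2 x - g x)%R <= e1%:E.
  apply: small => //.
  - exact: measurable_funB.
  - move=> x; have := ler_normB (g2 x) (g x); have := g1 x; have := g21 x.
    by have := expR_ge1Dx (1 : R); lra.
  - by move=> x xL; rewrite gL ?g2L ?subrr//; lra.
apply: (@le_trans _ _ (Q%:E * (dsum 1 p (fun x => G x - g2 x)%R + dsum 1 p (fun x => g2 x - g x)%R))).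
  apply: dsumD; [exact: measurable_funB|exact: measurable_funB|exact: measurable_funB|].
  by apply/aeW => x; exact: ler_distD.
apply: (@le_trans _ _ (Q%:E * (e1%:E + e1%:E))).
  by apply: lee_wpmul2l; [rewrite lee_fin ltW|exact: leeD].
rewrite -EFinD -EFinM lee_fin (_ : Q * (e1 + e1) = e)%R// /e1.
by field; rewrite gt_eqF.
Qed.

(** [G] obeys [hardy_weak] and [G - g] the weak bound, each at level [e], whence the level [e^2] of
    [Hg]; the contribution of [G - g] is arbitrarily small and leaves no trace in [A]. A single
    level suffices because truncations will be rescaled to height 1. *)
Lemma bounded_weak : exists2 A : R, (0 <= A)%R & forall g (L : R), measurable_fun setT g ->
  (forall x, `|g x| <= 1)%R -> (0 < L)%R -> (forall x, (L < `|x|)%R -> g x = 0%R) ->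
  forall Hg, pv_ae g Hg -> lev Hg 2 <= A%:E * dsum 1 (3 / 2 * p) g.
Proof.
have [A A0 hw] := hardy_weak; set q := (3 / 2 * p)%R in hw *.
have pq : (p <= q)%R by rewrite /q; move: p0; lra.
pose Q := (K * expR q)%R; have Q0 : (0 <= Q)%R by rewrite mulr_ge0.
exists (K * (A * Q))%R; first by rewrite !mulr_ge0.
move=> g L mg g1 L0 gL Hg pg.
pose S := (K * (A * Q * expR ((q - p) * 2) + C))%R.
have S0 : (0 <= S)%R by rewrite mulr_ge0// addr_ge0// !mulr_ge0.
apply/lee_addgt0Pr => e e0.
pose e1 := (e / (S + 1))%R; have e10 : (0 < e1)%R by rewrite divr_gt0// ltr_wpDl.
have [G [h [gGh Ge Gfin Gg]]] := hardy_density mg g1 L0 gL e10.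
have [mG mh] := hardy_measurable gGh.
have mH : measurable_fun setT (fun x => pi * h x)%R by exact: measurable_funM.
have pG : pv_ae G (fun x => pi * h x)%R.
  by split => //; apply/aeW => x; have [] := hardy_pvint x gGh.
have mGg : measurable_fun setT (fun x => G x - g x)%R by exact: measurable_funB.
have [mHg _] := pg.
have pGg : pv_ae (fun x => G x - g x)%R (fun x => pi * h x + -1 * Hg x)%R.
  have := pv_aeD pG (pv_aeZ (-1)%R pg).
  by congr pv_ae; apply/funext => x; rewrite mulN1r.
have [mT _] := pGg.
have Ggfin : dsum 1 p (fun x => G x - g x)%R < +oo by exact: (le_lt_trans Gg (ltry _)).
have l1 (t : R) : (0 <= t)%R -> 1 <= ex t by move=> t0; rewrite -ex0 ex_le.
apply: (@le_trans _ _ (K%:E * (lev (fun x => pi * h x)%R 1 + lev (fun x => pi * h x + -1 * Hg x)%R 1))).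
  rewrite (_ : 2 = 1 + 1)%R//; apply: levD => //; apply/aeW => x.
  by rewrite -{1}[Hg x](subKr (pi * h x)%R) mulN1r ler_normB.
have H1 : lev (fun x => pi * h x)%R 1 <= A%:E * dsum 1 q G.
  apply: le_trans (hw G h gGh Ge Gfin 1%R); rewrite -[leLHS]mul1e; apply: lee_wpmul2r; first exact: lev_ge0.
  by apply: l1; rewrite !mulr_ge0// ltW.
have H2 : lev (fun x => pi * h x + -1 * Hg x)%R 1 <= C%:E * e1%:E.
  apply: (@le_trans _ _ (C%:E * dsum 1 p (fun x => G x - g x)%R)); last exact: lee_wpmul2l.
  apply: le_trans (wb_bound 1%R mGg Ggfin pGg); rewrite -[leLHS]mul1e; apply: lee_wpmul2r; first exact: lev_ge0.
  by apply: l1; rewrite mulr_ge0// ltW.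
have H3 : dsum 1 q G <= Q%:E * (dsum 1 q g + (expR ((q - p) * 2) * e1)%:E).
  apply: (@le_trans _ _ (Q%:E * (dsum 1 q g + dsum 1 q (fun x => G x - g x)%R))).
    apply: dsumD => //; apply/aeW => x.
    by rewrite -{1}[G x](subrK (g x)) addrC ler_normD.
  apply: lee_wpmul2l => //; apply: leeD => //.
  have GGg x : (`|G x - g x| <= expR (2 : int)%:~R)%R.
    have := ler_normB (G x) (g x); have := Ge x; have := g1 x.
    rewrite (_ : (2 : int)%:~R = 1 + 1 :> R)%R// expRD.
    by have := expR_ge1Dx (1 : R); nra.
  apply: (le_trans (dsum_expo mGg pq GGg)).
  by rewrite EFinM; apply: lee_pmul; rewrite ?ex_ge0 ?dsum_ge0.
have D0 : 0 <= dsum 1 q g by exact: dsum_ge0.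
apply: (@le_trans _ _ (K%:E * (A%:E * (Q%:E * (dsum 1 q g + (expR ((q - p) * 2) * e1)%:E)) + C%:E * e1%:E))).
  apply: lee_wpmul2l => //; apply: leeD => //; apply: (le_trans H1).
  exact: lee_wpmul2l.
have Se : (S * e1 <= e)%R.
  by rewrite /e1 mulrCA ger_pMr// ler_pdivrMr ?mul1r ?lerDl// ltr_wpDl.
have X0 : (0 <= expR ((q - p) * 2) * e1)%R by rewrite mulr_ge0// ltW.
have e1ge0 := ltW e10; move: (e1) Se X0 e1ge0 => e2 Se X0 e20.
have d (c x : R) : (0 <= c)%R -> (0 <= x)%R -> forall D, 0 <= D -> c%:E * (D + x%:E) = c%:E * D + (c * x)%:E.
  by move=> c0 x0 D hD; rewrite ge0_muleDr ?lee_fin// EFinM.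
have Q1 : 0 <= Q%:E * dsum 1 q g by exact: mule_ge0.
have A1 : 0 <= A%:E * (Q%:E * dsum 1 q g) by exact: mule_ge0.
have QX : (0 <= Q * (expR ((q - p) * 2) * e2))%R by exact: mulr_ge0.
have Y0 : (0 <= A * (Q * (expR ((q - p) * 2) * e2)) + C * e2)%R by rewrite addr_ge0 ?mulr_ge0.
rewrite (d _ _ Q0 X0 _ D0) (d _ _ A0 QX _ Q1) -addeA -EFinM -EFinD (d _ _ K0 Y0 _ A1).
apply: leeD; first by rewrite !EFinM -!muleA.
rewrite lee_fin; apply: le_trans Se.
by rewrite /S le_eqVlt; apply/orP; left; apply/eqP; ring.
Qed.

End weak.

(* The bound that truncation at height [expR k] gives for the [k]-th level of
   the Hilbert transform: the exponent [q] serves the part below the height,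
   [p] the part above it. *)
Definition rhs (p q : R) (k : int) f : \bar R :=
  zsum (fun j => if (j <= k)%R then ex (q * (j - k)%:~R) * lev f j%:~R else 0) +
  zsum (fun j => if (k <= j)%R then ex (p * (j - k)%:~R) * lev f j%:~R else 0).

Let ifexlev_ge0 (b : bool) f a t : 0 <= if b then ex a * lev f t else 0.
Proof. by case: b; rewrite // exlev_ge0. Qed.

Lemma rhs_ge0 p q k f : 0 <= rhs p q k f.
Proof. by rewrite adde_ge0// zsum_ge0. Qed.

Lemma le_rhs p q k f g : measurable_fun setT f -> measurable_fun setT g ->
  (forall x, `|f x| <= `|g x|)%R -> rhs p q k f <= rhs p q k g.
Proof.
move=> mf mg fg.
have lfg t : lev f t <= lev g t by apply: le_lev => //; apply/aeW => x /lt_le_trans; exact.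
by apply: leeD; apply: le_zsum => j; case: ifP => // _; apply: lee_wpmul2l; rewrite ?ex_ge0.
Qed.

(** After exchanging the sums, for fixed [j] the sum of [e^((r - q) k)] over [k >= j] converges
    because [r < q], and that of [e^((r - p) k)] over [k <= j] because [p < r]. *)
Lemma rhs_sum (p q r : R) f : (p < r)%R -> (r < q)%R ->
  zsum (fun k => ex (r * k%:~R) * rhs p q k f) <= (geo (q - r) + geo (r - p))%:E * dsum 1 r f.
Proof.
move=> pr rq; have qr0 : (0 < q - r)%R by rewrite subr_gt0.
have rp0 : (0 < r - p)%R by rewrite subr_gt0.
have g1 := ltW (geo_gt0 qr0); have g2 := ltW (geo_gt0 rp0).
rewrite EFinD ge0_muleDl ?lee_fin//.
rewrite (_ : (fun k => _) = (fun k =>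
    zsum (fun j => ex (r * k%:~R) * (if (j <= k)%R then ex (q * (j - k)%:~R) * lev f j%:~R else 0)) +
    zsum (fun j => ex (r * k%:~R) * (if (k <= j)%R then ex (p * (j - k)%:~R) * lev f j%:~R else 0)))); last first.
  apply/funext => k; rewrite !zsumZ ?expR_ge0//.
  by rewrite ge0_muleDr// zsum_ge0.
have t0 (b : bool) a f' a' t : 0 <= ex a * (if b then ex a' * lev f' t else 0) by rewrite mule_ge0 ?ex_ge0.
rewrite zsumD; [|by move=> k; rewrite zsum_ge0|by move=> k; rewrite zsum_ge0].
rewrite (zsum_exchange (a := fun k j => ex (r * k%:~R) * (if (j <= k)%R then ex (q * (j - k)%:~R) * lev f j%:~R else 0)))//.
rewrite (zsum_exchange (a := fun k j => ex (r * k%:~R) * (if (k <= j)%R then ex (p * (j - k)%:~R) * lev f j%:~R else 0)))//.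
rewrite -!zsumZ; try by [move=> k; exact: exlev_ge0|].
(* A gauge may be infinite, whereas only real constants are taken out of [zsum]. *)
have fin j : lev f j%:~R = +oo \/ lev f j%:~R \is a fin_num.
  have := lev_ge0 f j%:~R; case: (lev f j%:~R) => //= [y|]; by [right|left].
have key (c : R) (j : int) (F : int -> \bar R) : (0 < c)%R ->
  (forall k, 0 <= F k) -> zsum F <= (geo c * expR (r * j%:~R))%:E ->
  zsum (fun k => F k * lev f j%:~R) <= (geo c)%:E * (ex (1 * r * j%:~R) * lev f (1 * j%:~R)).
  move=> c0 F0 HF; rewrite !mul1r muleA -EFinM.
  have [->|lf] := fin j.
    by rewrite mulry gtr0_sg ?mul1e ?leey// mulr_gt0 ?geo_gt0 ?expR_gt0.
  rewrite (_ : (fun k => _) = fun k => (fine (lev f j%:~R))%:E * F k); last first.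
    by apply/funext => k; rewrite muleC fineK.
  rewrite zsumZ ?fine_ge0 ?lev_ge0// fineK// muleC.
  by apply: lee_wpmul2r => //; exact: lev_ge0.
apply: leeD; apply: le_zsum => j.
  rewrite (_ : (fun k => _) = fun k => (if (j <= k)%R then (expR (- (q - r) * k%:~R))%:E * ex (q * j%:~R) else 0) * lev f j%:~R); last first.
    apply/funext => k; case: ifP => _; rewrite ?mule0 ?mul0e// muleA -[(expR _)%:E]/(ex (- (q - r) * k%:~R)) -!exD.
    by congr (ex _ * _); rewrite rmorphB/=; ring.
  apply: key => //; first by move=> k; case: ifP => // _; rewrite mule_ge0 ?ex_ge0.
  rewrite (_ : (fun k => _) = fun k => ex (q * j%:~R) * (if (j <= k)%R then (expR (- (q - r) * k%:~R))%:E else 0)); last first.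
    by apply/funext => k; case: ifP; rewrite ?mule0// muleC.
  rewrite zsumZ ?expR_ge0//; last by move=> k; case: ifP => // _; rewrite lee_fin expR_ge0.
  apply: (@le_trans _ _ (ex (q * j%:~R) * (geo (q - r) * expR (- (q - r) * j%:~R))%:E)).
    by apply: lee_wpmul2l; rewrite ?ex_ge0//; exact: zsum_geo_ge.
  rewrite -EFinM lee_fin mulrCA -expRD le_eqVlt; apply/orP; left; apply/eqP.
  by congr (_ * expR _)%R; ring.
rewrite (_ : (fun k => _) = fun k => (if (k <= j)%R then (expR ((r - p) * k%:~R))%:E * ex (p * j%:~R) else 0) * lev f j%:~R); last first.
  apply/funext => k; case: ifP => _; rewrite ?mule0 ?mul0e// muleA -[(expR _)%:E]/(ex ((r - p) * k%:~R)) -!exD.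
  by congr (ex _ * _); rewrite rmorphB/=; ring.
apply: key => //; first by move=> k; case: ifP => // _; rewrite mule_ge0 ?ex_ge0.
rewrite (_ : (fun k => _) = fun k => ex (p * j%:~R) * (if (k <= j)%R then (expR ((r - p) * k%:~R))%:E else 0)); last first.
  by apply/funext => k; case: ifP; rewrite ?mule0// muleC.
rewrite zsumZ ?expR_ge0//; last by move=> k; case: ifP => // _; rewrite lee_fin expR_ge0.
apply: (@le_trans _ _ (ex (p * j%:~R) * (geo (r - p) * expR ((r - p) * j%:~R))%:E)).
  by apply: lee_wpmul2l; rewrite ?ex_ge0//; exact: zsum_geo_le.
rewrite -EFinM lee_fin mulrCA -expRD le_eqVlt; apply/orP; left; apply/eqP.
by congr (_ * expR _)%R; ring.
Qed.

Lemma rhs_le (p q r : R) f k : (p < r)%R -> (r < q)%R ->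
  rhs p q k f <= ex (- r * k%:~R) * ((geo (q - r) + geo (r - p))%:E * dsum 1 r f).
Proof.
move=> pr rq; have := rhs_sum f pr rq; set X := (X in _ <= X) => H.
rewrite -[leLHS]mul1e -ex0 -(addNr (r * k%:~R)%R) exD -muleA -mulNr.
apply: lee_wpmul2l; first exact: ex_ge0.
apply: le_trans H; apply: (@zsum_term _ (fun k => ex (r * k%:~R) * rhs p q k f)) => j.
by rewrite mule_ge0 ?ex_ge0 ?rhs_ge0.
Qed.

Section marcinkiewicz.
Variables (p C r : R).
Hypotheses (p0 : (0 < p)%R) (C0 : (0 <= C)%R) (wb : weak_bound p C).
Hypotheses (pr : (p < r)%R) (rq : (r < 3 / 2 * p)%R).
Let q := (3 / 2 * p)%R.

(** The part [tr k] of [f] below the height, divided by [e^k], is subject to [bounded_weak] at level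
    [e^2]; the part [re k] above it is subject to the weak bound. Joining the two costs one more
    level, whence [k + 3]. *)
Lemma truncation_bound : exists2 A : R, (0 <= A)%R & forall f (L : R), measurable_fun setT f ->
  (0 < L)%R -> (forall x, (L < `|x|)%R -> f x = 0%R) -> dsum 1 r f < +oo ->
  exists2 Hf, pv_ae f Hf & forall k : int, lev Hf (k%:~R + 3) <= A%:E * rhs p q k f.
Proof.
have [A A0 bw] := bounded_weak p0 C0 wb; rewrite -/q in bw.
have gp : (0 <= geo p)%R by rewrite ltW// geo_gt0.
exists (K * (A + C * (geo p + 1)))%R; first by rewrite mulr_ge0// addr_ge0// mulr_ge0// addr_ge0.
move=> f L mf L0 fL ffin.
have rfin k : rhs p q k f < +oo.
  apply: (le_lt_trans (rhs_le f k pr rq)).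
  rewrite lte_mul_pinfty ?ex_ge0// lte_mul_pinfty// lee_fin addr_ge0// ltW// geo_gt0// subr_gt0//.
pose S k : mset := [set x | (expR k%:~R < `|f x|)%R].
have mS k : measurable (S k) by exact: measurable_lev.
pose tr (k : int) x := (f x * \1_(~` S k) x)%R.
pose re (k : int) x := (f x * \1_(S k) x)%R.
have mtr k : measurable_fun setT (tr k).
  by apply: measurable_funM => //; apply: measurable_indic; apply: measurableC; exact: mS.
have mre k : measurable_fun setT (re k) by apply: measurable_funM => //; apply: measurable_indic; exact: mS.
have trE k x : tr k x = if (expR k%:~R < `|f x|)%R then 0%R else f x.
  rewrite /tr indicE; case: ifPn => h.
    by rewrite memNset ?mulr0//= => /(_ h).
  by rewrite mem_set ?mulr1//=; exact/negP.
have reE k x : re k x = if (expR k%:~R < `|f x|)%R then f x else 0%R.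
  rewrite /re indicE; case: ifPn => h; first by rewrite mem_set ?mulr1.
  by rewrite memNset ?mulr0//=; exact/negP.
have trre k : f = (fun x => tr k x + re k x)%R.
  by apply/funext => x; rewrite trE reE; case: ifP; rewrite ?add0r ?addr0.
have trf k x : (`|tr k x| <= `|f x|)%R by rewrite trE; case: ifP; rewrite ?normr0.
have tre k x : (`|tr k x| <= expR k%:~R)%R.
  by rewrite trE; case: ifPn; rewrite ?normr0 ?expR_ge0// -leNgt.
have ref k x : (`|re k x| <= `|f x|)%R by rewrite reE; case: ifP; rewrite ?normr0.
have trL k x : (L < `|x|)%R -> tr k x = 0%R by move=> /fL h; rewrite /tr h mul0r.
have Dtr k : dsum 1 p (tr k) < +oo.
  by apply: (dsum_supp_fin _ p0 (mtr k) (@trL k) (a := k)) => // x; rewrite mul1r.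
pose S2 k := zsum (fun j => if (k <= j)%R then ex (p * (j - k)%:~R) * lev f j%:~R else 0).
have S20 k : 0 <= S2 k by exact: zsum_ge0.
have S2r k : S2 k <= rhs p q k f by rewrite leeDr// zsum_ge0.
have lS2 k : lev f k%:~R <= S2 k.
  have : (if (k <= k)%R then ex (p * (k - k)%:~R) * lev f k%:~R else 0) <= S2 k.
    by apply: (@zsum_term _ (fun j => if (k <= j)%R then ex (p * (j - k)%:~R) * lev f j%:~R else 0)).
  by rewrite lexx subrr mulr0 ex0 mul1e.
(* All levels of [re k] up to [k] coincide with the level [k] of [f], which is the term [j = k] of
   [S2 k]; their geometric sum gives [geo p]. *)
have Dre k : dsum 1 p (re k) <= ex (p * k%:~R) * ((geo p + 1)%:E * S2 k).
  have S2f : S2 k \is a fin_num by rewrite ge0_fin_numE// (le_lt_trans (S2r k)).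
  apply: (@le_trans _ _ (zsum (fun j => S2 k * (if (j <= k)%R then (expR (p * j%:~R))%:E else 0) +
      ex (p * k%:~R) * (if (k <= j)%R then ex (p * (j - k)%:~R) * lev f j%:~R else 0)))).
    apply: le_zsum => j; rewrite !mul1r; have [jk|kj] := leP j k.
      apply: (@le_trans _ _ (S2 k * (expR (p * j%:~R))%:E)); last first.
        by rewrite leeDl// mule_ge0 ?ex_ge0.
      rewrite muleC; apply: lee_wpmul2r; first exact: ex_ge0.
      apply: le_trans (lS2 k); apply: le_lev => //; apply/aeW => x.
      by rewrite reE; case: ifPn => // _; rewrite normr0 ltNge expR_ge0.
    rewrite mule0 add0e (ltW kj) muleA -exD (_ : (p * _ + _ = p * j%:~R)%R); last by rewrite rmorphB/=; ring.
    apply: lee_wpmul2l; first exact: ex_ge0.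
    by apply: le_lev => //; apply/aeW => x /lt_le_trans; apply.
  have h0 j : 0 <= (if (j <= k)%R then (expR (p * j%:~R))%:E else 0) by case: ifP => // _; rewrite lee_fin expR_ge0.
  rewrite zsumD; [|by move=> j; rewrite mule_ge0|by move=> j; rewrite mule_ge0 ?ex_ge0].
  rewrite -{1}(fineK S2f) zsumZ ?fine_ge0// fineK// zsumZ ?expR_ge0// -/(S2 k).
  apply: (@le_trans _ _ (S2 k * (geo p * expR (p * k%:~R))%:E + ex (p * k%:~R) * S2 k)).
    by rewrite leeD2r//; apply: lee_wpmul2l => //; exact: zsum_geo_le.
  by rewrite -(fineK S2f) -!EFinM -EFinD lee_fin le_eqVlt; apply/orP; left; apply/eqP; ring.
have Dref k : dsum 1 p (re k) < +oo.
  apply: (le_lt_trans (Dre k)); rewrite lte_mul_pinfty ?ex_ge0// lte_mul_pinfty ?lee_fin ?addr_ge0//.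
  exact: le_lt_trans (S2r k) _.
have pv k : exists Htr Hre, pv_ae (tr k) Htr /\ pv_ae (re k) Hre.
  have [[Htr h1] _] := wb (mtr k) (Dtr k); have [[Hre h2] _] := wb (mre k) (Dref k).
  by exists Htr, Hre.
(* One representative has to serve every [k]: it is built from the splitting at height 1 and
   compared with the others by uniqueness almost everywhere. *)
have [Htr0 [Hre0 [ht0 hr0]]] := pv 0%R.
pose Hf x := (Htr0 x + Hre0 x)%R.
have pf : pv_ae f Hf by have := pv_aeD ht0 hr0; rewrite -trre.
exists Hf => // k; have [mHf _] := pf.
have [Htr [Hre [ht hr]]] := pv k; have [[mHt _] [mHr _]] := (ht, hr).
have HfE : {ae mu, forall x, Hf x = (Htr x + Hre x)%R}.
  by apply: pv_ae_unique pf _; have := pv_aeD ht hr; rewrite -trre.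
rewrite (_ : 3 = 2 + 1)%R; last by rewrite -natr1.
rewrite addrA; apply: (@le_trans _ _ (K%:E * (lev Htr (k%:~R + 2) + lev Hre (k%:~R + 2)))).
  by apply: levD => //; apply: ae_imp HfE => x ->; exact: ler_normD.
rewrite EFinM -muleA; apply: lee_wpmul2l => //.
rewrite EFinD ge0_muleDl ?lee_fin ?mulr_ge0 ?addr_ge0//; apply: leeD.
  have h := @pv_aeZ (expR (- k%:~R)) _ _ ht.
  have {h} := bw (fun x => expR (- k%:~R) * tr k x)%R L _ _ L0 _ _ h.
  rewrite lev_scale opprK addrC => /(_ _ _ _)/le_trans -> //.
  - exact: measurable_funM.
  - move=> x; rewrite normrM ger0_norm ?expR_ge0// mulrC expRN ler_pdivrMr ?expR_gt0// mul1r.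
    exact: tre.
  - by move=> x /trL h; rewrite h mulr0.
  - apply: lee_wpmul2l => //; rewrite -mulrNz dsum_scale.
    apply: (@le_trans _ _ (zsum (fun j => if (j <= k)%R then ex (q * (j - k)%:~R) * lev f j%:~R else 0))).
      rewrite /dsum -zsumZ ?expR_ge0//; last by move=> j; exact: exlev_ge0.
      apply: le_zsum => j; rewrite !mul1r muleA -exD; have [jk|kj] := leP j k.
        rewrite (_ : (q * (- k)%:~R + q * j%:~R = q * (j - k)%:~R)%R); last by rewrite rmorphB/= rmorphN/=; ring.
        apply: lee_wpmul2l; first exact: ex_ge0.
        by apply: le_lev => //; apply/aeW => x /lt_le_trans; apply.
      by rewrite lev0 ?mule0//; apply/aeW => x; rewrite (le_trans (tre k x))// ler_expR ler_int ltW.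
    by rewrite leeDl// zsum_ge0.
have [_ /(_ Hre hr (k%:~R + 2)%R) h] := wb (mre k) (Dref k).
apply: (@le_trans _ _ (ex (p * 2) * lev Hre (k%:~R + 2))).
  rewrite -[leLHS]mul1e; apply: lee_wpmul2r; first exact: lev_ge0.
  by rewrite -ex0 ex_le mulr_ge0// ltW.
have -> : ex (p * 2) = ex (- (p * k%:~R)) * ex (p * (k%:~R + 2)) by rewrite -exD; congr ex; ring.
rewrite -muleA; apply: (@le_trans _ _ (ex (- (p * k%:~R)) * (C%:E * (ex (p * k%:~R) * ((geo p + 1)%:E * S2 k))))).
  apply: lee_wpmul2l; first exact: ex_ge0.
  by apply: (le_trans h); apply: lee_wpmul2l.
rewrite muleCA muleA -(muleA C%:E) muleA muleA -(muleA C%:E) -exD addNr ex0 mule1 EFinM -!muleA.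
by apply: lee_wpmul2l => //; apply: lee_wpmul2l; rewrite ?lee_fin ?addr_ge0.
Qed.

End marcinkiewicz.

End gauge.

(** * Strong estimates *)

Section strong_type.
Context {R : realType}.
Local Notation mu := (@lebesgue_measure R).
Local Notation mset := (set (measurableTypeR R)).
Local Open Scope ereal_scope.
Implicit Types (f g h : R -> R).

Lemma integrable_far_setT h (x e : R) : (forall y, (`|x - y| <= e)%R -> h y = 0%R) ->
  mu.-integrable (far x e) (EFin \o h) -> mu.-integrable setT (EFin \o h).
Proof.
move=> h0 /(integrable_mkcond _ (measurable_far x e)); apply: eq_integrable => // y _.
rewrite patchE; case: ifPn => // /negP yf; rewrite /= h0// leNgt.
by apply/negP => hy; apply: yf; rewrite inE.
Qed.

Definition cut (L : R) f y := (f y * \1_(seg L) y)%R.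

Lemma cutE L f y : cut L f y = if (`|y| <= L)%R then f y else 0%R.
Proof.
rewrite /cut indicE; case: ifPn => h; first by rewrite mem_set ?mulr1.
by rewrite memNset ?mulr0//; exact/negP.
Qed.

Lemma measurable_cut L f : measurable_fun setT f -> measurable_fun setT (cut L f).
Proof. by move=> mf; apply: measurable_funM => //; apply: measurable_indic; exact: measurable_seg. Qed.

Lemma cut_le L f y : (`|cut L f y| <= `|f y|)%R.
Proof. by rewrite cutE; case: ifP; rewrite ?normr0. Qed.

Lemma cut_supp L f y : (L < `|y|)%R -> cut L f y = 0%R.
Proof. by move=> Ly; rewrite cutE ifF// leNgt Ly. Qed.

(* For [|x| <= N / 2] the part of the singular integral over [N < |y|] is
   dominated by the integral of [decay f], whatever [x] is. *)
Definition decay f y : R := if (1 < `|y|)%R then (`|f y| / `|y|)%R else 0%R.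

Lemma decayE f y : decay f y = (`|f y| / `|y| * \1_(~` seg 1) y)%R.
Proof.
rewrite /decay indicE; case: ifPn => h.
  by rewrite mem_set ?mulr1//= /seg/=; apply/negP; rewrite -ltNge.
by rewrite memNset ?mulr0//= /seg/=; apply; rewrite leNgt.
Qed.

Lemma decay_ge0 f y : (0 <= decay f y)%R.
Proof. by rewrite /decay; case: ifP => // _; rewrite divr_ge0. Qed.

Lemma measurable_decay f : measurable_fun setT f -> measurable_fun setT (decay f).
Proof.
move=> mf; rewrite (_ : decay f = fun y => `|f y| / `|y| * \1_(~` seg 1) y)%R; last first.
  by apply/funext => y; exact: decayE.
apply: measurable_funM.
  apply: measurable_funM; first exact: measurableT_comp.
  by apply: (measurableT_comp measurable_inv).
by apply: measurable_indic; apply: measurableC; exact: measurable_seg.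
Qed.

Variables (Phi : mset -> \bar R) (K : R).
Hypothesis gP : gauge Phi K.
Variables (p C r : R).
Hypotheses (p0 : (0 < p)%R) (C0 : (0 <= C)%R) (wb : weak_bound Phi p C).
Hypotheses (pr : (p < r)%R) (rq : (r < 3 / 2 * p)%R).
Local Notation lev := (lev Phi).
Local Notation dsum := (dsum Phi).
Local Notation rhs := (rhs Phi p (3 / 2 * p)).

(** For large [k] the level [k + 3] of the transform has smaller gauge than [[-1/2, 1/2]], so that
    interval contains an [x] whose transform is at most [e^(k + 3)]. For [|y| > 1] the quotient
    [sgn y / (x - y)] is negative with modulus at least [1 / (2 |y|)], so nothing cancels. The
    choice of [k] does not depend on the truncation [n]. *)
Lemma decay_bound f : measurable_fun setT f -> dsum 1 r f < +oo -> exists B : R, forall n : nat,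
  \int[mu]_y (cut n%:R (decay f) y)%:E <= B%:E.
Proof.
move=> mf ffin; have [A A0 tb] := truncation_bound gP p0 C0 wb pr rq.
have r0 : (0 < r)%R by rewrite (lt_trans p0).
have D0 : 0 <= dsum 1 r f by exact: (dsum_ge0 gP).
set G := ((geo (3 / 2 * p - r) + geo (r - p)))%R.
have [k kP] : exists k : nat, A%:E * (ex (- r * k%:R) * (G%:E * dsum 1 r f)) < Phi (seg 2^-1).
  have Df : dsum 1 r f \is a fin_num by rewrite ge0_fin_numE.
  have [v v0 vP] : exists2 v : R, (0 < v)%R & v%:E <= Phi (seg 2^-1).
    have := gauge_pos gP; case: (Phi (seg 2^-1)) => [v|_|]//.
      by rewrite lte_fin => v0; exists v.
    by exists 1%R => //; exact: leey.
  set M := (A * (G * fine (dsum 1 r f)))%R.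
  exists (Num.truncn (M / v / r)).+1; apply: lt_le_trans vP.
  rewrite -(fineK Df) -!EFinM lte_fin mulrCA -/M mulNr expRN ltr_pdivrMl ?expR_gt0//.
  rewrite mulrC -ltr_pdivrMl// mulrC; apply: lt_le_trans (expR_ge1Dx _).
  by have := truncnS_gt (M / v / r); rewrite ltr_pdivrMr//; lra.
exists (2 * expR (k%:R + 3))%R => n.
pose F y := (Num.sg y * cut n%:R (fun z => \1_(~` seg 1) z * `|f z|) y)%R.
have FE y : F y = if (1 < `|y| <= n%:R)%R then (Num.sg y * `|f y|)%R else 0%R.
  rewrite /F cutE indicE andbC; case: ifP => _ /=; rewrite ?mulr0//; case: ifPn => h.
    by rewrite mem_set ?mul1r//= /seg/=; apply/negP; rewrite -ltNge.
  by rewrite memNset ?mul0r ?mulr0//= /seg/=; apply; rewrite leNgt.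
have mF : measurable_fun setT F.
  apply: measurable_funM.
    rewrite (_ : Num.sg = fun y : R => y * `|y|^-1)%R; last first.
      apply/funext => y; have [->|y0] := eqVneq y 0%R; first by rewrite sgr0 mul0r.
      by rewrite {2}[y]numEsg mulfK// normr_eq0.
    by apply: measurable_funM => //; apply: (measurableT_comp measurable_inv).
  apply: measurable_cut; apply: measurable_funM; last exact: measurableT_comp.
  by apply: measurable_indic; apply: measurableC; exact: measurable_seg.
have Ff y : (`|F y| <= `|f y|)%R.
  rewrite FE; case: ifP => _; rewrite ?normr0// normrM normr_id normr_sg.
  by case: eqP => _; rewrite ?mul1r// mul0r.
(* The support bound is [n + 1] because [truncation_bound] wants a positive one and [n] may be 0. *)
have FL y : (n.+1%:R < `|y|)%R -> F y = 0%R.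
  move=> h; rewrite FE; case: ifP => // /andP[_ h2]; exfalso.
  by move: (lt_le_trans h h2); rewrite ltr_nat ltnNge leqnSn.
have FD : dsum 1 r F < +oo by apply: le_lt_trans ffin; apply: (le_dsum gP) => //; exact/aeW.
have [HF [mHF pF] lF] := tb F n.+1%:R mF (ltr0Sn _ _) FL FD.
have lFk : lev HF (k%:R + 3) < Phi (seg 2^-1).
  apply: le_lt_trans kP; apply: (le_trans (lF k%:Z)); apply: lee_wpmul2l => //.
  apply: (le_trans (le_rhs gP _ _ _ mF mf Ff)).
  exact: (rhs_le gP).
have [x [x2 pFx HFx]] : exists x, [/\ (`|x| <= 2^-1)%R, pvint F x (HF x) & (`|HF x| <= expR (k%:R + 3))%R].
  apply: contrapT => H; move: lFk; rewrite ltNge => /negP; apply.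
  apply: (gauge_le gP); [exact: measurable_seg|exact: measurable_lev|].
  apply: ae_imp pF => x px x2 /=; rewrite ltNge; apply/negP => h.
  by apply: H; exists x.
have Far y : (`|x - y| <= 2^-1)%R -> (F y / (x - y) = 0)%R.
  move=> h; rewrite FE ifF ?mul0r//; apply/negP => /andP[h1 _].
  have := ler_distD x y 0%R; rewrite !subr0 distrC => h3.
  by move: (lt_le_trans h1 h3); rewrite ltNge => /negP; apply; lra.
have intF : mu.-integrable setT (fun y => (F y / (x - y))%:E).
  have [e e2 ie] : exists2 e : R, (e <= 2^-1)%R & mu.-integrable (far x e) (fun y => (F y / (x - y))%:E).
    near (0 : R)%R^'+ => e; exists e; near: e; last exact: (proj1 pFx).
    by apply: nbhs_right_le.
  by apply: (integrable_far_setT _ ie) => y ye; apply: Far; exact: le_trans e2.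
pose g y := (2^-1 * cut n%:R (decay f) y)%R.
have g0 y : (0 <= g y)%R by rewrite mulr_ge0 ?invr_ge0// cutE; case: ifP => // _; exact: decay_ge0.
have mg : measurable_fun setT g.
  by apply: measurable_funM => //; apply: measurable_cut; exact: measurable_decay.
have gF y : (g y <= -1 * (F y / (x - y)))%R.
  rewrite /g cutE FE /decay andbC; case: ifP => _ /=; last by rewrite mul0r !mulr0.
  case: ifPn => y1 //=; last by rewrite mul0r !mulr0.
  have := x2; rewrite ler_norml => /andP[x3 x4].
  have := normr_ge0 (f y); move: `|f y|%R => a a0.
  have [yp|yn] := leP 0%R y.
    move: y1; rewrite (ger0_norm yp) => y1.
    rewrite gtr0_sg ?(lt_trans _ y1)// mul1r mulN1r -mulrN -invrN opprB mulrCA ler_wpM2l//.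
    by rewrite -invfM lef_pV2 ?posrE; lra.
  move: y1; rewrite (ltr0_norm yn) => y1.
  rewrite ltr0_sg// !mulN1r mulNr opprK mulrCA ler_wpM2l//.
  by rewrite -invfM lef_pV2 ?posrE; lra.
have intg : mu.-integrable setT (EFin \o g).
  apply: le_integrable intF => //; first exact/measurable_EFinP.
  move=> y _; rewrite lee_fin (ger0_norm (g0 y)) (le_trans (gF y))//.
  by rewrite mulN1r -normrN ler_norm.
have := pvint_lower pFx intF intg gF; rewrite mulN1r => lg.
have -> : \int[mu]_y (cut n%:R (decay f) y)%:E = \int[mu]_y (2%:E * (g y)%:E).
  by apply: eq_integral => y _; rewrite -EFinM /g mulrA divff// mul1r.
rewrite ge0_integralZl//; [|exact/measurable_EFinP|by move=> y _; rewrite lee_fin].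
rewrite -(fineK (integrable_fin_num _ intg))// -EFinM lee_fin ler_pM2l//.
apply: (le_trans lg); apply: (le_trans _ HFx); rewrite -normrN; exact: ler_norm.
Unshelve. all: by end_near. Qed.

Lemma decay_integrable f : measurable_fun setT f -> dsum 1 r f < +oo ->
  mu.-integrable setT (EFin \o decay f).
Proof.
move=> mf ffin; have [B hB] := decay_bound mf ffin.
have md := measurable_decay mf.
have d0 := decay_ge0 f.
apply/integrableP; split; first exact/measurable_EFinP.
rewrite (_ : \int[mu]_x _ = \int[mu]_y limn (fun n => (cut n%:R (decay f) y)%:E)); last first.
  apply: eq_integral => y _; rewrite /= ger0_norm//; apply/esym/cvg_lim => //.
  apply: cvg_near_cst; near=> n; rewrite cutE ifT//.
  by near: n; exact: nbhs_infty_ger.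
have := @cvg_monotone_convergence _ _ _ mu _ measurableT (fun n y => (cut n%:R (decay f) y)%:E).
move=> /(_ _ _ _)/cvg_lim => <- //.
- apply: (@le_lt_trans _ _ B%:E); last exact: ltry.
  apply: lime_le; last by apply: nearW => n; exact: hB.
  apply: ereal_nondecreasing_is_cvgn => m n mn; apply: ge0_le_integral => //.
  all: try by apply/measurable_EFinP; exact: measurable_cut.
  all: try by move=> y _; rewrite lee_fin cutE; case: ifP.
  move=> y _; rewrite lee_fin !cutE; case: ifPn => h; last by case: ifP.
  by rewrite ifT// (le_trans h)// ler_nat.
- by move=> n; apply/measurable_EFinP; exact: measurable_cut.
- by move=> n y _; rewrite lee_fin cutE; case: ifP.
- move=> y _ m n mn; rewrite lee_fin !cutE; case: ifPn => h; last by case: ifP.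
  by rewrite ifT// (le_trans h)// ler_nat.
Unshelve. all: by end_near. Qed.

Definition tail f (n : nat) : R := Rintegral mu setT (fun y => decay f y - cut n%:R (decay f) y)%R.

Lemma integrable_cut L h : mu.-integrable setT (EFin \o h) -> mu.-integrable setT (EFin \o cut L h).
Proof.
move=> hi; have mh : measurable_fun setT h by apply/measurable_EFinP; exact: (measurable_int mu hi).
apply: le_integrable hi => //; first by apply/measurable_EFinP; exact: measurable_cut.
by move=> y _; rewrite lee_fin cut_le.
Qed.

Lemma cvg_tail f : mu.-integrable setT (EFin \o decay f) -> tail f n @[n --> \oo] --> (0 : R)%R.
Proof.
move=> hi; have md : measurable_fun setT (decay f) by apply/measurable_EFinP; exact: (measurable_int mu hi).
pose g n y := (decay f y - cut n%:R (decay f) y)%R.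
have mg n : measurable_fun setT (EFin \o g n).
  by apply/measurable_EFinP; apply: measurable_funB => //; exact: measurable_cut.
have c0 : {ae mu, forall y, setT y -> (g n y)%:E @[n --> \oo] --> cst 0 y}.
  apply/aeW => y _; apply: cvg_near_cst; near=> n; rewrite /g cutE ifT ?subrr//.
  by near: n; exact: nbhs_infty_ger.
have b0 : {ae mu, forall y (n : nat), setT y -> `|(g n y)%:E| <= (EFin \o decay f) y}.
  apply/aeW => y n _; rewrite /g /= cutE; case: ifP => _; rewrite ?subrr ?subr0 ?normr0 lee_fin ?decay_ge0//.
  by rewrite ger0_norm// decay_ge0.
have [_ _] := @dominated_convergence _ _ _ mu _ measurableT (fun n y => (g n y)%:E) (cst 0)
  (EFin \o decay f) mg (measurable_cst _) c0 hi b0.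
rewrite integral_cst// mul0e => h.
rewrite (_ : tail f = fine \o (fun n => \int[mu]_y (g n y)%:E)); last by [].
by apply: fine_cvg; exact: h.
Unshelve. all: by end_near. Qed.

Lemma pvint_tail f (n : nat) x : measurable_fun setT f -> mu.-integrable setT (EFin \o decay f) ->
  (0 < n)%N -> (`|x| <= n%:R / 2)%R ->
  exists2 l, pvint (fun y => f y - cut n%:R f y)%R x l & (`|l| <= 2 * tail f n)%R.
Proof.
move=> mf hi n0 xn; set h := (fun y => f y - cut n%:R f y)%R.
have n1 : (1 <= n%:R :> R)%R by rewrite ler1n.
have hd y : (`|h y / (x - y)| <= 2 * (decay f y - cut n%:R (decay f) y))%R.
  rewrite /h !cutE; have [yn|ny] := leP `|y|%R n%:R; first by rewrite !subrr mul0r normr0 mulr0.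
  rewrite !subr0 /decay (le_lt_trans n1 ny) normrM normfV mulrCA ler_wpM2l//.
  have xy : (`|y| / 2 <= `|x - y|)%R by have := ler_distD x y 0%R; rewrite !subr0 distrC; lra.
  by rewrite -[X in (X * _)%R]invrK -invfM lef_pV2 ?posrE; lra.
have mh : measurable_fun setT h by apply: measurable_funB => //; exact: measurable_cut.
have it : mu.-integrable setT (EFin \o (fun y => 2 * (decay f y - cut n%:R (decay f) y))%R).
  have := integrableZl measurableT 2%R (integrableB measurableT hi (integrable_cut n%:R hi)).
  by apply: eq_integrable.
have ih : mu.-integrable setT (EFin \o (fun y => h y / (x - y))%R).
  apply: le_integrable it => //; first by apply/measurable_EFinP; exact: measurable_div_sub.
  by move=> y _; rewrite lee_fin (le_trans (hd y))// ler_norm.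
exists (Rintegral mu setT (fun y => h y / (x - y))%R); first exact: pvint_integrable.
apply: (le_trans (le_normr_Rintegral _ ih)) => //.
rewrite /tail -RintegralZl//; last exact: (integrableB measurableT hi (integrable_cut n%:R hi)).
apply: le_Rintegral => //; last by apply: integrable_norm.
Qed.

(** On [|x| <= (n + 1) / 2] the transform [H n] of the cut function differs from that of [f] by at
    most [2 * tail f n.+1]. The bounds on its levels, uniform in [n], therefore pass to the limit,
    first on segments and then by [gauge_lim]. *)
Lemma strong_type : exists2 A : R, (0 <= A)%R & forall f, measurable_fun setT f -> dsum 1 r f < +oo ->
  exists2 Hf, pv_ae f Hf & dsum 1 r Hf <= A%:E * dsum 1 r f.
Proof.
have [A A0 tb] := truncation_bound gP p0 C0 wb pr rq.
set G := ((geo (3 / 2 * p - r) + geo (r - p)))%R.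
have G0 : (0 <= G)%R by rewrite addr_ge0// ltW// geo_gt0// subr_gt0.
exists (expR (4 * r) * (A * G))%R; first by rewrite !mulr_ge0.
move=> f mf ffin; have di := decay_integrable mf ffin.
have mcut n : measurable_fun setT (cut n f) by exact: measurable_cut.
have /choice[H HP] (n : nat) : exists Hn, pv_ae (cut n.+1%:R f) Hn /\
    forall k : int, lev Hn (k%:~R + 3) <= A%:E * rhs k f.
  have [|||Hn pH lH] := tb (cut n.+1%:R f) n.+1%:R (mcut _) _.
  - by rewrite ltr0Sn.
  - by move=> x; exact: cut_supp.
  - apply: le_lt_trans ffin; apply: (le_dsum gP) => //; apply/aeW => x; exact: cut_le.
  exists Hn; split=> // k; apply: (le_trans (lH k)); apply: lee_wpmul2l => //.
  by apply: (le_rhs gP) => // x; exact: cut_le.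
(* The upper limit is measurable whether or not the sequence converges; almost everywhere it is the
   limit. *)
pose Hf x := fine (limn_esup (fun n => (H n x)%:E)).
have mHf : measurable_fun setT Hf.
  apply: (measurableT_comp (fine_measurable measurableT)).
  by apply: measurable_fun_limn_esup => n; apply/measurable_EFinP; case: (HP n) => -[].
have ct : (2 * tail f n.+1)%R @[n --> \oo] --> (0 : R)%R.
  rewrite -(mulr0 (2 : R)%R); apply: cvgMl_tmp.
  by have := cvg_tail di; rewrite -(cvg_shiftS (tail f)).
have lim : {ae mu, forall x, pvint f x (Hf x) /\
    forall n : nat, (`|x| <= n.+1%:R / 2)%R -> (`|H n x - Hf x| <= 2 * tail f n.+1)%R}.
  have : {ae mu, forall x (n : nat), pvint (cut n.+1%:R f) x (H n x)}.
    by apply: ae_foralln => n; case: (HP n) => -[].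
  apply: ae_imp => x px.
  have ext (n : nat) : (`|x| <= n.+1%:R / 2)%R ->
      exists2 l, pvint f x (H n x + l)%R & (`|l| <= 2 * tail f n.+1)%R.
    move=> xn; have [l pl bl] := pvint_tail mf di (ltn0Sn n) xn.
    exists l => //; have := pvintD (px n) pl.
    by congr pvint; apply/funext => y; rewrite addrC subrK.
  have xN : (`|x| <= (Num.truncn (2 * `|x|)).+1%:R / 2)%R.
    by have := ltW (truncnS_gt (2 * `|x|)%R); lra.
  have [l0 pl0 _] := ext _ xN; move: pl0; set l := (X in pvint f x X) => pl.
  have bl (n : nat) : (`|x| <= n.+1%:R / 2)%R -> (`|H n x - l| <= 2 * tail f n.+1)%R.
    move=> /ext[l1 pl1 bl1]; rewrite (pvint_unique pl pl1).
    by rewrite opprD addrA subrr add0r normrN.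
  have Hl : H n x @[n --> \oo] --> l.
    apply/cvgrPdist_le => e e0; near=> n; rewrite distrC (le_trans (bl n _))//.
      have : (2 * `|x| <= n%:R)%R by near: n; exact: nbhs_infty_ger.
      by rewrite -[n.+1%:R]natr1; lra.
    by near: n; exact: (cvgr_le _ ct).
  suff -> : Hf x = l by split.
  have Hle : (H n x)%:E @[n --> \oo] --> l%:E.
    by apply: cvg_EFin => //; exact: nearW.
  by rewrite /Hf (cvg_limn_einf_sup Hle).2.
exists Hf; first by split=> //; apply: ae_imp lim => x [].
(* The additional level absorbs the tail, since [2 e^(k + 3) <= e^(k + 4)]. *)
have lH (k : int) : lev Hf (k%:~R + 4) <= A%:E * rhs k f.
  apply: (gauge_lim gP) => [|n]; first exact: measurable_lev.
  have [N nN tN] : exists2 N : nat, (n%:R <= N.+1%:R / 2 :> R)%R & (2 * tail f N.+1 <= expR (k%:~R + 3))%R.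
    near \oo => N; exists N; last by near: N; apply: (cvgr_le _ ct); exact: expR_gt0.
    have : (2 * n%:R <= N%:R :> R)%R by near: N; exact: nbhs_infty_ger.
    by rewrite -[N.+1%:R]natr1; lra.
  have [[mHN _] lHN] := HP N.
  apply: le_trans (lHN k); apply: (gauge_le gP).
  - by apply: measurableI; [exact: measurable_lev|exact: measurable_seg].
  - exact: measurable_lev.
  apply: ae_imp lim => x [_ b] [/= h1 h2].
  have := b N (le_trans h2 nN); move=> /le_trans/(_ tN) h3.
  have h4 := ler_distD (H N x) (Hf x) 0%R; rewrite !subr0 distrC in h4.
  have : (2 * expR (k%:~R + 3) <= expR (k%:~R + 4) :> R)%R.
    rewrite (_ : k%:~R + 4 = 1 + (k%:~R + 3))%R; last by lra.
    rewrite [X in (_ <= X)%R]expRD ler_wpM2r ?expR_ge0// (le_trans _ (expR_ge1Dx 1))//.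
  by lra.
rewrite /dsum -(zsum_shift _ 4).
have h0 k : 0 <= ex (r * k%:~R) * rhs k f by rewrite mule_ge0 ?ex_ge0 ?(rhs_ge0 gP).
apply: (@le_trans _ _ (zsum (fun k => (expR (4 * r) * A)%:E * (ex (r * k%:~R) * rhs k f)))).
  apply: le_zsum => k; rewrite !mul1r intrD mulrDr exD [X in X * _]muleC -muleA.
  rewrite EFinM -muleA (_ : r * 4%:~R = 4 * r)%R; last by rewrite mulrC.
  apply: lee_wpmul2l; first exact: ex_ge0.
  rewrite muleCA; apply: lee_wpmul2l; first exact: ex_ge0.
  exact: lH.
rewrite zsumZ ?mulr_ge0//.
apply: (@le_trans _ _ ((expR (4 * r) * A)%:E * (G%:E * dsum 1 r f))); last first.
  by rewrite muleA -EFinM mulrA.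
apply: lee_wpmul2l; first by rewrite lee_fin mulr_ge0.
exact: (rhs_sum gP).
Unshelve. all: by end_near. Qed.

End strong_type.

(** * Reaching all larger exponents *)

Section extrapolation.
Context {R : realType}.
Local Notation mu := (@lebesgue_measure R).
Local Notation mset := (set (measurableTypeR R)).
Local Open Scope ereal_scope.
Variables (Phi : mset -> \bar R) (K : R).
Hypothesis gP : gauge Phi K.

Definition strong_bound (r A : R) := forall f : R -> R, measurable_fun setT f -> dsum Phi 1 r f < +oo ->
  exists2 Hf, pv_ae f Hf & dsum Phi 1 r Hf <= A%:E * dsum Phi 1 r f.

Lemma strong_weak (r A : R) : (0 <= r)%R -> strong_bound r A -> weak_bound Phi r (expR r * A).
Proof.
move=> r0 sb f mf ffin; have [Hf pf bf] := sb f mf ffin; split; first by exists Hf.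
move=> Hf' pf' t; have [mHf _] := pf; have [mHf' _] := pf'.
apply: (@le_trans _ _ (ex (r * t) * lev Phi Hf t)).
  apply: lee_wpmul2l; first exact: ex_ge0.
  by apply: (le_lev gP) => //; apply: ae_imp (pv_ae_unique pf' pf) => x ->.
apply: (le_trans (lev_dsum gP t mHf r0)); rewrite EFinM -muleA.
by apply: lee_wpmul2l; rewrite ?ex_ge0.
Qed.

(** A strong bound at [5 p / 4] is in particular a weak one, from which the argument restarts. Any
    factor strictly between 1 and [3 / 2] would do; the induction counts the restarts. *)
Lemma weak_strong (p C r : R) : (0 < p)%R -> (0 <= C)%R -> weak_bound Phi p C -> (p < r)%R ->
  exists2 A : R, (0 <= A)%R & strong_bound r A.
Proof.
move=> p0 C0 wb pr.
have [n rn] : exists n : nat, (r <= p * (5 / 4) ^+ n.+1)%R.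
  have pow n : (1 + n%:R / 4 <= (5 / 4 : R) ^+ n)%R.
    elim: n => [|n IH]; first by rewrite expr0 mul0r addr0.
    have n0 : (0 <= n%:R :> R)%R by [].
    by rewrite exprS -[n.+1%:R]natr1; lra.
  have := truncnS_gt (4 * r / p)%R; set n := Num.truncn _; rewrite ltr_pdivrMr// => h; exists n.
  have := pow n.+1; rewrite -(ler_pM2l p0); lra.
elim: n p C p0 C0 wb pr rn => [|n IH] p C p0 C0 wb pr rn.
  by apply: (strong_type gP p0 C0 wb pr); rewrite expr1 in rn; lra.
have [r1|r1] := leP r (5 / 4 * p)%R; first by apply: (strong_type gP p0 C0 wb pr); lra.
have [||A A0 sb] := @strong_type _ _ _ gP p C (5 / 4 * p)%R p0 C0 wb; [lra|lra|].
apply: (IH (5 / 4 * p)%R (expR (5 / 4 * p) * A)%R) => //.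
- by lra.
- by rewrite mulr_ge0.
- by apply: strong_weak => //; lra.
- by move: rn; rewrite exprS; lra.
Qed.

End extrapolation.

(** * The gauge of a pair of weights *)

Section small_integrals.
Context {R : realType}.
Local Notation mu := (@lebesgue_measure R).
Local Notation mset := (set (measurableTypeR R)).
Local Open Scope ereal_scope.

Lemma integral_split (E F : mset) (h : R -> R) : measurable E -> measurable F -> measurable_fun E h ->
  (forall x, E x -> 0 <= h x)%R ->
  \int[mu]_(x in E) (h x)%:E = \int[mu]_(x in E `&` F) (h x)%:E + \int[mu]_(x in E `\` F) (h x)%:E.
Proof.
move=> mE mF mh h0; rewrite -ge0_integral_setU//; first by rewrite setUIDK.
- exact: measurableI.
- exact: measurableD.
- by rewrite setUIDK; exact/measurable_EFinP.
- by move=> x; rewrite setUIDK lee_fin => /h0.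
- by apply/disj_setPS => x [[_ Fx] [_ nFx]].
Qed.

(** Absolute continuity of the integral: beyond a suitable height [n] at most [e / 2] of the mass of
    [h] is left, and below it the mass on [E] is at most [n.+1] times the measure of [E]. *)
Lemma integral_small (D : mset) (h : R -> R) (e : R) : measurable D -> measurable_fun D h ->
  (forall x, D x -> 0 <= h x)%R -> \int[mu]_(x in D) (h x)%:E < +oo -> (0 < e)%R ->
  exists2 d : R, (0 < d)%R & forall E : mset, measurable E -> E `<=` D -> mu E < d%:E ->
    \int[mu]_(x in E) (h x)%:E <= e%:E.
Proof.
move=> mD mh h0 hfin e0.
pose Dn (n : nat) : mset := D `&` [set x | (h x <= n%:R)%R].
have mDn n : measurable (Dn n) by exact: measurable_fun_le.
have subDn n : Dn n `<=` D by move=> x [].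
have mhE : measurable_fun D (EFin \o h) by exact/measurable_EFinP.
have cvgD : \int[mu]_(x in Dn n) (h x)%:E @[n --> \oo] --> \int[mu]_(x in D) (h x)%:E.
  have -> : D = \bigcup_n Dn n.
    apply/seteqP; split => [x Dx|x [n _ []]//].
    by exists (Num.truncn (h x)).+1 => //; split => //=; rewrite ltW// truncnS_gt.
  apply: ge0_nondecreasing_set_cvg_integral => //.
  - apply/nondecreasing_seqP => n; apply/subsetPset => x [Dx /= hx]; split => //=.
    by rewrite (le_trans hx)// ler_nat.
  - by move=> n; exact: measurable_funS (subDn n) mhE.
  - by move=> n x /subDn/h0; rewrite lee_fin.
have Dfin : \int[mu]_(x in D) (h x)%:E \is a fin_num.
  by rewrite ge0_fin_numE// integral_ge0// => x Dx; rewrite lee_fin h0.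
have [n nP] : exists n, \int[mu]_(x in D) (h x)%:E - (e / 2)%:E < \int[mu]_(x in Dn n) (h x)%:E.
  have lt : \int[mu]_(x in D) (h x)%:E - (e / 2)%:E < \int[mu]_(x in D) (h x)%:E.
    by rewrite lteBlDr// lteDl// lte_fin divr_gt0.
  apply: contrapT => /forallNP H; move: lt; rewrite ltNge => /negP; apply.
  rewrite -[X in X <= _](cvg_lim _ cvgD)//; apply: lime_le; first by apply/cvg_ex; eexists; exact: cvgD.
  by apply: nearW => n; rewrite leNgt; exact/negP/H.
have tl : \int[mu]_(x in D `\` Dn n) (h x)%:E <= (e / 2)%:E.
  move: nP; rewrite (integral_split mD (mDn n) mh h0) setIidr//.
  have f1 : \int[mu]_(x in Dn n) (h x)%:E \is a fin_num.
    rewrite ge0_fin_numE ?integral_ge0//; last by move=> x /subDn/h0; rewrite lee_fin.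
    apply: le_lt_trans hfin; apply: ge0_subset_integral => //.
  by rewrite lteBlDr// lteD2lE// => /ltW.
exists (e / 2 / n.+1%:R)%R; first by rewrite !divr_gt0.
move=> E mE ED muE; have mhS : measurable_fun E h by exact: measurable_funS mh.
rewrite (integral_split mE (mDn n) mhS); last by move=> x /ED/h0.
have -> : e%:E = (e / 2)%:E + (e / 2)%:E by rewrite -EFinD -splitr.
apply: leeD.
  apply: (@le_trans _ _ (\int[mu]_(x in E `&` Dn n) (n.+1%:R)%:E)).
    apply: ge0_le_integral => //.
    - exact: measurableI.
    - by move=> x [/ED/h0]; rewrite lee_fin.
    - by apply/measurable_EFinP; apply: measurable_funS mhS.
    - by move=> x [_ [_ /= hx]]; rewrite lee_fin (le_trans hx)// ler_nat.
  rewrite integral_cst; last exact: measurableI.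
  apply: (@le_trans _ _ (n.+1%:R%:E * mu E)).
    by apply: lee_wpmul2l => //; apply: le_measure; rewrite ?inE//; exact: measurableI.
  apply: (le_trans (lee_wpmul2l _ (ltW muE))); first by rewrite lee_fin.
  by rewrite -EFinM lee_fin mulrC divfK// pnatr_eq0.
apply: le_trans tl; apply: ge0_subset_integral => //.
- exact: measurableD.
- exact: measurableD.
- by apply: measurable_funS mhE => // x [].
- by move=> x [/h0]; rewrite lee_fin.
- by move=> x [/ED].
Qed.

Lemma le_integral_ae (E F : mset) (h : R -> R) : measurable E -> measurable F -> measurable_fun setT h ->
  (forall x, 0 <= h x)%R -> {ae mu, forall x, E x -> F x} ->
  \int[mu]_(x in E) (h x)%:E <= \int[mu]_(x in F) (h x)%:E.
Proof.
move=> mE mF mh h0 EF; rewrite (integral_mkcond E) (integral_mkcond F).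
have mhE : measurable_fun setT (EFin \o h) by exact/measurable_EFinP.
apply: ae_ge0_le_integral => //.
- by move=> x _; apply: erestrict_ge0 => y _; rewrite lee_fin.
- by apply/(measurable_restrictT _ _).1 => //; exact: measurable_funTS.
- by move=> x _; apply: erestrict_ge0 => y _; rewrite lee_fin.
- by apply/(measurable_restrictT _ _).1 => //; exact: measurable_funTS.
- apply: ae_imp EF => x EF _; rewrite !patchE; case: ifPn => [|_].
    by rewrite inE => /EF Fx; rewrite mem_set.
  by case: ifP => _; rewrite ?lee_fin.
Qed.

End small_integrals.

Section weight_measure.
Context {R : realType}.
Local Notation mu := (@lebesgue_measure R).
Local Notation mset := (set (measurableTypeR R)).
Local Open Scope ereal_scope.
Variable u : R -> R.
Hypothesis uw : weight_R u.

(** [u] is positive only almost everywhere; its positive part has the same integrals and is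
    nonnegative at every point. *)
Let v x : R := Num.max (u x) 0%R.
Let mv : measurable_fun setT v. Proof. by case: uw => mu_ _ _; exact: measurable_maxr. Qed.
Let v0 x : (0 <= v x)%R. Proof. by rewrite le_max lexx orbT. Qed.
Let mvE (E : mset) : measurable_fun E (EFin \o v).
Proof. by apply/measurable_EFinP; exact: measurable_funTS. Qed.

Lemma umeasE (E : mset) : measurable E -> umeas u E = \int[mu]_(x in E) (v x)%:E.
Proof.
case: uw => mu_ _ up mE; apply: ae_eq_integral => //.
  by apply/measurable_EFinP; exact: measurable_funTS.
by apply: ae_imp up => x ux _ /=; rewrite /v max_l// ltW.
Qed.

Lemma umeas_ge0 (E : mset) : measurable E -> 0 <= umeas u E.
Proof. by move=> mE; rewrite umeasE// integral_ge0// => x _; rewrite lee_fin. Qed.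

Lemma umeas0 : umeas u set0 = 0.
Proof. by rewrite /umeas integral_set0. Qed.

Lemma le_umeas (E F : mset) : measurable E -> measurable F -> {ae mu, forall x, E x -> F x} ->
  umeas u E <= umeas u F.
Proof. by move=> mE mF EF; rewrite !umeasE//; exact: le_integral_ae. Qed.

Lemma umeas_split (E F : mset) : measurable E -> measurable F ->
  umeas u E = umeas u (E `&` F) + umeas u (E `\` F).
Proof.
move=> mE mF; rewrite !umeasE//; [|exact: measurableD|exact: measurableI].
by apply: integral_split => //; exact: measurable_funTS.
Qed.

Lemma umeasU (E F : mset) : measurable E -> measurable F -> umeas u (E `|` F) <= umeas u E + umeas u F.
Proof.
move=> mE mF; rewrite (umeas_split (measurableU _ _ mE mF) mE) leeD//.
  by apply: le_umeas => //; [apply: measurableI => //; exact: measurableU|apply/aeW => x []].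
apply: le_umeas => //; first by apply: measurableD => //; exact: measurableU.
by apply/aeW => x [[]].
Qed.

Lemma compact_seg L : compact (seg L : set R).
Proof.
rewrite (_ : seg L = `[(- L)%R, L]%classic); first exact: segment_compact.
by apply/seteqP; split => x /=; rewrite /seg/= in_itv/= ler_norml.
Qed.

Lemma umeas_seg_fin L : umeas u (seg L) < +oo.
Proof.
case: uw => _ /(_ _ (@compact_seg L)) /integrableP[_ ui] _.
rewrite umeasE; last exact: measurable_seg.
apply: le_lt_trans ui; apply: ge0_le_integral => //.
- exact: measurable_seg.
- by move=> x _; rewrite lee_fin.
- apply: measurableT_comp => //; apply/measurable_EFinP.
  by apply: measurable_funTS; case: uw.
- move=> x _; rewrite lee_fin /v ge_max normr_ge0 andbT; exact: ler_norm.
Qed.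

Lemma umeas_small L (e : R) : (0 < e)%R -> exists2 d : R, (0 < d)%R &
  forall E : mset, measurable E -> E `<=` seg L -> mu E < d%:E -> umeas u E <= e%:E.
Proof.
move=> e0; have fin := umeas_seg_fin L; rewrite umeasE in fin; last exact: measurable_seg.
have mvL : measurable_fun (seg L) v by exact: measurable_funTS.
have [d d0 dP] := integral_small (measurable_seg L) mvL (fun x _ => v0 x) fin e0.
by exists d => // E mE EL muE; rewrite umeasE//; exact: dP.
Qed.

Lemma umeas_lim (E : mset) : measurable E ->
  umeas u (E `&` seg n%:R) @[n --> \oo] --> umeas u E.
Proof.
move=> mE; have mEn (n : nat) : measurable (E `&` seg (n%:R : R)) by apply: measurableI => //; exact: measurable_seg.
rewrite (_ : (fun n => _) = fun n : nat => \int[mu]_(x in E `&` seg n%:R) (v x)%:E); last first.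
  by apply/funext => n; rewrite umeasE.
rewrite umeasE//; rewrite [X in _ --> \int[mu]_(x in X) _](_ : E = \bigcup_n (E `&` seg n%:R)).
  apply: ge0_nondecreasing_set_cvg_integral => //.
  - apply/nondecreasing_seqP => n; apply/subsetPset => x [Ex /= hx]; split => //=.
    by rewrite /seg/= (le_trans hx)// ler_nat.
  - by move=> n x _; rewrite lee_fin.
apply/seteqP; split => [x Ex|x [n _ []]//].
by exists (Num.truncn `|x|%R).+1 => //; split => //=; rewrite /seg/= ltW// truncnS_gt.
Qed.

(** Positivity almost everywhere makes Lebesgue measure absolutely continuous with respect to
    [u]. *)
Lemma umeas_eq0 (E : mset) : measurable E -> umeas u E = 0 -> mu E = 0.
Proof.
case: uw => _ _ up mE; rewrite umeasE// => U0.
have : ae_eq mu E (EFin \o v) (cst 0).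
  apply/(ae_eq_integral_abs _ mE) => //; rewrite -[RHS]U0.
  by apply: eq_integral => x _; rewrite /= ger0_norm.
move=> E0; have : {ae mu, forall x, ~ E x}.
  apply: ae_imp2 up E0 => x ux Ex Exx; have := Ex Exx => /= -[] vx.
  by move: ux; rewrite ltNge => /negP; apply; rewrite -vx /v le_max lexx.
move=> [N [mN N0 sN]]; apply: (subset_measure0 mE mN _ N0).
by move=> x Ex; apply: sN => /= nE; exact: nE.
Qed.

End weight_measure.

Section primitive.
Context {R : realType}.
Local Notation mu := (@lebesgue_measure R).
Local Notation mset := (set (measurableTypeR R)).
Local Open Scope ereal_scope.
Variable w : R -> R.
Hypothesis ww : weight_pos w.

(** Extended endpoints are allowed because [u(E)] may be infinite. The strict inequality makes [wI]
    left continuous without any finiteness assumption and matches the sets [t < u(|f| > y)] of the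
    layer-cake formula. *)
Definition below (a : \bar R) : mset := [set t | (0 < t)%R /\ t%:E < a].

Lemma below_fin (b : R) : below b%:E = `]0%R, b[%classic.
Proof. by apply/seteqP; split => t /=; rewrite /below/= in_itv/= lte_fin; [case=> -> ->|case/andP]. Qed.

Lemma below_pinfty : below +oo = `]0%R, +oo[%classic.
Proof. by apply/seteqP; split => t /=; rewrite /below/= in_itv/= andbT ltry; [case|]. Qed.

Lemma measurable_below a : measurable (below a).
Proof.
case: a => [b||]; [by rewrite below_fin|by rewrite below_pinfty|].
by rewrite (_ : below _ = set0)//; apply/seteqP; split => t // [_].
Qed.

Lemma le_below a b : a <= b -> below a `<=` below b.
Proof. by move=> ab t [t0 ta]; split=> //; exact: lt_le_trans ab. Qed.

Lemma below_pos a : below a `<=` `]0%R, +oo[%classic.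
Proof. by move=> t [t0 _] /=; rewrite in_itv/= t0. Qed.

Let mw (D : mset) : D `<=` `]0%R, +oo[%classic -> measurable_fun D (EFin \o w).
Proof.
move=> Dp; apply/measurable_EFinP; case: ww => mw_ _ _.
by apply: measurable_funS mw_.
Qed.

Let w0 (D : mset) : D `<=` `]0%R, +oo[%classic -> forall t, D t -> 0 <= (w t)%:E.
Proof. by move=> Dp t /Dp /=; rewrite in_itv/= andbT => t0; rewrite lee_fin; case: ww => _ + _; exact. Qed.

Definition wI (a : \bar R) : \bar R := \int[mu]_(t in below a) (w t)%:E.

Lemma wI_ge0 a : 0 <= wI a.
Proof. by apply: integral_ge0; apply: w0; exact: below_pos. Qed.

Lemma le_wI a b : a <= b -> wI a <= wI b.
Proof.
move=> ab; apply: ge0_subset_integral; [exact: measurable_below|exact: measurable_below| | |exact: le_below].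
  by apply: mw; exact: below_pos.
by apply: w0; exact: below_pos.
Qed.

Lemma wI_le0 a : a <= 0 -> wI a = 0.
Proof.
move=> a0; rewrite /wI (_ : below a = set0) ?integral_set0//; apply/seteqP; split => t // [t0 ta].
by have := lt_le_trans ta a0; rewrite lte_fin ltNge ltW.
Qed.

Lemma wI_Wfun t : wI t%:E = Wfun w t.
Proof.
rewrite /wI /Wfun below_fin; apply: integral_itv_bndo_bndc.
by apply: mw => s /=; rewrite !in_itv/= andbT => /andP[].
Qed.

Lemma wI_sup (c a : \bar R) (s : nat -> \bar R) : nondecreasing_seq s ->
  (forall t : R, t%:E < a -> exists n, t%:E < s n) -> (forall n, wI (s n) <= c) -> wI a <= c.
Proof.
move=> snd sa sc.
apply: (@le_trans _ _ (\int[mu]_(t in \bigcup_n below (s n)) (w t)%:E)).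
  apply: ge0_subset_integral; first exact: measurable_below.
  - by apply: bigcup_measurable => n _; exact: measurable_below.
  - by apply: mw => t [n _]; exact: below_pos.
  - by apply: w0 => t [n _]; exact: below_pos.
  - by move=> t [t0 ta]; have [n tn] := sa _ ta; exists n.
have cv : wI (s n) @[n --> \oo] --> \int[mu]_(t in \bigcup_n below (s n)) (w t)%:E.
  apply: ge0_nondecreasing_set_cvg_integral.
  - by move=> m n mn; apply/subsetPset; apply: le_below; exact: snd.
  - by move=> n; exact: measurable_below.
  - by move=> n; apply: mw; exact: below_pos.
  - by move=> n; apply: w0; exact: below_pos.
rewrite -(cvg_lim _ cv)//; apply: lime_le; first by apply/cvg_ex; eexists; exact: cv.
exact: nearW.
Qed.

Lemma wI_le_Wfun (c a : \bar R) : 0 <= c -> (forall t : R, (0 < t)%R -> t%:E < a -> Wfun w t <= c) -> wI a <= c.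
Proof.
move=> c0 H.
have H1 (x : R) : x%:E < a -> wI x%:E <= c.
  have [x0|x0] := ltP 0%R x; first by move=> xa; rewrite wI_Wfun H.
  by move=> _; rewrite wI_le0.
case: a H H1 => [b||] H H1; last by rewrite wI_le0.
  apply: (@wI_sup _ _ (fun n => (b - n.+1%:R^-1)%:E)).
  - by move=> m n mn; rewrite lee_fin lerD2l lerN2 lef_pV2 ?posrE// ler_nat.
  - move=> t; rewrite lte_fin => tb; exists (Num.truncn (b - t)^-1); rewrite lte_fin.
    rewrite ltrBrDl -ltrBrDr -[X in (_ < X)%R]invrK ltf_pV2 ?posrE ?invr_gt0 ?subr_gt0//.
    exact: truncnS_gt.
  - by move=> n; apply: H1; rewrite lte_fin ltrBlDr ltrDl invr_gt0.
apply: (@wI_sup _ _ (fun n => n%:R%:E)).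
- by move=> m n mn; rewrite lee_fin ler_nat.
- by move=> t _; exists (Num.truncn t).+1; rewrite lte_fin truncnS_gt.
- by move=> n; apply: H1; exact: ltry.
Qed.

Lemma wI_small (t0 e : R) : (0 < t0)%R -> Wfun w t0 < +oo -> (0 < e)%R ->
  exists2 d : R, (0 < d)%R & wI d%:E <= e%:E.
Proof.
move=> t00; rewrite -wI_Wfun => Wf e0.
have mw1 : measurable_fun (below t0%:E) w by apply/measurable_EFinP; apply: mw; exact: below_pos.
have w01 (t : R) : below t0%:E t -> (0 <= w t)%R.
  by move=> ta; rewrite -lee_fin; exact: (w0 (@below_pos t0%:E)) ta.
have [d d0 dP] := integral_small (measurable_below _) mw1 w01 Wf e0.
pose d1 := Num.min (d / 2)%R t0.
have d10 : (0 < d1)%R by rewrite lt_min divr_gt0.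
exists d1 => //; apply: dP; first exact: measurable_below.
  by apply: le_below; rewrite lee_fin ge_min lexx orbT.
rewrite below_fin lebesgue_measure_itv/= lte_fin d10 sube0 lte_fin.
by rewrite (@le_lt_trans _ _ (d / 2)%R)// ?ge_min ?lexx//; lra.
Qed.

(** [w] is integrable on compact subsets of the open half-line, so a finite interval of integration
    can diverge only at 0, which all of them share. *)
Lemma Wfun_pinfty (t0 t : R) : (0 < t0)%R -> (0 < t)%R -> Wfun w t0 = +oo -> Wfun w t = +oo.
Proof.
move=> t00 tp; rewrite -!wI_Wfun => W0; have [tt|tt] := leP t0 t.
  by apply/eqP; rewrite -leye_eq -W0; apply: le_wI; rewrite lee_fin.
move: W0; rewrite {1}/wI (integral_split (measurable_below _) (measurable_below t%:E)); first last.
- by move=> s ts; rewrite -lee_fin; exact: (w0 (@below_pos t0%:E)) ts.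
- by apply/measurable_EFinP; apply: mw; exact: below_pos.
rewrite setIidr; last by apply: le_below; rewrite lee_fin ltW.
rewrite -/(wI t%:E).
have wc : mu.-integrable `[t, t0] (EFin \o w).
  case: ww => _ _; apply; first exact: segment_compact.
  by move=> s /=; rewrite !in_itv/= andbT => /andP[ts _]; exact: lt_le_trans ts.
have pos : `[t, t0]%classic `<=` `]0%R, +oo[%classic.
  by move=> s /=; rewrite !in_itv/= andbT => /andP[ts _]; exact: lt_le_trans ts.
have : \int[mu]_(s in below t0%:E `\` below t%:E) (w s)%:E < +oo.
  apply: (@le_lt_trans _ _ (\int[mu]_(s in `[t, t0]) (w s)%:E)).
    apply: ge0_subset_integral => //.
    - by apply: measurableD; exact: measurable_below.
    - exact: mw.
    - exact: w0.
    - move=> s [[s0 st] nst] /=; rewrite in_itv/=; move: st; rewrite lte_fin => /ltW ->.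
      by rewrite andbT leNgt; apply/negP => h; apply: nst; split=> //; rewrite lte_fin.
  have /integrableP[_] := wc; congr (_ < _); apply: eq_integral => s sI /=.
  by rewrite ger0_norm// -lee_fin; apply: (w0 pos); rewrite -inE.
have := wI_ge0 t%:E; case: (wI t%:E) => [a||]//= _.
by case: (\int[mu]_(s in _) _).
Qed.

End primitive.

(** * Dyadic form of the Lorentz quasi-norms *)

Section dyadic_power.
Context {R : realType}.
Local Open Scope ereal_scope.
Variables (p : R) (s : \bar R) (b : pred int).
Hypotheses (p0 : (0 < p)%R) (s0 : 0 <= s).
Let F k : \bar R := if b k then ex (p * k%:~R) else 0.

Let F0 k : 0 <= F k. Proof. by rewrite /F; case: ifP => // _; exact: ex_ge0. Qed.

(** [b k] will say that [t < u(|f| > e^k)], and [s] will be the rearrangement at [t]. The two are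
    related only up to equality: [e^k < s] implies [b k], and [b k] implies [e^k <= s]. Each of the
    two comparisons uses one implication. *)
Lemma poweR_le_zsum : (forall k : int, ex k%:~R < s -> b k) -> s `^ p <= ex p * zsum F.
Proof.
move=> sb; have z0 : 0 <= zsum F by exact: zsum_ge0.
have term k : b k -> ex (p * k%:~R) <= zsum F.
  by move=> bk; apply: le_trans (zsum_term k F0); rewrite /F bk.
case: s s0 sb => [x|_|]//.
  rewrite lee_fin poweR_EFin le_eqVlt => /predU1P[<- _|x0 sb].
    by rewrite powR0 ?gt_eqF// mule_ge0 ?ex_ge0.
  (* The largest integer strictly below [ln x]; the floor would fail when [x] is itself a power of
     e, because [b] is known only under a strict inequality. *)
  pose m := (Num.ceil (ln x) - 1)%R.
  have m1 : (m%:~R < ln x)%R by exact: ceilB1_lt.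
  have m2 : (ln x <= m%:~R + 1)%R.
    by rewrite /m intrD; have := ceil_ge (ln x); lra.
  apply: (@le_trans _ _ (ex p * ex (p * m%:~R))).
    rewrite -exD lee_fin /powR gt_eqF// ler_expR.
    by rewrite -{2}[p]mulr1 -mulrDr ler_wpM2l ?(ltW p0)// addrC.
  apply: lee_wpmul2l; first exact: ex_ge0.
  apply: term; apply: sb; rewrite lte_fin -[X in (_ < X)%R]lnK ?posrE// ltr_expR//.
move=> sb; rewrite poweRyr ?gt_eqF//.
suff -> : zsum F = +oo by rewrite gt0_muley ?ex_gt0.
case: (zsum F) z0 term => [z|//|//] z0 term; exfalso.
have := term (Posz (Num.truncn (z / p)).+1) (sb _ (ltry _)).
rewrite leNgt => /negP; apply; rewrite lte_fin.
apply: lt_le_trans (expR_ge1Dx _).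
by have := truncnS_gt (z / p)%R; rewrite ltr_pdivrMr// -pmulrn; lra.
Qed.

Lemma zsum_le_poweR : (forall k : int, b k -> ex k%:~R <= s) -> zsum F <= (geo p)%:E * s `^ p.
Proof.
move=> bs; have g0 := geo_gt0 p0.
case: s s0 bs => [x|_|]//; last by move=> _; rewrite poweRyr ?gt_eqF// gt0_muley ?leey// lte_fin.
rewrite lee_fin poweR_EFin le_eqVlt => /predU1P[<- bs|x0 bs].
  rewrite powR0 ?gt_eqF// mule0 /zsum esum1// => k _; rewrite /F ifF//.
  by apply/negP => /bs; rewrite lee_fin leNgt expR_gt0.
pose m := Num.floor (ln x).
apply: (@le_trans _ _ (zsum (fun k => if (k <= m)%R then (expR (p * k%:~R))%:E else 0))).
  apply: le_zsum => k; rewrite /F; case: ifPn => [/bs|_]; last by case: ifP => // _; exact: ex_ge0.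
  rewrite lee_fin -[X in (_ <= X)%R]lnK ?posrE// ler_expR => h.
  by rewrite ifT// /m floor_ge_int_tmp.
apply: (le_trans (zsum_geo_le _ p0)); rewrite -EFinM lee_fin ler_wpM2l ?(ltW g0)//.
rewrite /powR gt_eqF// ler_expR ler_wpM2l ?(ltW p0)//.
exact: floor_le_tmp.
Qed.

End dyadic_power.

Section rearrangement.
Context {R : realType}.
Local Notation mu := (@lebesgue_measure R).
Local Notation mset := (set (measurableTypeR R)).
Local Open Scope ereal_scope.
Variable u : R -> R.
Hypothesis uw : weight_R u.
Implicit Type f : R -> R.

Lemma rearr_ge0 f t : 0 <= rearr u f t.
Proof. by apply: le_ereal_inf_tmp => _ [y [y0 _] <-]; rewrite lee_fin ltW. Qed.

Lemma rearr_ge f y t : measurable_fun setT f ->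
  t%:E < umeas u [set x | (y < `|f x|)%R] -> y%:E <= rearr u f t.
Proof.
move=> mf ty; apply: le_ereal_inf_tmp => _ [z [z0 zt] <-]; rewrite lee_fin leNgt.
apply/negP => zy; move: ty; rewrite ltNge => /negP; apply; apply: le_trans zt.
apply: (le_umeas uw); [exact: measurable_gt_norm|exact: measurable_gt_norm|].
by apply/aeW => x /=; exact: lt_trans.
Qed.

Lemma rearr_lt f y t : (0 < y)%R -> y%:E < rearr u f t -> t%:E < umeas u [set x | (y < `|f x|)%R].
Proof.
move=> y0; apply: contraTT; rewrite -!leNgt => h.
by apply: ereal_inf_lbound; exists y.
Qed.

Lemma le_rearr f s t : (s <= t)%R -> rearr u f t <= rearr u f s.
Proof.
move=> st; apply: ereal_inf_le_tmp => _ [y [y0 yt] <-]; exists y => //; split=> //.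
by rewrite (le_trans yt)// lee_fin.
Qed.

Lemma measurable_rearr f : measurable_fun (`]0%R, +oo[ : mset) (rearr u f).
Proof.
move=> mD; apply: (measurability _ (ErealGenOInfty.measurableE R)) => // _ [_ [y ->] <-].
rewrite preimage_itvoy.
apply: is_interval_measurable => s t [/= s0 ys] [/= t0 yt] z /andP[sz zt]; split => /=.
  by move: s0; rewrite !in_itv/= !andbT => s0; exact: lt_le_trans sz.
by apply: lt_le_trans yt _; exact: le_rearr.
Qed.

End rearrangement.

Section lorentz_levels.
Context {R : realType}.
Local Notation mu := (@lebesgue_measure R).
Local Notation mset := (set (measurableTypeR R)).
Local Open Scope ereal_scope.
Variables u w : R -> R.
Hypotheses (uw : weight_R u) (ww : weight_pos w).
Implicit Type f : R -> R.

Definition gaugeW (E : mset) : \bar R := wI w (umeas u E).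

Definition lorentz_int (p : R) f : \bar R :=
  \int[mu]_(t in (`]0%R, +oo[ : set R)) (poweR (rearr u f t) p * (w t)%:E).

Let mw : measurable_fun (`]0%R, +oo[ : mset) (EFin \o w).
Proof. by apply/measurable_EFinP; case: ww. Qed.

Let w0 (t : R) : (`]0%R, +oo[%classic : mset) t -> 0 <= (w t)%:E.
Proof. by rewrite /= in_itv/= andbT => t0; rewrite lee_fin; case: ww => _ + _; exact. Qed.

Lemma lorentz_int_ge0 p f : 0 <= lorentz_int p f.
Proof. by apply: integral_ge0 => t tp; rewrite mule_ge0 ?poweR_ge0// w0. Qed.

Let F (p : R) f (t : R) (k : int) : \bar R :=
  if t%:E < umeas u [set x | (expR k%:~R < `|f x|)%R] then ex (p * k%:~R) else 0.

Let F0 p f t k : 0 <= F p f t k.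
Proof. by rewrite /F; case: ifP => // _; exact: ex_ge0. Qed.

Let measurable_F p f k : measurable_fun (`]0%R, +oo[ : mset) (fun t => F p f t k).
Proof.
set a := umeas u [set x | (expR k%:~R < `|f x|)%R].
rewrite (_ : (fun t => F p f t k) = fun t => (expR (p * k%:~R) * \1_([set t : R | (t%:E < a)%E]) t)%:E).
  apply/measurable_EFinP; apply: measurable_funM => //; apply: measurable_indic.
  apply: is_interval_measurable => s t /= _ ta z /andP[_ zt]; apply: le_lt_trans ta.
  by rewrite lee_fin.
apply/funext => t; rewrite /F indicE -/a; case: ifPn => h.
  by rewrite mem_set// mulr1.
by rewrite memNset ?mulr0//; exact/negP.
Qed.

Let measurable_zsumF p f : measurable_fun (`]0%R, +oo[ : mset) (fun t => zsum (F p f t)).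
Proof.
rewrite (_ : (fun t => _) = fun t => \sum_(n <oo) F p f t (int_of_nat n)); last first.
  by apply/funext => t; rewrite zsum_nat.
apply: (@ge0_emeasurable_sum _ _ _ _ (fun n t => F p f t (int_of_nat n)) xpredT) => // n _.
exact: measurable_F.
Qed.

(** Layer-cake formula: sum and integral are exchanged, and the integral of [w] over [0 < t < a] is
    [wI w a], here with [a = u(|f| > e^k)]. *)
Lemma dsum_integral p f : \int[mu]_(t in (`]0%R, +oo[ : set R)) (zsum (F p f t) * (w t)%:E) = dsum gaugeW 1 p f.
Proof.
rewrite [LHS](_ : _ = \int[mu]_(t in (`]0%R, +oo[ : set R)) \sum_(n <oo) (F p f t (int_of_nat n) * (w t)%:E)); last first.
  apply: eq_integral => t; rewrite inE => tp; rewrite zsum_nat// muleC -nneseriesZl//.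
  by apply: eq_eseriesr => n _; rewrite muleC.
rewrite integral_nneseries//; last 2 first.
- by move=> n; apply: emeasurable_funM => //; exact: measurable_F.
- by move=> n t tp; rewrite mule_ge0// w0.
rewrite /dsum zsum_nat; last by move=> k; rewrite mule_ge0 ?ex_ge0 ?wI_ge0.
apply: eq_eseriesr => n _; move: (int_of_nat n) => k.
rewrite !mul1r /lev /gaugeW /wI; set a := umeas u _.
rewrite -ge0_integralZl ?ex_ge0//; last 3 first.
- exact: measurable_below.
- apply: measurable_funS mw => //; exact: below_pos.
- by move=> t /below_pos/w0.
rewrite [RHS](_ : _ = \int[mu]_(t in `]0%R, +oo[ `&` [set t : R | (t%:E < a)%E]) (ex (p * k%:~R) * (w t)%:E)).
  rewrite integral_mkcondr; apply: eq_integral => t _.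
  rewrite patchE /F -/a; case: ifPn => h; first by rewrite mem_set.
  by rewrite mul0e memNset//; exact/negP.
congr integral; apply/seteqP; split => t /=; rewrite /below/= in_itv/= andbT //.
Qed.

Lemma lorentz_int_le_dsum (p : R) f : (0 < p)%R -> measurable_fun setT f ->
  lorentz_int p f <= ex p * dsum gaugeW 1 p f.
Proof.
move=> p0 mf; rewrite -dsum_integral -ge0_integralZl ?ex_ge0//; last 2 first.
- by apply: emeasurable_funM.
- by move=> t tp; rewrite mule_ge0 ?w0// zsum_ge0.
apply: ge0_le_integral => //.
- by move=> t tp; rewrite mule_ge0 ?poweR_ge0// w0.
- apply: emeasurable_funM => //.
  by apply: (measurableT_comp (measurable_poweR _)); exact: measurable_rearr.
- by apply: emeasurable_funM => //; apply: emeasurable_funM.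
move=> t tp; rewrite muleA; apply: lee_wpmul2r; first exact: w0.
apply: poweR_le_zsum => //; first exact: rearr_ge0.
by move=> k; apply: rearr_lt; exact: expR_gt0.
Qed.

Lemma dsum_le_lorentz_int (p : R) f : (0 < p)%R -> measurable_fun setT f ->
  dsum gaugeW 1 p f <= (geo p)%:E * lorentz_int p f.
Proof.
move=> p0 mf; have g0 := ltW (geo_gt0 p0); rewrite -dsum_integral -ge0_integralZl ?lee_fin//; last 2 first.
- apply: emeasurable_funM => //.
  by apply: (measurableT_comp (measurable_poweR _)); exact: measurable_rearr.
- by move=> t tp; rewrite mule_ge0 ?w0// poweR_ge0.
apply: ge0_le_integral => //.
- by move=> t tp; rewrite mule_ge0 ?w0// zsum_ge0.
- exact: emeasurable_funM.
- apply: emeasurable_funM => //; apply: emeasurable_funM => //.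
  by apply: (measurableT_comp (measurable_poweR _)); exact: measurable_rearr.
move=> t tp; rewrite muleA; apply: lee_wpmul2r; first exact: w0.
apply: zsum_le_poweR => //; first exact: rearr_ge0.
by move=> k; exact: (rearr_ge uw).
Qed.

(** For every [s < u(|f| > e^t)] the rearrangement at [s] is at least [e^t], which bounds [W(s)];
    letting [s] increase bounds [wI] by left continuity. *)
Lemma weak_level (p : R) f (M : \bar R) (t : R) : (0 < p)%R -> measurable_fun setT f ->
  weak_lorentz_norm u w p f <= M -> ex (p * t) * lev gaugeW f t <= M `^ p.
Proof.
move=> p0 mf fM; rewrite /lev /gaugeW; set a := umeas u _.
have Me : M `^ p = ex (p * t) * (ex (- (p * t)) * M `^ p).
  by rewrite muleA -exD subrr ex0 mul1e.
rewrite Me; apply: lee_wpmul2l; first exact: ex_ge0.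
apply: (wI_le_Wfun ww) => [|s s0 sa]; first by rewrite mule_ge0 ?ex_ge0// poweR_ge0.
have W0 : 0 <= Wfun w s by rewrite -(wI_Wfun ww) wI_ge0.
have h1 : ex t * (Wfun w s) `^ p^-1 <= M.
  apply: le_trans fM; apply: (@le_trans _ _ (rearr u f s * (Wfun w s) `^ p^-1)).
    by apply: lee_wpmul2r; rewrite ?poweR_ge0//; exact: (rearr_ge uw).
  by apply: ereal_sup_ubound; exists s => //=; rewrite in_itv/= s0.
have h2 : ex (p * t) * Wfun w s <= M `^ p.
  have -> : ex (p * t) * Wfun w s = (ex t * (Wfun w s) `^ p^-1) `^ p.
    rewrite poweRM ?ex_ge0 ?poweR_ge0// -poweRrM mulVf ?gt_eqF// poweRe1// poweR_EFin.
    by rewrite /ex /powR gt_eqF ?expR_gt0// expRK.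
  have l0 : 0 <= ex t * (Wfun w s) `^ p^-1 by rewrite mule_ge0 ?ex_ge0 ?poweR_ge0.
  apply: gt0_ler_poweR => //; first exact: ltW.
  - by rewrite in_itv/= l0 leey.
  - by rewrite in_itv/= (le_trans l0 h1) leey.
rewrite -[leLHS]mul1e -ex0 -(addNr (p * t)%R) exD -muleA.
by apply: lee_wpmul2l; rewrite ?ex_ge0.
Qed.

End lorentz_levels.

(** * What the weak estimate forces on the weights *)

Section kernel_at_infinity.
Context {R : realType}.
Local Notation mu := (@lebesgue_measure R).
Local Notation mset := (set (measurableTypeR R)).
Local Open Scope ereal_scope.

Lemma ae_exists (P : R -> Prop) : {ae mu, forall x, P x} -> exists x, P x.
Proof.
move=> [N [mN N0 sN]]; apply: contrapT => /forallNP H.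
have : mu (seg 1) <= mu N.
  apply: le_measure; rewrite ?inE//; first exact: measurable_seg.
  by move=> x _; apply: sN => /= /H.
rewrite measure_seg// N0 lee_fin; lra.
Qed.

(** Each dyadic block from [x + e 2^n] to [x + e 2^(n + 1)] contributes at least [1 / 2]. *)
Lemma not_integrable_inv (x e : R) : (0 < e)%R -> ~ mu.-integrable (far x e) (fun y => (1 / (x - y))%:E).
Proof.
move=> e0 /integrableP[mf fin].
pose A n : mset := `](x + e)%R, (x + e * 2 ^+ n)%R]%classic.
have AE n y : A n y = (x + e < y <= x + e * 2 ^+ n)%R :> Prop by rewrite /A/= in_itv.
have Afar n : A n `<=` far x e.
  move=> y; rewrite AE => /andP[h _]; rewrite /far/= distrC ger0_norm; lra.
have mh (D : mset) : D `<=` far x e -> measurable_fun D (fun y => (`|1 / (x - y)|)%R).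
  move=> Df; apply: measurableT_comp => //; apply/measurable_EFinP.
  by apply: measurable_funS mf => //; exact: measurable_far.
have lb (n : nat) : (n%:R / 2)%:E <= \int[mu]_(y in A n) (`|1 / (x - y)|)%:E.
  elim: n => [|n IH]; first by rewrite mul0r integral_ge0// => y _; rewrite lee_fin.
  have mAn k : measurable (A k) by exact: measurable_itv.
  rewrite (integral_split (mAn n.+1) (mAn n)) //; last exact: mh.
  have p1 : (1 <= 2 ^+ n :> R)%R by rewrite exprn_ege1//; lra.
  have eP : (e * 2 ^+ n.+1 = e * 2 ^+ n + e * 2 ^+ n)%R by rewrite exprS; lra.
  have ep : (0 < e * 2 ^+ n)%R by rewrite mulr_gt0//; lra.
  have sub : A n `<=` A n.+1.
    by move=> y; rewrite !AE => /andP[-> h]; rewrite (le_trans h)//; lra.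
  rewrite setIidr// -[n.+1%:R]natr1 mulrDl EFinD; apply: leeD => //.
  have AD : A n.+1 `\` A n = `](x + e * 2 ^+ n)%R, (x + e * 2 ^+ n.+1)%R]%classic.
    apply/seteqP; split => y /=; rewrite !AE !in_itv/=.
      by move=> [/andP[h1 ->]]; rewrite h1/= andbT => /negP; rewrite -ltNge.
    move=> /andP[h1 h2]; split; first by rewrite h2 andbT; apply: le_lt_trans h1; rewrite lerD2l ler_peMr// ltW.
    by apply/negP; rewrite negb_and -!ltNge h1 orbT.
  rewrite AD.
  apply: (@le_trans _ _ (\int[mu]_(y in `](x + e * 2 ^+ n)%R, (x + e * 2 ^+ n.+1)%R]%classic) ((e * 2 ^+ n.+1)^-1)%R%:E)).
    have mI : mu `](x + e * 2 ^+ n)%R, (x + e * 2 ^+ n.+1)%R]%classic = (e * 2 ^+ n)%:E.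
      by rewrite lebesgue_measure_itv/= lte_fin ltrD2l eP ltrDl ep -EFinD; congr _%:E; lra.
    rewrite integral_cst//; set m := (X in _ * X); have -> : m = _ := mI.
    rewrite -EFinM lee_fin eP le_eqVlt; apply/orP; left; apply/eqP; move: ep; set z := (e * 2 ^+ n)%R => z0.
    by field; rewrite gt_eqF//=; lra.
  apply: ge0_le_integral => //.
  - by move=> y _; rewrite lee_fin invr_ge0 eP; lra.
  - apply/measurable_EFinP; apply: mh; rewrite -AD => y [/Afar].
    by [].
  - move=> y /=; rewrite in_itv/= => /andP[h1 h2]; rewrite lee_fin mul1r normfV lef_pV2 ?posrE.
    + by rewrite ler0_norm; lra.
    + by rewrite eP; lra.
    + by rewrite normr_gt0 ltr0_neq0//; lra.
have tot n : (n%:R / 2)%:E <= \int[mu]_(y in far x e) `|(1 / (x - y))%:E|.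
  apply: (le_trans (lb n)); apply: ge0_subset_integral => //.
  - exact: measurable_itv.
  - exact: measurable_far.
  - by apply/measurable_EFinP; exact: mh.
move: fin tot; case: (\int[mu]_(y in far x e) _) => [I _ tot|//|_ /(_ 0%N)//].
have := tot (Num.truncn (2 * I)).+1; rewrite lee_fin.
by have := truncnS_gt (2 * I)%R; lra.
Qed.

End kernel_at_infinity.

Section doubling.
Context {R : realType}.
Local Notation mu := (@lebesgue_measure R).
Local Notation mset := (set (measurableTypeR R)).
Local Open Scope ereal_scope.
Variables (u w : R -> R) (p : R).
Hypotheses (uw : weight_R u) (ww : weight_pos w) (p0 : (0 < p)%R).
Hypothesis hb : hilbert_bounded (lorentz_norm u w p) (weak_lorentz_norm u w p).
Hypothesis Wfin : forall t : R, (0 < t)%R -> Wfun w t < +oo.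
Local Notation Phi := (gaugeW u w).
Local Notation dsum := (dsum Phi).
Implicit Type f : R -> R.

Lemma le_gaugeW (E F : mset) : measurable E -> measurable F -> {ae mu, forall x, E x -> F x} -> Phi E <= Phi F.
Proof. by move=> mE mF EF; apply: (le_wI ww); exact: (le_umeas uw). Qed.

(** The hypothesis in terms of [Phi]. Passing from [hilbert_pv] to [pvint] multiplies the transform
    by pi, which shifts its levels by [ln pi]. *)
Lemma hilbert_levels : exists2 C : R, (0 <= C)%R & forall f, measurable_fun setT f -> dsum 1 p f < +oo ->
  exists2 Hf, pv_ae f Hf & forall t : R, ex (p * t) * lev Phi Hf t <= C%:E * dsum 1 p f.
Proof.
(* The constant in [hilbert_bounded] carries no sign, and it is about to be raised to the power
   [p]. *)
case: hb => C0 hC; pose C := Num.max C0 0%R.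
have C0' : (0 <= C)%R by rewrite le_max lexx orbT.
exists (expR (p * ln pi) * (C `^ p * expR p))%R; first by rewrite !mulr_ge0// ?expR_ge0 ?powR_ge0.
move=> f mf ffin.
have I0 : 0 <= lorentz_int u w p f by exact: (lorentz_int_ge0 _ ww).
have If : lorentz_int u w p f < +oo.
  apply: (le_lt_trans (lorentz_int_le_dsum _ ww p0 mf)).
  by rewrite lte_mul_pinfty ?ex_ge0.
have Nf : lorentz_norm u w p f < +oo by exact: poweR_lty.
have [Hf [mHf pHf wHf]] := hC f mf Nf.
have piE : pi = expR (ln pi) :> R by rewrite lnK// posrE pi_gt0.
exists (fun x => expR (ln pi) * Hf x)%R.
  split; first exact: measurable_funM.
  by apply: ae_imp pHf => x /hilbert_pvE; rewrite -piE.
move=> t; rewrite lev_scale.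
have -> : ex (p * t) = ex (p * ln pi) * ex (p * (t - ln pi)) by rewrite -exD; congr ex; ring.
rewrite -muleA EFinM -muleA; apply: lee_wpmul2l; first exact: ex_ge0.
have wHf' : weak_lorentz_norm u w p Hf <= C%:E * lorentz_norm u w p f.
  apply: (le_trans wHf); apply: lee_wpmul2r; first exact: poweR_ge0.
  by rewrite lee_fin le_max lexx.
apply: (le_trans (weak_level uw ww _ p0 mHf wHf')).
rewrite poweRM ?poweR_ge0// poweR_EFin EFinM -muleA; apply: lee_wpmul2l; first by rewrite lee_fin powR_ge0.
rewrite /lorentz_norm -poweRrM mulVf ?gt_eqF// poweRe1//.
exact: (lorentz_int_le_dsum _ ww p0 mf).
Qed.

Lemma dsum_indic (E : mset) : measurable E -> Phi E < +oo -> dsum 1 p \1_E <= (geo p)%:E * Phi E.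
Proof.
move=> mE Ef; have E0 : 0 <= Phi E by exact: (wI_ge0 ww).
have Efn : Phi E \is a fin_num by rewrite ge0_fin_numE.
apply: (@le_trans _ _ (zsum (fun k => (fine (Phi E))%:E * (if (k <= 0)%R then (expR (p * k%:~R))%:E else 0)))).
  apply: le_zsum => k; rewrite !mul1r fineK// muleC.
  rewrite /lev; case: ifPn => k0.
    apply: lee_wpmul2r; first exact: ex_ge0.
    apply: le_gaugeW => //; first by apply: measurable_gt_norm; exact: measurable_indic.
    apply/aeW => x /=; rewrite indicE; case: (boolP (x \in E)); first by rewrite inE.
    by move=> _; rewrite normr0 ltNge expR_ge0.
  have -> : [set x : R | (expR k%:~R < `|(\1_E : R -> R) x|)%R] = set0 :> mset.
    apply/seteqP; split => x //=; rewrite indicE; move: k0; rewrite -ltNge => k0.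
    have : (1 <= expR k%:~R :> R)%R by rewrite -[leLHS]expR0 ler_expR ler0z ltW.
    by case: (x \in E); rewrite ?normr1 ?normr0; lra.
  by rewrite /gaugeW umeas0 (wI_le0 w (lexx _)) mul0e mule0.
rewrite zsumZ ?fine_ge0//; last by move=> k; case: ifP => // _; exact: ex_ge0.
rewrite fineK// muleC; apply: lee_wpmul2r => //.
by apply: (le_trans (zsum_geo_le _ p0)); rewrite mulr0 expR0 mulr1.
Qed.

(** Otherwise the constant 1 lies in the space, while [1 / (x - y)] is not integrable at infinity,
    so that its truncated integrals exist for no [x]. *)
Lemma gaugeW_setT : Phi setT = +oo.
Proof.
apply/eqP; rewrite -leye_eq leNgt; apply/negP => fin.
have [C _ hC] := hilbert_levels.
have m1 : measurable_fun setT (\1_[set: R] : R -> R) by exact: measurable_indic.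
have [|Hf [_ pHf] _] := hC _ m1.
  apply: (le_lt_trans (dsum_indic _ fin)) => //.
  by rewrite lte_mul_pinfty ?lee_fin ?(ltW (geo_gt0 p0)).
have [x [nx _]] := ae_exists pHf.
have [e e0 ie] : exists2 e : R, (0 < e)%R & mu.-integrable (far x e) (fun y => (\1_[set: R] y / (x - y))%:E).
  near (0 : R)%R^'+ => e; exists e; last by near: e.
  by near: e; exact: nbhs_right_gt.
apply: (not_integrable_inv e0 (x := x)); apply: eq_integrable ie; first exact: measurable_far.
by move=> y _; rewrite indicE in_setT.
Unshelve. all: by end_near. Qed.

Lemma wI_lt_pinfty (a : R) : wI w a%:E < +oo.
Proof.
have [a0|a0] := ltP 0%R a; first by rewrite (wI_Wfun ww) Wfin.
by rewrite wI_le0.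
Qed.

Lemma umeas_setT : umeas u setT = +oo.
Proof.
have := gaugeW_setT; rewrite /gaugeW; have := umeas_ge0 uw (measurableT : measurable ([set: R] : mset)).
case: (umeas u setT) => [a _ /= H|//|//].
by have := wI_lt_pinfty a; rewrite H.
Qed.

Lemma umeas_seg_large (s : R) : exists n : nat, s%:E <= umeas u (seg n%:R).
Proof.
apply: contrapT => /forallNP H.
have := umeas_lim uw (measurableT : measurable ([set: R] : mset)); rewrite umeas_setT => cv.
suff : +oo <= s%:E by [].
rewrite -[X in X <= _](cvg_lim _ cv)//; apply: lime_le; first by apply/cvg_ex; eexists; exact: cv.
by apply: nearW => n; rewrite setTI; have /negP := H n; rewrite -ltNge => /ltW.
Qed.

Lemma umeas_itv_fin (a b : R) : umeas u `[a, b]%classic \is a fin_num.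
Proof.
case: uw => _ /(_ _ (@segment_compact _ a b)) ui _.
exact: (integrable_fin_num _ ui).
Qed.

Lemma quantile (a b s : R) : (a <= b)%R -> (0 <= s)%R -> s%:E <= umeas u `[a, b]%classic ->
  exists2 c : R, (a <= c <= b)%R & umeas u `[a, c]%classic = s%:E.
Proof.
move=> ab s0 sb; case: (uw) => _ /(_ _ (@segment_compact _ a b)) ui _.
have cF := parameterized_integral_continuous ab ui.
have FE x : (parameterized_integral mu a x u)%:E = umeas u `[a, x]%classic.
  by rewrite -[RHS]fineK// umeas_itv_fin.
have Fa : parameterized_integral mu a a u = 0%R.
  by apply: EFin_inj; rewrite FE set_itv1 /umeas integral_set1.
have [|c] := IVT ab cF (v := s).
  rewrite Fa; apply/andP; split; first by rewrite ge_min s0.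
  by rewrite le_max; apply/orP; right; rewrite -lee_fin FE.
by rewrite in_itv/= => cab cs; exists c => //; rewrite -FE cs.
Qed.

Lemma umeas_step (a b c s t : R) : (a <= b <= c)%R -> umeas u `[a, b]%classic = s%:E ->
  umeas u `[a, c]%classic = t%:E -> umeas u `[b, c]%classic = (t - s)%:E.
Proof.
rewrite {3}/umeas -integral_itv_obnd_cbnd; last first.
  by apply/measurable_EFinP; apply: measurable_funTS; case: uw.
rewrite -/(umeas u _).
move=> /andP[ab bc] us; rewrite (umeas_split uw (F := `[a, b]%classic))//.
have -> : `[a, c]%classic `&` `[a, b]%classic = `[a, b]%classic :> set R.
  apply: setIidr => y /=; rewrite !in_itv/= => /andP[-> h]; exact: le_trans bc.
have -> : `[a, c]%classic `\` `[a, b]%classic = `]b, c]%classic :> set R.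
  apply/seteqP; split => y /=; rewrite !in_itv/=.
    by move=> [/andP[h1 ->]]; rewrite h1/= andbT => /negP; rewrite -ltNge.
  move=> /andP[h1 h2]; split; first by rewrite h2 andbT (le_trans ab)// ltW.
  by apply/negP; rewrite negb_and -!ltNge h1 orbT.
rewrite us; have := umeas_ge0 uw (measurable_itv (`]b, c]) : measurable (`]b, c]%classic : mset)).
by case: (umeas u _) => //= x _ [<-]; congr _%:E; ring.
Qed.

(** An interval of measure [3 s] exists because [u] has infinite total mass. One of its three parts
    of measure [s] has at least a third of its length; on the rest of [[a, d]] the transform of the
    indicator of that part is then at least [1 / 3], however unevenly [u] is distributed. *)
Lemma long_third (s : R) : (0 < s)%R -> exists a b c d : R, [/\ (a <= b)%R, (c <= d)%R,
  (0 < d - a <= 3 * (c - b))%R, umeas u `[b, c]%classic = s%:E & umeas u `[a, d]%classic = (3 * s)%:E].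
Proof.
move=> s0; have [n nP] := umeas_seg_large (3 * s).
pose a : R := (- n%:R)%R.
have an : (a <= n%:R)%R by rewrite /a; have : (0 <= n%:R :> R)%R by []; lra.
rewrite (_ : seg n%:R = `[a, n%:R]%classic) in nP; last first.
  by apply/seteqP; split => x /=; rewrite /seg/= in_itv/= ler_norml.
have s3 : (0 <= 3 * s)%R by lra. have s2 : (0 <= 2 * s)%R by lra.
have [d /andP[ad _] ud] := quantile an s3 nP.
have [c /andP[ac cd] uc] : exists2 c : R, (a <= c <= d)%R & umeas u `[a, c]%classic = (2 * s)%:E.
  by apply: quantile => //; rewrite ud lee_fin; lra.
have [b /andP[ab bc] ub] : exists2 b : R, (a <= b <= c)%R & umeas u `[a, b]%classic = s%:E.
  by apply: quantile => //; [exact: ltW|rewrite uc lee_fin; lra].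
have ud0 : (a < d)%R.
  rewrite lt_neqAle ad andbT; apply/eqP => ad'; move: ud; rewrite -ad' set_itv1 /umeas integral_set1.
  by move=> [/eqP]; rewrite eq_sym gt_eqF//; lra.
have u2 : umeas u `[b, c]%classic = s%:E.
  by rewrite (umeas_step (a := a) (s := s) (t := 2 * s)) ?ab//; congr _%:E; ring.
have u3 : umeas u `[c, d]%classic = s%:E.
  by rewrite (umeas_step (a := a) (s := 2 * s) (t := 3 * s)) ?ac//; congr _%:E; ring.
have [h1|h1] := leP (d - a)%R (3 * (b - a))%R.
  by exists a, a, b, d; split=> //; [exact: le_trans cd|rewrite h1 subr_gt0 ud0].
have [h2|h2] := leP (d - a)%R (3 * (c - b))%R.
  by exists a, b, c, d; split=> //; rewrite h2 subr_gt0 ud0.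
exists a, c, d, d; split=> //; rewrite subr_gt0 ud0/=; lra.
Qed.

(** On [S], of measure [2 s], the transform of the indicator of [J] is at least [1 / 3 > e^(- 2)].
    So [W(2 s)] is at most the gauge of its level at [- 2], which the weak estimate bounds by a
    multiple of [Phi J = W(s)]. *)
Lemma doubling : exists2 D : R, (1 <= D)%R & forall s : R, (0 < s)%R ->
  wI w (2 * s)%:E <= D%:E * wI w s%:E.
Proof.
have [C C0 hC] := hilbert_levels; have g0 := ltW (geo_gt0 p0).
have D0 : (0 <= expR (2 * p) * (C * geo p))%R by rewrite !mulr_ge0.
(* The summand 1 only ensures [D >= 1]. *)
exists (1 + expR (2 * p) * (C * geo p))%R; first by rewrite lerDl.
move=> s s0; have W0 := wI_ge0 ww s%:E.
apply: (@le_trans _ _ ((expR (2 * p) * (C * geo p))%:E * wI w s%:E)); last first.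
  by apply: lee_wpmul2r => //; rewrite lee_fin lerDr.
have [a [b [c [d [ab cd /andP[da dcb] ubc uad]]]]] := long_third s0.
pose J : mset := `[b, c]%classic; have mJ : measurable J by exact: measurable_itv.
have PJ : Phi J = wI w s%:E by rewrite /gaugeW ubc.
have JE x : J x = (b <= x <= c)%R :> Prop by rewrite /J/= in_itv.
have bc : (b < c)%R by lra.
have PJf : Phi J < +oo by rewrite PJ wI_lt_pinfty.
have mf : measurable_fun setT (\1_J : R -> R) by exact: measurable_indic.
have Df : dsum 1 p \1_J < +oo.
  by apply: (le_lt_trans (dsum_indic mJ PJf)); rewrite lte_mul_pinfty ?lee_fin.
have [Hf [mHf pHf] lHf] := hC _ mf Df.
pose S : mset := `[a, d]%classic `\` J.
have mS : measurable S by apply: measurableD => //; exact: measurable_itv.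
have uS : umeas u S = (2 * s)%:E.
  have := umeas_split uw (measurable_itv `[a, d] : measurable (`[a, d]%classic : mset)) mJ.
  rewrite uad setIidr; last first.
    move=> y; rewrite JE /= in_itv/= => /andP[h1 h2].
    by rewrite (le_trans h2 cd) andbT (le_trans ab).
  rewrite -/S /J ubc; have := umeas_ge0 uw mS.
  by case: (umeas u S) => //= x _ [h]; congr _%:E; lra.
have far_lower x : (a <= x <= d)%R -> ~ (b <= x <= c)%R -> pvint \1_J x (Hf x) -> (3^-1 <= `|Hf x|)%R.
  move=> /andP[ax xd] nx px; apply: le_trans (pvint_indic_lower bc px nx (T := (d - a)%R) _ _ _) => //.
  - by rewrite ler_pdivlMr//; lra.
  - by rewrite ler_norml; lra.
  - by rewrite ler_norml; lra.
have PS : Phi S <= lev Phi Hf (- 2).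
  apply: le_gaugeW => //; first exact: measurable_gt_norm.
  apply: ae_imp pHf => x px; rewrite /S => -[/=]; rewrite in_itv/= => xad nJ.
  have e2 : (expR (- 2) < 3^-1 :> R)%R.
    rewrite expRN ltf_pV2 ?posrE ?expR_gt0// (_ : 2 = 1 + 1)%R// expRD.
    by have := expR_ge1Dx (1 : R); nra.
  apply: lt_le_trans e2 _; exact: far_lower.
rewrite -uS; apply: (le_trans PS).
rewrite -[leLHS]mul1e -ex0 -(addNr (p * - 2)%R) exD -muleA mulrN opprK EFinM -muleA mulrC.
rewrite [(2 * p)%R]mulrC; apply: lee_wpmul2l; first exact: ex_ge0.
rewrite -mulrN; apply: (le_trans (lHf _)); rewrite EFinM -muleA -PJ.
by apply: lee_wpmul2l => //; exact: dsum_indic.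
Qed.

(** A zero of [W] would spread by doubling to the whole half-line, against [Phi setT = +oo]. *)
Lemma wI_gt0 (t : R) : (0 < t)%R -> 0 < wI w t%:E.
Proof.
move=> t0; rewrite lt0e (wI_ge0 ww) andbT; apply/eqP => Wt.
have [D D1 dbl] := doubling.
have z n : wI w (2 ^+ n * t)%:E = 0.
  elim: n => [|n IH]; first by rewrite expr0 mul1r.
  apply/eqP; rewrite eq_le (wI_ge0 ww) andbT.
  have := dbl (2 ^+ n * t)%R; rewrite IH mule0 mulrA -exprS; apply.
  by rewrite mulr_gt0// exprn_gt0.
have : wI w +oo <= 0.
  apply: (wI_sup ww (s := fun n => (2 ^+ n * t)%:E)) => [m n mn|x _|n]; last by rewrite z.
    by rewrite lee_fin ler_pM2r// ler_weXn2l//; lra.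
  exists (Num.truncn (x / t)).+1; rewrite lte_fin -ltr_pdivrMr//.
  apply: (lt_trans (truncnS_gt _)); rewrite -natrX ltr_nat; exact: ltn_expl.
by rewrite -umeas_setT -/(gaugeW u w setT) gaugeW_setT.
Qed.

Lemma wI_add (D : R) (a b : \bar R) : (1 <= D)%R -> (forall s : R, (0 < s)%R -> wI w (2 * s)%:E <= D%:E * wI w s%:E) ->
  0 <= a -> a <= b -> wI w (a + b) <= D%:E * wI w b.
Proof.
move=> D1 dbl a0; case: b => [b||] ab; last by have := le_trans a0 ab.
  have [b0|b0] := ltP 0%R b.
    apply: le_trans (dbl b b0); apply: (le_wI ww).
    by rewrite (_ : 2 * b = b + b)%R ?EFinD ?leeD2r//; ring.
  have bz : b%:E = 0 by apply/eqP; rewrite eq_le lee_fin b0/= (le_trans a0 ab).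
  have az : a = 0 by apply/eqP; rewrite eq_le a0 andbT -bz.
  by rewrite bz az add0e wI_le0// mule0.
rewrite -[leLHS]mul1e; apply: lee_pmul => //; rewrite ?lee_fin//; first exact: (wI_ge0 ww).
by apply: (le_wI ww); exact: leey.
Qed.

(** Quasi-subadditivity is doubling, as [a + b] is at most twice the larger of the two. Smallness
    composes the absolute continuity of [W] at 0 with that of [u]. *)
Lemma weight_gauge : exists K, gauge Phi K.
Proof.
have [D D1 dbl] := doubling; have D0 : (0 <= D)%R by lra.
exists D; split; first exact: D1.
- by move=> E; exact: (wI_ge0 ww).
- by move=> E F mE mF EF; exact: le_gaugeW.
- move=> E F mE mF; apply: (@le_trans _ _ (wI w (umeas u E + umeas u F))).
    by apply: (le_wI ww); exact: (umeasU uw).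
  have E0 := umeas_ge0 uw mE; have F0 := umeas_ge0 uw mF.
  have PE := wI_ge0 ww (umeas u E); have PF := wI_ge0 ww (umeas u F).
  have D0' : 0 <= D%:E by rewrite lee_fin.
  rewrite /gaugeW.
  case: (leP (umeas u E) (umeas u F)) => [EF|/ltW FE].
    apply: (le_trans (wI_add D1 dbl E0 EF)); apply: lee_wpmul2l; first exact: D0'.
    by move: (wI w (umeas u E)) (wI w (umeas u F)) PE PF => a b a0 b0; rewrite leeDr.
  rewrite addeC; apply: (le_trans (wI_add D1 dbl F0 FE)); apply: lee_wpmul2l; first exact: D0'.
  by rewrite leeDl.
- move=> L; rewrite /gaugeW; have := umeas_seg_fin uw L; have := umeas_ge0 uw (measurable_seg L).
  by case: (umeas u _) => // a _ _; exact: wI_lt_pinfty.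
- move=> L e e0; have [t t0 tP] := wI_small ww ltr01 (Wfin ltr01) e0.
  have [d d0 dP] := umeas_small uw L t0; exists d => // E mE EL muE.
  by apply: le_trans tP; apply: (le_wI ww); exact: dP.
- move=> E c mE Ec.
  have mEn (n : nat) : measurable (E `&` seg (n%:R : R)) by apply: measurableI => //; exact: measurable_seg.
  apply: (wI_sup ww (s := fun n => umeas u (E `&` seg n%:R))) => //.
    move=> m n mn; apply: (le_umeas uw) => //; apply/aeW => x [Ex /= hx]; split => //=.
    by rewrite /seg/= (le_trans hx)// ler_nat.
  move=> t tE; apply: contrapT => /forallNP H; move: tE; rewrite ltNge => /negP; apply.
  have cv := umeas_lim uw mE.
  rewrite -[X in X <= _](cvg_lim _ cv)//; apply: lime_le; first by apply/cvg_ex; eexists; exact: cv.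
  by apply: nearW => n; rewrite leNgt; exact/negP/H.
- have mS := measurable_seg (2^-1 : R).
  have : umeas u (seg 2^-1) != 0.
    apply/eqP => /(umeas_eq0 uw mS) /eqP; rewrite measure_seg ?invr_gt0// eqe.
    by rewrite mulfV// oner_eq0.
  rewrite /gaugeW; have := umeas_ge0 uw mS; have := umeas_seg_fin uw 2^-1.
  case: (umeas u _) => // a _ a0 an; apply: wI_gt0.
  by rewrite -lte_fin lt0e an.
Qed.

Lemma weight_weak_bound : exists2 C : R, (0 <= C)%R & weak_bound Phi p C.
Proof.
have [C C0 hC] := hilbert_levels; exists C => // f mf ffin.
have [Hf pHf lHf] := hC f mf ffin; split; first by exists Hf.
move=> Hf' pHf' t; apply: le_trans (lHf t); apply: lee_wpmul2l; first exact: ex_ge0.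
have [mHf _] := pHf; have [mHf' _] := pHf'.
apply: le_gaugeW; [exact: measurable_gt_norm|exact: measurable_gt_norm|].
by apply: ae_imp (pv_ae_unique pHf' pHf) => x /= ->.
Qed.

End doubling.

(** * The case of infinite [W] *)

Section degenerate_weight.
Context {R : realType}.
Local Notation mu := (@lebesgue_measure R).
Local Notation mset := (set (measurableTypeR R)).
Local Open Scope ereal_scope.
Variables (u w : R -> R).
Hypotheses (uw : weight_R u) (ww : weight_pos w).
Implicit Type f : R -> R.

Lemma lorentz_norm_cst0 (r : R) : (0 < r)%R -> lorentz_norm u w r (cst 0%R) = 0.
Proof.
move=> r0; have : lorentz_int u w r (cst 0%R) <= 0.
  apply: (le_trans (lorentz_int_le_dsum _ ww r0 (measurable_cst _))).
  rewrite /dsum /zsum esum1 ?mule0// => k _.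
  rewrite /lev (_ : [set x | _] = set0); last first.
    by apply/seteqP; split => x //=; rewrite normr0 ltNge expR_ge0.
  by rewrite /gaugeW umeas0 (wI_le0 w (lexx _)) mule0.
rewrite /lorentz_norm -/(lorentz_int u w r (cst 0%R)).
have := lorentz_int_ge0 u ww r (cst 0%R) => h1 h2.
have -> : lorentz_int u w r (cst 0%R) = 0 by apply/eqP; rewrite eq_le h1 h2.
by rewrite poweR0r// invr_neq0 ?gt_eqF.
Qed.

(** A level set of positive [u]-measure would have infinite gauge, and hence give an infinite term
    of the dyadic sum; so all level sets at [e^(- n)] are null. *)
Lemma lorentz_fin_ae0 (r : R) f : (forall t : R, (0 < t)%R -> Wfun w t = +oo) -> (0 < r)%R ->
  measurable_fun setT f -> lorentz_norm u w r f < +oo -> {ae mu, forall x, f x = 0%R}.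
Proof.
move=> Winf r0 mf Nf.
have If : lorentz_int u w r f < +oo.
  by apply: (lty_poweRy _ Nf); rewrite invr_neq0 ?gt_eqF.
have Df : dsum (gaugeW u w) 1 r f < +oo.
  apply: (le_lt_trans (dsum_le_lorentz_int uw ww r0 mf)).
  by rewrite lte_mul_pinfty ?lee_fin ?(ltW (geo_gt0 r0)).
have null (n : nat) : {ae mu, forall x, `|f x| <= expR (- n%:R)}%R.
  set E : mset := [set x | (expR (- n%:R) < `|f x|)%R].
  have mE : measurable E by exact: measurable_gt_norm.
  have PE : gaugeW u w E < +oo.
    have : ex (1 * r * (- n%:Z)%:~R) * lev (gaugeW u w) f (1 * (- n%:Z)%:~R) < +oo.
      apply: le_lt_trans Df.
      apply: (@zsum_term _ (fun k => ex (1 * r * k%:~R) * lev (gaugeW u w) f (1 * k%:~R))) => k.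
      by rewrite mule_ge0 ?ex_ge0// (wI_ge0 ww).
    rewrite !mul1r mulrNz -pmulrn /lev -/E; have := wI_ge0 ww (umeas u E); rewrite -/(gaugeW u w E).
    case: (gaugeW u w E) => [a _ _|_|//]; first exact: ltry.
    by rewrite gt0_muley ?ex_gt0.
  have U0 : umeas u E = 0.
    apply/eqP; rewrite eq_le (umeas_ge0 uw mE) andbT leNgt; apply/negP => Upos.
    have [t t0 tE] : exists2 t : R, (0 < t)%R & t%:E <= umeas u E.
      move: Upos; case: (umeas u E) => [a|_|//]; first by rewrite lte_fin => a0; exists a.
      by exists 1%R => //; exact: leey.
    by move: PE; rewrite ltNge (le_trans _ (le_wI ww tE))// (wI_Wfun ww) Winf.
  exists E; split => //; first exact: umeas_eq0 U0.
  by move=> x /= /negP; rewrite -ltNge.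
apply: ae_imp (ae_foralln null) => x fx; apply/eqP; rewrite -normr_le0; apply/ler_addgt0Pr => e e0.
rewrite add0r; apply: (le_trans (fx (Num.truncn e^-1).+1)).
rewrite expRN -[leRHS]invrK lef_pV2 ?posrE ?expR_gt0 ?invr_gt0//.
by rewrite ltW// (lt_le_trans (truncnS_gt _))// (le_trans _ (expR_ge1Dx _))// lerDr.
Qed.

Lemma pvint_ae0 f x : measurable_fun setT f -> {ae mu, forall y, f y = 0%R} -> pvint f x 0%R.
Proof.
move=> mf f0; have mfx : measurable_fun setT (fun y => (f y / (x - y))%:E).
  by apply/measurable_EFinP; exact: measurable_div_sub.
have I0 : \int[mu]_y `|(f y / (x - y))%:E| = 0.
  apply/(ae_eq_integral_abs _ measurableT) => //.
  by apply: ae_imp f0 => y fy _; rewrite fy mul0r.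
have iF : mu.-integrable setT (fun y => (f y / (x - y))%:E) by apply/integrableP; rewrite I0.
have -> : 0%R = Rintegral mu setT (fun y => (f y / (x - y))%R); last exact: pvint_integrable.
apply/esym/eqP; rewrite -normr_le0; apply: (le_trans (le_normr_Rintegral _ iF)) => //.
by rewrite /Rintegral I0.
Qed.

End degenerate_weight.

Theorem theorem3p1 (R : realType) (u w : R -> R) (p : R) :
  weight_R u -> weight_pos w -> 0 < p ->
  hilbert_bounded (lorentz_norm u w p) (weak_lorentz_norm u w p) ->
  forall r : R, p < r ->
    hilbert_bounded (lorentz_norm u w r) (lorentz_norm u w r).
Proof.
move=> uw ww p0 hb r pr; have r0 := lt_trans p0 pr.
have [[t t0 Wt]|Wfin] := pselect (exists2 t, 0 < t & Wfun w t = +oo%E).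
  (* With [W] infinite only functions vanishing almost everywhere have finite quasi-norm, so the
     zero transform and the constant 0 serve. *)
  exists 0 => f mf Nf; exists (cst 0); split.
  - exact: measurable_cst.
  - have f0 := lorentz_fin_ae0 uw ww (fun s s0 => Wfun_pinfty ww t0 s0 Wt) r0 mf Nf.
    by apply/aeW => x; apply/hilbert_pvE; rewrite /= mulr0; exact: pvint_ae0.
  - by rewrite lorentz_norm_cst0// mul0e.
have {}Wfin t : 0 < t -> (Wfun w t < +oo)%E.
  by move=> t0; rewrite ltey; apply/eqP => Wt; apply: Wfin; exists t.
have [K gP] := weight_gauge uw ww p0 hb Wfin.
have [C C0 wb] := weight_weak_bound uw ww p0 hb.
have [A A0 sb] := weak_strong gP p0 C0 wb pr.
have g0 := ltW (geo_gt0 r0); pose B := expR r * (A * geo r).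
have B0 : 0 <= B by rewrite !mulr_ge0// expR_ge0.
(* [B] collects the passage from the integral to the dyadic sum ([geo r]), the strong bound ([A])
   and the passage back ([expR r]); the root converts integrals into quasi-norms. *)
exists (B `^ r^-1) => f mf Nf.
have If : (lorentz_int u w r f < +oo)%E by apply: (lty_poweRy _ Nf); rewrite invr_neq0 ?gt_eqF.
have Df := dsum_le_lorentz_int uw ww r0 mf.
have ffin : (dsum (gaugeW u w) 1 r f < +oo)%E.
  by apply: (le_lt_trans Df); rewrite lte_mul_pinfty ?lee_fin.
have [Hf [mHf pHf] bHf] := sb f mf ffin.
have mH : measurable_fun setT (fun x => pi^-1 * Hf x) by exact: measurable_funM.
exists (fun x => pi^-1 * Hf x); split => //.
  apply: ae_imp pHf => x; rewrite hilbert_pvE mulrA mulfV ?mul1r// gt_eqF//; exact: pi_gt0.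
have I0 g : (0 <= lorentz_int u w r g)%E by exact: (lorentz_int_ge0 _ ww).
have le1 : (lorentz_int u w r (fun x => pi^-1 * Hf x)%R <= B%:E * lorentz_int u w r f)%E.
  apply: (le_trans (lorentz_int_le_dsum _ ww r0 mH)).
  rewrite /B EFinM -muleA; apply: lee_wpmul2l; first exact: ex_ge0.
  (* Since [1 / pi <= 1], the normalising factor is simply dropped. *)
  apply: (@le_trans _ _ (dsum (gaugeW u w) 1 r Hf)).
    apply: (le_dsum gP) => //; apply/aeW => x; rewrite normrM ger0_norm ?invr_ge0 ?pi_ge0//.
    by rewrite ler_piMl// invf_le1 ?pi_gt0// (le_trans _ (pi_ge2 R))// ler1n.
  apply: (le_trans bHf); rewrite EFinM -muleA.
  by apply: lee_wpmul2l; rewrite ?lee_fin.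
rewrite -poweR_EFin -poweRM ?lee_fin//.
apply: gt0_ler_poweR => //.
- by rewrite invr_ge0 ltW.
- by rewrite in_itv/= I0 leey.
- by rewrite in_itv/= leey andbT; apply: mule_ge0; [rewrite lee_fin|exact: I0].
- exact: (I0 f).
Qed.
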